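(* For all simple Lie algebras $\mathfrak g_1$ and $\mathfrak g_2$, base fields $\mathbb K$, and $q\in\mathbb K^*$ not a root of unity, (for each choice of sign) $$\mathcal{U}_q^\pm(\mathfrak g_1)\cong\mathcal{U}_q^\pm(\mathfrak g_2)\ \text{ (as }\mathbb K\text{-algebras)}\quad\text{if and only if}\quad\mathfrak g_1\cong\mathfrak g_2.$$
   Context: For a complex simple Lie algebra $\mathfrak g$ with set of simple roots $\Pi$: $\langle\cdot,\cdot\rangle$ is the Weyl group invariant bilinear form on $\mathbb{R}\Pi$ with $\langle\alpha,\alpha\rangle=2$ for short simple roots; $a_{\alpha\alpha'}=2\langle\alpha,\alpha'\rangle/\langle\alpha,\alpha\rangle$; $q_\alpha=q^{\langle\alpha,\alpha\rangle/2}$. $\mathcal{U}_q^-(\mathfrak g)$ is the unital associative $\mathbb K$-algebra with generators $F_\alpha$ ($\alpha\in\Pi$) and relations $$\sum_{j=0}^{1-a_{\alpha\alpha'}}(-1)^j\begin{bmatrix}1-a_{\alpha\alpha'}\\ j\end{bmatrix}_{q_\alpha}F_\alpha^{\,j}F_{\alpha'}F_\alpha^{\,1-a_{\alpha\alpha'}-j}=0,\qquad \alpha\ne\alpha'\in\Pi,$$ where $\begin{bmatrix}m\\ j\end{bmatrix}_q=[m]_q!/([j]_q![m-j]_q!)$, $[m]_q!=[1]_q\cdots[m]_q$, $[m]_q=(q^m-q^{-m})/(q-q^{-1})$; $\mathcal{U}_q^+(\mathfrak g)$ is defined by the same relations with generators $E_\alpha$ in place of $F_\alpha$. *)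

(* Defs.v *)
From HB Require Import structures.
From mathcomp Require Import all_boot all_order all_algebra.
From mathcomp Require Import boolp reals.
From mathcomp Require Import complex.
From mathcomp Require Import monalg.

Set Implicit Arguments.
Unset Strict Implicit.
Unset Printing Implicit Defensive.

Import Order.TTheory GRing.Theory Num.Theory.
Local Open Scope ring_scope.
Local Open Scope quotient_scope.

(* Finite-dimensionality is part of vectType. *)
HB.mixin Record Vector_isLie (F : fieldType) g of Vector F g := {
  lie : g -> g -> g;
  lie_is_linearl : forall y, linear (lie^~ y);
  lie_is_linearr : forall x, linear (lie x);
  liexx : forall x, lie x x = 0;
  lie_jacobi : forall x y z,
    lie x (lie y z) + lie y (lie z x) + lie z (lie x y) = 0
}.

#[short(type="lieAlgType")]
HB.structure Definition LieAlgebra (F : fieldType) :=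
  { g of Vector_isLie F g & Vector F g }.

Section LieAlgebraNotions.
Variables (F : fieldType) (g : lieAlgType F).
Implicit Types (J h : {vspace g}) (x y : g).

Definition lie_ideal J := forall x y, y \in J -> lie x y \in J.

Definition lie_simple :=
  (exists x y : g, lie x y != 0) /\
  (forall J, lie_ideal J -> J = 0%VS \/ J = fullv).

Definition lie_subalgebra h := {in h &, forall x y, lie x y \in h}.

Definition ad_diagonalizable x :=
  exists2 b : seq g, basis_of fullv b
    & {in b, forall y, exists c : F, lie x y = c *: y}.

Definition toral h := lie_subalgebra h /\ {in h, forall x, ad_diagonalizable x}.

(* Over an algebraically closed field of characteristic 0 and for a semisimple
   g, the Cartan subalgebras are the maximal toral subalgebras. *)
Definition cartan_subalgebra h :=
  toral h /\ (forall h', toral h' -> (h <= h')%VS -> h' = h).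

End LieAlgebraNotions.

Definition lie_isomorphic (F : fieldType) (g1 g2 : lieAlgType F) :=
  exists2 f : {linear g1 -> g2}, bijective f & {morph f : x y / lie x y}.

Section Roots.
Variables (R : realType) (g : lieAlgType R[i]) (h : {vspace g}).

Definition dual := 'Hom(subvs_of h, R[i]^o).
Implicit Types (al be la mu : dual) (Pi : seq dual).

Definition in_root_space al (x : g) :=
  forall t : subvs_of h, lie (vsval t) x = (al t : R[i]) *: x.

Definition is_root al := al != 0 /\ exists2 x : g, x != 0 & in_root_space al x.

(* The coroot of al is the unique t in [g_al, g_(-al)] with al(t) = 2. *)
Definition is_coroot al (t : subvs_of h) :=
  (exists x y : g, [/\ in_root_space al x, in_root_space (- al) y
                     & vsval t = lie x y])
  /\ al t = 2.

Inductive weyl_group : (dual -> dual) -> Prop :=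
| weyl_id : weyl_group id
| weyl_reflection al t w : is_root al -> is_coroot al t -> weyl_group w ->
    weyl_group (fun la => w la - (w la t : R[i]) *: al).

(* For a semisimple g the C-basis of h^* below is also an R-basis of the real
   span of the roots. *)
Definition simple_system Pi :=
  [/\ basis_of fullv Pi, {in Pi, forall al, is_root al}
    & forall be, is_root be -> exists c : 'I_(size Pi) -> nat,
        be = \sum_(i < size Pi) Pi`_i *+ c i \/
        be = - \sum_(i < size Pi) Pi`_i *+ c i].

(* The real vector space RPi, as a subset of the complex space h^*. *)
Definition real_span Pi la :=
  exists c : 'I_(size Pi) -> R, la = \sum_(i < size Pi) ((c i)%:C)%C *: Pi`_i.

(* A form on RPi is a function on h^* whose values outside RPi are ignored. *)
Definition bilinear_on_real_span Pi (form : dual -> dual -> R) :=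
  forall la la' mu (a : R), real_span Pi la -> real_span Pi la' ->
    real_span Pi mu ->
    form ((a%:C)%C *: la + la') mu = a * form la mu + form la' mu /\
    form mu ((a%:C)%C *: la + la') = a * form mu la + form mu la'.

Definition weyl_invariant Pi (form : dual -> dual -> R) :=
  forall w la mu, weyl_group w -> real_span Pi la -> real_span Pi mu ->
    form (w la) (w mu) = form la mu.

(* When all simple roots have the same length, they are all short. *)
Definition short Pi (form : dual -> dual -> R) al :=
  {in Pi, forall be, form al al <= form be be}.

Definition normalized_form Pi (form : dual -> dual -> R) :=
  [/\ bilinear_on_real_span Pi form, weyl_invariant Pi form
    & {in Pi, forall al, short Pi form al -> form al al = 2}].

End Roots.

(* The choices behind "the set of simple roots of g": a Cartan subalgebra and
   a base of its root system; for a simple g these determine the normalized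
   form on the real span of the base. *)
Record root_data (R : realType) (g : lieAlgType R[i]) := RootData {
  cartan : {vspace g};
  cartanP : cartan_subalgebra cartan;
  simple_roots : seq (dual cartan);
  simple_rootsP : simple_system simple_roots;
  root_form : dual cartan -> dual cartan -> R;
  root_formP : normalized_form simple_roots root_form
}.

Section CartanIntegers.
Variables (R : realType) (g : lieAlgType R[i]) (D : root_data g).

Definition rank := size (simple_roots D).

Definition simple_root (i : 'I_rank) : dual (cartan D) := (simple_roots D)`_i.

Definition cartan_integer (i j : 'I_rank) : R :=
  2 * root_form (simple_root i) (simple_root j)
    / root_form (simple_root i) (simple_root i).

(* Num.truncn only turns these real numbers, which are natural numbers,
   into elements of nat. *)
Definition serre_order (i j : 'I_rank) : nat :=
  Num.truncn (1 - cartan_integer i j).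

Definition half_length (i : 'I_rank) : nat :=
  Num.truncn (root_form (simple_root i) (simple_root i) / 2).

End CartanIntegers.

(* Unital associative algebras given by generators and relations: quotients of
   the free algebra {malg K[{fmonom I}]} by the two-sided ideal generated by
   the relators.  As nzRingType and algType exclude the zero ring, the relators
   are required to have no constant term, so that 1 is not in the ideal. *)

Section PresentedAlgebra.
Variables (K : fieldType) (I : choiceType).

Local Notation free_algebra := {malg K[{fmonom I}]}.

Definition free_gen (i : I) : free_algebra := << fmu i >>.

Record relators := Relators {
  relator :> free_algebra -> Prop;
  relator_const0 : forall r, relator r -> mcoeff (mone : {fmonom I}) r = 0
}.

Inductive relator_ideal (S : relators) : free_algebra -> Prop :=
| relator_ideal_gen r : S r -> relator_ideal S r
| relator_ideal0 : relator_ideal S 0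
| relator_idealB x y :
    relator_ideal S x -> relator_ideal S y -> relator_ideal S (x - y)
| relator_idealM a x b : relator_ideal S x -> relator_ideal S (a * x * b).

Variable S : relators.

Lemma relator_ideal_const0 x : relator_ideal S x -> mcoeff (mone : {fmonom I}) x = 0.
Proof.
elim=> [r /relator_const0|||a y b _ y0] //; first by rewrite mcoeff0.
- by move=> y z _ y0 _ z0; rewrite mcoeffB y0 z0 subr0.
- by rewrite !rmorphM /= y0 mulr0 mul0r.
Qed.

Definition relator_ideal_pred : pred free_algebra :=
  fun x => `[< relator_ideal S x >].

Lemma relator_ideal_zmod_closed : zmod_closed relator_ideal_pred.
Proof.
split; first by apply/asboolP; exact: relator_ideal0.
by move=> x y /asboolP Sx /asboolP Sy; apply/asboolP; exact: relator_idealB.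
Qed.

HB.instance Definition _ :=
  GRing.isZmodClosed.Build free_algebra relator_ideal_pred
    relator_ideal_zmod_closed.

Definition relator_zmod_closed : zmodClosed free_algebra :=
  GRing.ZmodClosed.clone free_algebra relator_ideal_pred _.

Definition presented_algebra : Type := Quotient.quot relator_zmod_closed.
HB.instance Definition _ := GRing.Zmodule.on presented_algebra.

Definition presented_pi (x : free_algebra) : presented_algebra :=
  \pi_(Quotient.quot relator_zmod_closed) x.

Lemma presented_pi_surj (x : presented_algebra) : exists y, presented_pi y = x.
Proof. by exists (repr x); rewrite /presented_pi reprK. Qed.

Lemma presented_piE x y :
  presented_pi x = presented_pi y <-> relator_ideal S (x - y).
Proof.
rewrite /presented_pi; split=> [/eqP|Sxy].
  by rewrite -Quotient.idealrBE => /asboolP.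
by apply/eqP; rewrite -Quotient.idealrBE; apply/asboolP.
Qed.

Lemma presented_piD : {morph presented_pi : x y / x + y}.
Proof. by move=> x y; rewrite /presented_pi -[RHS]pi_addr. Qed.

Let repr_pi x : relator_ideal S (repr (presented_pi x) - x).
Proof. by apply/presented_piE; rewrite /presented_pi reprK. Qed.

Definition presented_mul (x y : presented_algebra) : presented_algebra :=
  presented_pi (repr x * repr y).

Lemma presented_piM x y :
  presented_pi (x * y) = presented_mul (presented_pi x) (presented_pi y).
Proof.
apply/esym/presented_piE; set x' := repr _; set y' := repr _.
have ->: x' * y' - x * y = 1 * (x' - x) * y' - - (x * (y' - y) * 1).
  by rewrite opprK mul1r mulr1 mulrBl mulrBr addrA subrK.
have relN z : relator_ideal S z -> relator_ideal S (- z).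
  by move=> Sz; rewrite -sub0r; apply: relator_idealB Sz; exact: relator_ideal0.
by apply: relator_idealB; [|apply: relN]; apply: relator_idealM; exact: repr_pi.
Qed.

Definition presented_scale (c : K) (x : presented_algebra) : presented_algebra :=
  presented_pi (c *: repr x).

Lemma presented_piZ c x :
  presented_pi (c *: x) = presented_scale c (presented_pi x).
Proof.
apply/esym/presented_piE; rewrite -scalerBr.
have ->: c *: (repr (presented_pi x) - x)
         = c%:MP * (repr (presented_pi x) - x) * 1 by rewrite mul_malgC mulr1.
by apply: relator_idealM; exact: repr_pi.
Qed.

Local Notation pi := presented_pi.
Local Notation surj := presented_pi_surj.

Fact presented_mulA : associative presented_mul.
Proof.
move=> x y z; have [[a <-] [b <-] [c <-]] := And3 (surj x) (surj y) (surj z).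
by rewrite -!presented_piM mulrA.
Qed.

Fact presented_mul1r : left_id (pi 1) presented_mul.
Proof. by move=> x; have [a <-] := surj x; rewrite -presented_piM mul1r. Qed.

Fact presented_mulr1 : right_id (pi 1) presented_mul.
Proof. by move=> x; have [a <-] := surj x; rewrite -presented_piM mulr1. Qed.

Fact presented_mulDl : left_distributive presented_mul +%R.
Proof.
move=> x y z; have [[a <-] [b <-] [c <-]] := And3 (surj x) (surj y) (surj z).
by rewrite -presented_piD -!presented_piM mulrDl presented_piD.
Qed.

Fact presented_mulDr : right_distributive presented_mul +%R.
Proof.
move=> x y z; have [[a <-] [b <-] [c <-]] := And3 (surj x) (surj y) (surj z).
by rewrite -presented_piD -!presented_piM mulrDr presented_piD.
Qed.

Fact presented_1_neq0 : pi 1 != 0.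
Proof.
apply/eqP; have -> : 0 = pi 0 by rewrite /presented_pi -[LHS]pi_zeror.
move/presented_piE/relator_ideal_const0/eqP.
by rewrite subr0 rmorph1 oner_eq0.
Qed.

HB.instance Definition _ := GRing.Zmodule_isNzRing.Build presented_algebra
  presented_mulA presented_mul1r presented_mulr1 presented_mulDl
  presented_mulDr presented_1_neq0.

Fact presented_scaleA a b x :
  presented_scale a (presented_scale b x) = presented_scale (a * b) x.
Proof. by have [y <-] := surj x; rewrite -!presented_piZ scalerA. Qed.

Fact presented_scale1r : left_id 1 presented_scale.
Proof. by move=> x; have [y <-] := surj x; rewrite -presented_piZ scale1r. Qed.

Fact presented_scaleDr : right_distributive presented_scale +%R.
Proof.
move=> a x y; have [[b <-] [c <-]] := conj (surj x) (surj y).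
by rewrite -presented_piD -!presented_piZ scalerDr presented_piD.
Qed.

Fact presented_scaleDl x : {morph presented_scale^~ x : a b / a + b}.
Proof.
move=> a b; have [y <-] := surj x.
by rewrite -!presented_piZ scalerDl presented_piD.
Qed.

HB.instance Definition _ := GRing.Zmodule_isLmodule.Build K presented_algebra
  presented_scaleA presented_scale1r presented_scaleDr presented_scaleDl.

Fact presented_scaleAl (a : K) (x y : presented_algebra) :
  a *: (x * y) = a *: x * y.
Proof.
have [[b <-] [c <-]] := conj (surj x) (surj y).
rewrite /GRing.scale /GRing.mul /=.
by rewrite -!(presented_piM, presented_piZ) scalerAl.
Qed.

HB.instance Definition _ :=
  GRing.Lmodule_isLalgebra.Build K presented_algebra presented_scaleAl.

Fact presented_scaleAr (a : K) (x y : presented_algebra) :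
  a *: (x * y) = x * (a *: y).
Proof.
have [[b <-] [c <-]] := conj (surj x) (surj y).
rewrite /GRing.scale /GRing.mul /=.
rewrite -!(presented_piM, presented_piZ); congr pi.
suff cC (u : free_algebra) : a%:MP * u = u * a%:MP.
  by rewrite -!mul_malgC !mulrA cC.
rewrite !malgM_def fgmulUg fgmulgU; apply: eq_bigr => k _.
by rewrite mul1m mulm1 mulrC.
Qed.

HB.instance Definition _ :=
  GRing.Lalgebra_isAlgebra.Build K presented_algebra presented_scaleAr.

End PresentedAlgebra.

Definition alg_isomorphic (K : fieldType) (A B : algType K) :=
  exists f : {lrmorphism A -> B}, bijective f.

Section QuantumSerre.
Variable K : fieldType.
Implicit Types (q : K) (m j : nat).

Definition qint q m : K := (q ^+ m - q ^- m) / (q - q^-1).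

Definition qfact q m : K := \prod_(1 <= i < m.+1) qint q i.

Definition qbinom q m j : K := qfact q m / (qfact q j * qfact q (m - j)).

Definition qserre (A : lalgType K) q m (x y : A) : A :=
  \sum_(0 <= j < m.+1)
    ((-1) ^+ j * qbinom q m j) *: (x ^+ j * y * x ^+ (m - j)).

End QuantumSerre.

Section QuantizedNilpotent.
Variables (R : realType) (g : lieAlgType R[i]) (D : root_data g).
Variables (K : fieldType) (q : K).

Definition q_root (i : 'I_(rank D)) : K := q ^+ half_length i.

Definition serre_relator (r : {malg K[{fmonom 'I_(rank D)}]}) : Prop :=
  exists i j : 'I_(rank D), i != j /\
    r = qserre (q_root i) (serre_order i j) (free_gen K i) (free_gen K j).

Lemma serre_relator_const0 r :
  serre_relator r -> mcoeff (mone : {fmonom 'I_(rank D)}) r = 0.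
Proof.
move=> [i [j [_ ->]]]; rewrite /qserre raddf_sum big1 // => k _.
rewrite /= mcoeffZ !rmorphM /= mcoeffU fmP fmU fm1 /=.
by rewrite mulr0 mul0r mulr0.
Qed.

Definition serre_relators := Relators serre_relator_const0.

(* U_q^-(g) (generators F_al) and U_q^+(g) (generators E_al) have the same
   presentation: they differ by the names of the generators only. *)
Definition Uq_minus : algType K := presented_algebra serre_relators.
Definition Uq_plus : algType K := presented_algebra serre_relators.

End QuantizedNilpotent.

(* Main.v *)
Require Import Defs.
From HB Require Import structures.
From mathcomp Require Import all_boot all_order all_algebra perm fingroup.
From mathcomp Require Import boolp reals.
From mathcomp Require Import complex.
From mathcomp Require Import monalg generic_quotient.
From mathcomp Require mpoly.
From mathcomp Require Import ring lra zify.

(** Uq+ and Uq- have the same presentation, by generators indexed by the simple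
    roots and quantum Serre relations.  The proof reads the Cartan matrix off
    such an algebra, and shows independently that the Cartan matrix and the Lie
    algebra determine each other.

    From the algebra to the Cartan matrix.  Let phi : A -> B be an isomorphism.
    The generators of B are tested by the characters x_k : B -> K[x] that send
    the generator k to x and the others to 0; the coefficients of x in
    x_k (phi F_i) form a matrix M, and the chain rule makes M invertible.  Hence
    some permutation s has M i (s i) != 0 for all i.  Serre relations are then
    tested on triangular 2 x 2 matrices over K[x].  On F_k = diag (a, d) and
    F_l strictly upper triangular, the relation of order m between F_k and F_l
    becomes the product of d - q_k ^ (m - 1 - 2 u) a for u < m
    ([qbinomial_product]), so that B has a representation for each of the m
    distinct ratios d / a = q_k ^ (m - 1 - 2 u).  Pulled back by phi it is a
    representation of A, in which the ratio must be one of those of the relation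
    (i, j) with s i = k and s j = l.  This gives m_B (s i) (s j) <= m_A i j, and
    the same bound for the inverse of phi turns it into an equality, because
    both matrices then have the same sum ([serre_rigidity]).  This works without
    assuming that phi preserves the augmentation, since a Serre relation of even
    order forces one of two commuting elements of a domain to vanish, and one of
    the two relations between adjacent simple roots has even order.

    From the Cartan matrix to the Lie algebra.  The structure theory is developed
    from the definition of a Cartan subalgebra as a maximal toral one: Engel's
    theorem, nondegeneracy of the Killing form, inner derivations, h is its own
    centralizer, root spaces of dimension 1, coroots, reflections, Chevalley
    generators.  If the Cartan matrices agree, the subalgebra of g1 x g2 generated
    by the pairs of Chevalley generators has a triangular decomposition, hence it
    meets each factor in a proper ideal, and by simplicity it is the graph of an
    isomorphism ([same_cartan_matrix_isomorphic]).

    From the Lie algebra to the Cartan matrix.  Two Cartan subalgebras have to be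
    compared.  A polynomial function that vanishes on the conjugates of the
    regular elements of h, under automorphisms exp (ad u), has derivatives with
    the same property, and is therefore zero ([vanishes_everywhere]).  Applied to
    a symmetric function of the eigenvalues of ad z, this shows that every
    diagonalizable element of g has the spectrum of some element of h
    ([spectrum_transfer]).  For a generic element of the other Cartan subalgebra,
    the equality of the spectra lifts to a linear bijection between the duals of
    the two Cartan subalgebras that exchanges the roots ([weights_transport]).
    Cartan integers are lengths of root strings, hence are preserved, and any two
    bases of one root system are exchanged by reflections ([weyl_transitive]).

    Finally, the form is determined by the Cartan matrix, because the Dynkin
    diagram is connected and the shortest simple roots have square length 2
    ([same_half_length]); so equal Cartan matrices give the same presentation. *)

Set Implicit Arguments.
Unset Strict Implicit.
Unset Printing Implicit Defensive.

Import Order.TTheory GRing.Theory Num.Theory passmx.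
Local Open Scope ring_scope.

(** * Evaluating the free algebra, and the q-binomial product *)

Section FreeAlgebra.
Variables (K : fieldType) (I : choiceType).
Local Notation free_algebra := {malg K[{fmonom I}]}.

Lemma free_algebra_ind (P : free_algebra -> Prop) :
    P 1 -> (forall i a, P a -> P (free_gen K i * a)) ->
    (forall a b, P a -> P b -> P (a + b)) ->
    (forall c a, P a -> P (c *: a)) ->
  forall a, P a.
Proof.
move=> P1 Pgen PD PZ a; rewrite [a]monalgE.
elim/big_ind: _ => [||m _]; first by rewrite -(scale0r 1); exact: PZ.
  exact: PD.
have -> : << a@_m *g m >> = a@_m *: (<< m >> : free_algebra).
  by rewrite -mul_malgC /malgC malgM_def fgmulUU mul1m mulr1.
apply: PZ; case: m => s; elim: s => [|i s IHs].
  by rewrite -fmoneE; exact: P1.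
have -> : << FMonom (i :: s) >> = free_gen K i * << FMonom s >> :> free_algebra.
  rewrite /free_gen malgM_def fgmulUU mulr1; congr << _ >>.
  by rewrite /mmul /= fmmulE fmU.
exact: Pgen.
Qed.

Section Eval.
Variables (S : nzRingType) (f : {rmorphism K -> S}) (F : I -> S).
Hypothesis fC : forall c x, f c * x = x * f c.

Definition word_eval (m : {fmonom I}) : S := \prod_(i <- (m : seq I)) F i.

Fact word_eval_mmorphism : mmorphism word_eval.
Proof.
split=> [m n|]; first by rewrite /word_eval fmM big_cat.
by rewrite /word_eval fm1 big_nil.
Qed.
HB.instance Definition _ :=
  isMultiplicative.Build {fmonom I} S word_eval word_eval_mmorphism.

Definition free_eval : free_algebra -> S := mmap f word_eval.

Lemma free_evalD : {morph free_eval : a b / a + b}.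
Proof. exact: mmapD. Qed.

Lemma free_evalB : {morph free_eval : a b / a - b}.
Proof. exact: mmapB. Qed.

Lemma free_eval_multiplicative :
  {morph free_eval : a b / a * b} * (free_eval 1 = 1).
Proof.
by apply: commr_mmap_is_multiplicative => g m m'; rewrite /GRing.comm fC.
Qed.

Lemma free_evalM : {morph free_eval : a b / a * b}.
Proof. exact: free_eval_multiplicative.1. Qed.

Lemma free_eval1 : free_eval 1 = 1.
Proof. exact: free_eval_multiplicative.2. Qed.

Lemma free_evalZ c a : free_eval (c *: a) = f c * free_eval a.
Proof. exact: mmapZ. Qed.

Lemma free_eval_gen i : free_eval (free_gen K i) = F i.
Proof.
have -> : free_eval (free_gen K i) = f 1 * word_eval (fmu i) by exact: mmapU.
by rewrite rmorph1 mul1r /word_eval fmU big_seq1.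
Qed.
End Eval.
End FreeAlgebra.

Section QBinomial.
Variables (K : fieldType) (q : K).
Hypotheses (q_neq0 : q != 0) (qX_neq1 : forall n, (0 < n)%N -> q ^+ n != 1).

Lemma qint_neq0 m : (0 < m)%N -> qint q m != 0.
Proof.
have subV n : (0 < n)%N -> q ^+ n - q ^- n != 0.
  move=> n0; have qn : q ^+ n != 0 by rewrite expf_neq0.
  rewrite subr_eq0; apply: contra (qX_neq1 (n := n + n) _) => [/eqP e|].
    by rewrite exprD {1}e mulVf.
  by rewrite addn_gt0 n0.
move=> m0; rewrite /qint mulf_neq0 ?invr_eq0 ?subV //.
by have := subV 1%N isT; rewrite expr1.
Qed.

Lemma qfactS m : qfact q m.+1 = qfact q m * qint q m.+1.
Proof. by rewrite /qfact big_nat_recr. Qed.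

Lemma qfact_neq0 m : qfact q m != 0.
Proof.
elim: m => [|m IHm]; first by rewrite /qfact big_geq ?oner_neq0.
by rewrite qfactS mulf_neq0 ?qint_neq0.
Qed.

Lemma qbinom0 m : qbinom q m 0 = 1.
Proof.
by rewrite /qbinom subn0 /qfact (big_geq (n := 1)) // mul1r divff ?qfact_neq0.
Qed.

Lemma qbinomn m : qbinom q m m = 1.
Proof.
by rewrite /qbinom subnn /qfact (big_geq (n := 1)) // mulr1 divff ?qfact_neq0.
Qed.

(** One of the two Pascal rules; it is the one that matches the extraction of
    the factor u = 0 in [qbinomial_product]. *)
Lemma qbinomS m j : (j < m)%N ->
  qbinom q m.+1 j.+1
  = q ^- j.+1 * qbinom q m j.+1 + q ^+ m * q ^- j * qbinom q m j.
Proof.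
move=> jm; rewrite /qbinom subSS !qfactS.
have -> : (m - j = (m - j.+1).+1)%N by rewrite subnSK.
rewrite !qfactS; set k := (m - j.+1)%N.
have -> : m = (j + k.+1)%N by rewrite /k addnS -addSn subnKC.
have qj := qint_neq0 (ltn0Sn j); have qk := qint_neq0 (ltn0Sn k).
have qd : q - q^-1 != 0.
  apply: contraNneq (qint_neq0 (ltn0Sn 0)) => e.
  by rewrite /qint e invr0 mulr0.
have jk : qint q (j + k.+1).+1
    = q ^- j.+1 * qint q k.+1 + q ^+ (j + k.+1) * q ^- j * qint q j.+1.
  rewrite /qint -addSn !exprD -!exprVn; set x := q ^+ j.+1; set y := q ^+ k.+1.
  have x0 : x != 0 by rewrite expf_neq0. have y0 : y != 0 by rewrite expf_neq0.
  have -> : q^-1 ^+ j = q / x.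
    by rewrite exprVn /x exprSr invfM mulrCA divff // mulr1.
  have -> : q ^+ j = x / q by rewrite /x exprSr mulfK.
  rewrite !exprVn -/x -/y !invfM; field.
  by rewrite ?x0 ?y0 ?q_neq0 -expr2 subr_eq0 qX_neq1.
rewrite jk; field.
by rewrite !qfact_neq0 qj qk !expf_neq0.
Qed.

(** The power q ^ (m - 1 - 2 u), written as a quotient of natural powers. *)
Definition qroot m (u : nat) : K := q ^+ m.-1 / q ^+ (u.*2).

Section Product.
Variables (S : nzRingType) (f : {rmorphism K -> S}).

(** [qserre] evaluated in a ring S that is only an algebra through f; this
    covers K[x] and 2 x 2 matrices over K[x] at once. *)
Definition serre_value m (X Y : S) : S :=
  \sum_(0 <= j < m.+1) f ((-1) ^+ j * qbinom q m j) * (X ^+ j * Y * X ^+ (m - j)).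
End Product.

(** The q-binomial theorem, by induction on m: extracting the factor u = 0
    replaces a by a / q in the others. *)
Lemma qbinomial_product (S : comNzRingType) (f : {rmorphism K -> S}) m a d :
  \sum_(0 <= j < m.+1) f ((-1) ^+ j * qbinom q m j) * (a ^+ j * d ^+ (m - j))
  = \prod_(u < m) (d - f (qroot m u) * a).
Proof.
elim: m a => [|m IHm] a.
  by rewrite big_nat1 big_ord0 qbinom0 !mulr1 rmorph1.
rewrite big_ord_recl /=.
have -> : \prod_(i < m) (d - f (qroot m.+1 (bump 0 i)) * a)
        = \prod_(i < m) (d - f (qroot m i) * (f q^-1 * a)).
  apply: eq_bigr => i _; rewrite mulrA -rmorphM; congr (_ - f _ * _).
  rewrite /qroot /bump /= add1n doubleS; case: m i {IHm} => [[]//|m] i /=.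
  by rewrite !exprS; field; rewrite q_neq0 expf_neq0.
rewrite -IHm /qroot /= expr0 divr1.
rewrite mulrBl !mulr_sumr big_nat_recl // big_nat_recr //=.
rewrite [in RHS]big_nat_recl // [in X in _ - X]big_nat_recr //=.
rewrite !qbinom0 !qbinomn !subnn !subn0 !expr0 !mulr1 !mul1r !rmorph1 !mul1r.
rewrite -exprS -!addrA; congr (_ + _).
rewrite opprD addrA -sumrB; congr (_ + _).
  apply: eq_big_nat => j /andP[_ jm].
  rewrite qbinomS // subSS; have -> : (m - j = (m - j.+1).+1)%N by rewrite subnSK.
  rewrite -!exprVn; 
  move: (qbinom q m j.+1) (qbinom q m j) (m - j.+1)%N => b1 b0 k.
  have -> : (-1) ^+ j.+1 = - (-1) ^+ j :> K by rewrite exprS mulN1r.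
  rewrite !mulNr !rmorphN mulrDr rmorphD !rmorphM !rmorphXn /= !exprMn !exprS.
  by ring.
have -> : (-1) ^+ m.+1 = - (-1) ^+ m :> K by rewrite exprS mulN1r.
rewrite rmorphN !exprMn -[f q^-1 ^+ m]rmorphXn [a ^+ m.+1]exprS.
have : f (q ^+ m) * f (q^-1 ^+ m) = 1.
  by rewrite -rmorphM -exprMn divff // expr1n rmorph1.
set y := f (q ^+ m); set y' := f (q^-1 ^+ m); set s := f (_ ^+ m) => yy'.
transitivity (- (s * (a * a ^+ m)) * (y * y')); first by rewrite yy'; ring.
by ring.
Qed.
End QBinomial.

(** * Representations of presented algebras *)

(** K-algebra homomorphisms into rings T that are K-algebras through f only. *)
Record is_rep (K : fieldType) (A : lalgType K) (T : nzRingType)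
    (f : K -> T) (psi : A -> T) : Prop := IsRep {
  repD : {morph psi : x y / x + y};
  repM : {morph psi : x y / x * y};
  rep1 : psi 1 = 1;
  repZ : forall c x, psi (c *: x) = f c * psi x
}.

(** A derivation at the character c0: the first-order part of a
    representation with constant part c0. *)
Record is_derivation (K : fieldType) (A : lalgType K) (c0 c1 : A -> K) : Prop :=
  IsDerivation {
  derD : {morph c1 : x y / x + y};
  derZ : forall c x, c1 (c *: x) = c * c1 x;
  derM : forall x y, c1 (x * y) = c0 x * c1 y + c1 x * c0 y
}.

Section Reps.
Variables (K : fieldType) (A : lalgType K) (T : nzRingType).
Variables (f : {rmorphism K -> T}) (psi : A -> T).
Hypothesis psiP : is_rep f psi.

Lemma rep0 : psi 0 = 0.
Proof. by rewrite -(scale0r 1) (repZ psiP) rmorph0 mul0r. Qed.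

Lemma repX x n : psi (x ^+ n) = psi x ^+ n.
Proof.
by elim: n => [|n IHn]; rewrite ?(rep1 psiP) // !exprS (repM psiP) IHn.
Qed.

Lemma rep_sum (J : Type) (r : seq J) (P : pred J) (F : J -> A) :
  psi (\sum_(i <- r | P i) F i) = \sum_(i <- r | P i) psi (F i).
Proof. exact: (big_morph psi (repD psiP) rep0). Qed.

Lemma rep_qserre q m x y :
  psi (qserre q m x y) = serre_value q f m (psi x) (psi y).
Proof.
rewrite /qserre rep_sum; apply: eq_bigr => j _.
by rewrite (repZ psiP) !(repM psiP) !repX.
Qed.

End Reps.

Section PolyReps.
Variables (K : fieldType) (A : lalgType K) (psi : A -> {poly K}).
Hypothesis psiP : is_rep polyC psi.

Lemma rep_coef0M x y : (psi (x * y))`_0 = (psi x)`_0 * (psi y)`_0.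
Proof. by rewrite (repM psiP) coefM big_ord1 subn0. Qed.

Lemma rep_derivation : is_derivation (fun x => (psi x)`_0) (fun x => (psi x)`_1).
Proof.
split=> [x y|c x|x y] /=; first by rewrite (repD psiP) coefD.
  by rewrite (repZ psiP) coefCM.
by rewrite (repM psiP) coefM big_ord_recl big_ord1.
Qed.
End PolyReps.

Section FreeDerivations.
Variables (K : fieldType) (I : choiceType).
Local Notation free_algebra := {malg K[{fmonom I}]}.

Lemma free_rep_eq (T : nzRingType) (f : {rmorphism K -> T})
    (psi1 psi2 : free_algebra -> T) :
    is_rep f psi1 -> is_rep f psi2 ->
    (forall i, psi1 (free_gen K i) = psi2 (free_gen K i)) ->
  psi1 =1 psi2.
Proof.
move=> P1 P2 e; elim/free_algebra_ind => [|i a IHa|a b IHa IHb|c a IHa].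
- by rewrite (rep1 P1) (rep1 P2).
- by rewrite (repM P1) (repM P2) e IHa.
- by rewrite (repD P1) (repD P2) IHa IHb.
- by rewrite (repZ P1) (repZ P2) IHa.
Qed.

Lemma free_derivation0 (c0 c1 : free_algebra -> K) :
    is_derivation c0 c1 -> c0 1 = 1 ->
    (forall i, c1 (free_gen K i) = 0) ->
  forall a, c1 a = 0.
Proof.
move=> c1P c01 e; elim/free_algebra_ind => [|i a IHa|a b IHa IHb|c a IHa].
- have := derM c1P 1 1; rewrite mulr1 c01 mul1r mulr1 => /esym/eqP.
  by rewrite -[X in _ == X]addr0 (inj_eq (addrI _)) => /eqP.
- by rewrite (derM c1P) IHa e mulr0 mul0r addr0.
- by rewrite (derD c1P) IHa IHb addr0.
- by rewrite (derZ c1P) IHa mulr0.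
Qed.

Section Eval.
Variables (S : nzRingType) (f : {rmorphism K -> S}) (F : I -> S).
Hypothesis fC : forall c x, f c * x = x * f c.

Lemma free_eval_rep : is_rep f (free_eval f F).
Proof.
split; [exact: free_evalD|exact: free_evalM|exact: free_eval1|exact: free_evalZ].
Qed.
End Eval.
End FreeDerivations.

Section PresentedLift.
Variables (K : fieldType) (I : choiceType) (S : relators K I).
Variables (T : nzRingType) (f : {rmorphism K -> T}) (F : I -> T).
Hypothesis fC : forall c x, f c * x = x * f c.
Local Notation pi := (presented_pi S).

(** A representative in the free algebra is evaluated; the value does not
    depend on it as soon as the relators vanish. *)
Definition presented_lift (x : presented_algebra S) : T := free_eval f F (repr x).

Definition presented_gen i : presented_algebra S := pi (free_gen K i).

Hypothesis relF : forall r, S r -> free_eval f F r = 0.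

Lemma presented_lift_pi a : presented_lift (pi a) = free_eval f F a.
Proof.
have E : relator_ideal S (repr (pi a) - a).
  by apply/presented_piE; rewrite /presented_pi reprK.
apply/eqP; rewrite -subr_eq0 -free_evalB; apply/eqP.
elim: E => {a} [r /relF //||x y _ x0 _ y0|a x b _ x0].
- exact: mmap0.
- by rewrite free_evalB x0 y0 subr0.
- by rewrite !free_evalM // x0 mulr0 mul0r.
Qed.

Lemma presented_lift_gen i : presented_lift (presented_gen i) = F i.
Proof. by rewrite presented_lift_pi free_eval_gen. Qed.

Lemma presented_lift_rep :
  is_rep f (presented_lift : (presented_algebra S : lalgType K) -> T).
Proof.
split=> [x y|x y||c x].
- have [[a <-] [b <-]] := (presented_pi_surj x, presented_pi_surj y).
  by rewrite -presented_piD !presented_lift_pi free_evalD.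
- have [[a <-] [b <-]] := (presented_pi_surj x, presented_pi_surj y).
  rewrite [_ * _](esym (presented_piM S a b)).
  by rewrite !presented_lift_pi free_evalM.
- by rewrite [1 in LHS](_ : 1 = pi 1) // presented_lift_pi free_eval1.
- have [a <-] := presented_pi_surj x.
  rewrite [_ *: _](esym (presented_piZ S c a)).
  by rewrite !presented_lift_pi free_evalZ.
Qed.
End PresentedLift.

Section PresentedPi.
Variables (K : fieldType) (I : choiceType) (S : relators K I).
Local Notation A := (presented_algebra S : algType K).
Local Notation free_algebra := {malg K[{fmonom I}]}.
Local Notation pi := (presented_pi S).

Lemma presented_pi_relator r : S r -> pi r = 0.
Proof.
move=> Sr; have -> : 0 = pi 0.
  by have := presented_piD S 0 0; rewrite addr0 -[LHS]addr0 => /addrI.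
by apply/presented_piE; rewrite subr0; exact: relator_ideal_gen.
Qed.

Lemma presented_rep_pi (T : nzRingType) (f : K -> T) (psi : A -> T) :
  is_rep f psi -> is_rep f (psi \o pi : free_algebra -> T).
Proof.
move=> psiP; split=> [x y|x y||c x] /=.
- by rewrite presented_piD (repD psiP).
- by rewrite presented_piM -(repM psiP).
- by rewrite -(rep1 psiP).
- by rewrite presented_piZ -(repZ psiP).
Qed.

Lemma presented_rep_relator (T : nzRingType) (f : {rmorphism K -> T})
    (psi : A -> T) q m i j :
    is_rep f psi -> S (qserre q m (free_gen K i) (free_gen K j)) ->
  serre_value q f m (psi (presented_gen S i)) (psi (presented_gen S j)) = 0.
Proof.
move=> psiP Sr.
by rewrite -(rep_qserre (presented_rep_pi psiP)) /= presented_pi_relator // (rep0 psiP).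
Qed.

Lemma presented_derivation0 (c0 c1 : A -> K) :
    is_derivation c0 c1 -> c0 1 = 1 ->
    (forall i, c1 (presented_gen S i) = 0) ->
  forall a, c1 a = 0.
Proof.
move=> c1P c01 e x; have [a <-] := presented_pi_surj x.
apply: (free_derivation0 (c0 := c0 \o pi) (c1 := c1 \o pi)) => //.
split=> [y z|c y|y z] /=.
- by rewrite presented_piD (derD c1P).
- by rewrite presented_piZ -(derZ c1P).
- by rewrite presented_piM -(derM c1P).
Qed.

(** Products need to be considered only with a generator on the left, since
    these words span. *)
Lemma presented_ind (P : A -> Prop) :
    P 1 -> (forall i a, P a -> P (presented_gen S i * a)) ->
    (forall a b, P a -> P b -> P (a + b)) ->
    (forall c a, P a -> P (c *: a)) ->
  forall a, P a.
Proof.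
move=> P1 Pgen PD PZ x; have [a <-] := presented_pi_surj x.
elim/free_algebra_ind: a => [//|i a Pa|a b Pa Pb|c a Pa].
- by rewrite presented_piM; exact: Pgen.
- by rewrite presented_piD; exact: PD.
- by rewrite presented_piZ; exact: PZ.
Qed.
End PresentedPi.

Section SerreValues.
Variables (K : fieldType) (q : K).
Hypotheses (q_neq0 : q != 0) (qX_neq1 : forall n, (0 < n)%N -> q ^+ n != 1).

(** For commuting values the q-binomial product has d = a = x, so that only
    the factors 1 - rho matter. *)
Lemma serre_value_comm (S : comNzRingType) (f : {rmorphism K -> S}) m x y :
  serre_value q f m x y = y * \prod_(u < m) (x - f (qroot q m u) * x).
Proof.
rewrite -qbinomial_product // mulr_sumr; apply: eq_bigr => j _.
by move: (f _) => c; ring.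
Qed.

Lemma serre_value0l (S : nzRingType) (f : {rmorphism K -> S}) m y :
  (0 < m)%N -> serre_value q f m 0 y = 0.
Proof.
move=> m0; rewrite /serre_value big1_seq // => j /andP[_].
rewrite mem_index_iota => /andP[_ jm]; case: j jm => [|j] jm.
  by rewrite subn0 [0 ^+ m]expr0n eqn0Ngt m0 !mulr0.
by rewrite [0 ^+ j.+1]expr0n /= !mul0r mulr0.
Qed.

Lemma serre_value0r (S : nzRingType) (f : {rmorphism K -> S}) m x :
  serre_value q f m x 0 = 0.
Proof. by rewrite /serre_value big1 // => j _; rewrite mulr0 mul0r mulr0. Qed.

(** Upper triangular 2 x 2 matrices. *)
Definition ut (S : nzRingType) (a b d : S) : 'M[S]_2 :=
  \matrix_(i, j) if i == j then (if i == 0 then a else d)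
                 else if i == 0 then b else 0.

Lemma mx2P (S : nzRingType) (A B : 'M[S]_2) :
    A 0 0 = B 0 0 -> A 0 1 = B 0 1 -> A 1 0 = B 1 0 -> A 1 1 = B 1 1 -> A = B.
Proof.
move=> e00 e01 e10 e11; apply/matrixP => i j.
have cases (k : 'I_2) : k = 0 \/ k = 1.
  by case: k => [[|[|//]] k2]; [left|right]; apply: val_inj.
by case: (cases i) => ->; case: (cases j) => ->.
Qed.

Lemma utM (S : nzRingType) (a b d a' b' d' : S) :
  ut a b d * ut a' b' d' = ut (a * a') (a * b' + b * d') (d * d').
Proof.
by apply: mx2P; rewrite !mxE big_ord_recl big_ord1 !mxE /=
  ?(mulr0, mul0r, addr0, add0r).
Qed.

Lemma utD (S : nzRingType) (a b d a' b' d' : S) :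
  ut a b d + ut a' b' d' = ut (a + a') (b + b') (d + d').
Proof. by apply: mx2P; rewrite !mxE /= ?addr0. Qed.

Lemma utC (S : nzRingType) (c : S) : c%:M = ut c 0 c.
Proof. by apply: mx2P; rewrite !mxE /=. Qed.

Lemma ut0 (S : nzRingType) : 0 = ut 0 0 0 :> 'M[S]_2.
Proof. by apply: mx2P; rewrite !mxE /=. Qed.

(** The entry above the diagonal is left unspecified: it is multiplied by zero
    in [serre_value_ut]. *)
Lemma utX (S : nzRingType) (a b d : S) n :
  exists b', ut a b d ^+ n = ut (a ^+ n) b' (d ^+ n).
Proof.
elim: n => [|n [b' IHn]]; first by exists 0; rewrite !expr0 -utC.
by rewrite exprS IHn utM -!exprS; eexists.
Qed.
End SerreValues.

(** * Test representations of Serre algebras *)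

Definition scalar_polyC (K : fieldType) : K -> 'M[{poly K}]_2 := scalar_mx \o polyC.
HB.instance Definition _ (K : fieldType) :=
  GRing.RMorphism.copy (@scalar_polyC K) (scalar_mx \o polyC).

Lemma scalar_polyCE (K : fieldType) (c : K) : scalar_polyC c = ut c%:P 0 c%:P.
Proof. exact: utC. Qed.

Section SerreValues2.
Variables (K : fieldType) (q : K).
Hypotheses (q_neq0 : q != 0) (qX_neq1 : forall n, (0 < n)%N -> q ^+ n != 1).

Lemma qX_inj : injective (fun n => q ^+ n).
Proof.
move=> a b /= e; wlog ab : a b e / (a <= b)%N.
  by move=> W; case: (leqP a b) => [|/ltnW] ab; [|symmetry]; apply: W.
apply/eqP; rewrite eqn_leq ab /= leqNgt; apply/negP => ab'.
have := qX_neq1 (n := b - a); rewrite subn_gt0 => /(_ ab') /eqP[].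
by apply: (mulfI (expf_neq0 a q_neq0)); rewrite -exprD subnKC // mulr1.
Qed.

Lemma qXd_neq1 d : (0 < d)%N -> forall n, (0 < n)%N -> (q ^+ d) ^+ n != 1.
Proof. by move=> d0 n n0; rewrite -exprM qX_neq1 // muln_gt0 d0. Qed.

Lemma qroot_neq0 m u : qroot q m u != 0.
Proof. by rewrite mulf_neq0 ?invr_eq0 ?expf_neq0. Qed.

(** Exponents that differ by an even number give different powers, as q is
    not a root of unity. *)
Lemma qroot_inj m : injective (qroot q m).
Proof.
move=> u v; rewrite /qroot => /(mulfI (expf_neq0 _ q_neq0)) /invr_inj /qX_inj.
exact: double_inj.
Qed.

(** For even m the exponent m - 1 - 2 u is odd, hence nonzero. *)
Lemma qroot_neq1 m u : (0 < m)%N -> ~~ odd m -> qroot q m u != 1.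
Proof.
move=> m0 om; apply/negP => /eqP /(congr1 (fun x => x * q ^+ u.*2)).
rewrite mulfVK ?expf_neq0 // mul1r => /qX_inj e; move: om; rewrite -(prednK m0) /= e.
by rewrite odd_double.
Qed.

(** The product of the factors 1 - rho is nonzero when m is even, because
    no exponent m - 1 - 2 u vanishes. *)
Lemma serre_value_domain (S : idomainType) (f : {rmorphism K -> S}) m x y :
  (0 < m)%N -> ~~ odd m -> serre_value q f m x y = 0 -> x = 0 \/ y = 0.
Proof.
move=> m0 om; rewrite serre_value_comm // => /eqP; rewrite mulf_eq0.
case/orP => [/eqP|]; first by right.
rewrite prodf_seq_eq0 => /hasP[u _ /=].
rewrite -{1}[x]mul1r -mulrBl mulf_eq0 => /orP[|/eqP]; last by left.
rewrite -(rmorph1 f) -rmorphB fmorph_eq0 subr_eq0 eq_sym => e.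
by have := qroot_neq1 u m0 om; rewrite e.
Qed.

(** The only nonzero entry of X ^+ j * Y * X ^+ (m - j) is
    a ^+ j * y * d ^+ (m - j), so the q-binomial theorem applies. *)
Lemma serre_value_ut m a b d y :
  serre_value q (@scalar_polyC K) m (ut a b d) (ut 0 y 0)
  = ut 0 (y * \prod_(u < m) (d - (qroot q m u)%:P * a)) 0.
Proof.
rewrite -qbinomial_product // mulr_sumr /serre_value.
elim: index_iota => [|j r IHr]; first by rewrite !big_nil -ut0.
rewrite !big_cons {}IHr.
have [b1 ->] := utX a b d j; have [b2 ->] := utX a b d (m - j).
rewrite /= !scalar_polyCE !utM !utD.
rewrite !(mulr0, mul0r, addr0, add0r); congr ut.
congr (_ + _); rewrite mulrCA [a ^+ j * y]mulrC -!mulrA.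
by move: (_%:P) => c; ring.
Qed.

(** Here X ^+ 2 = 0 and X * Y * X = 0, so that every term vanishes. *)
Lemma serre_value_ut_nil m x a d :
  (1 < m)%N -> serre_value q (@scalar_polyC K) m (ut 0 x 0) (ut a 0 d) = 0.
Proof.
move=> m1; rewrite /serre_value big1_seq // => j /andP[_].
rewrite mem_index_iota => /andP[_ jm].
have nil2 n : (1 < n)%N -> ut 0 x 0 ^+ n = 0 :> 'M[{poly K}]_2.
  by case: n => [//|[//|n]] _; rewrite !exprS mulrA utM !(mul0r, mulr0, addr0) -ut0 mul0r.
have [j2|] := ltnP 1 j; first by rewrite (nil2 _ j2) !mul0r mulr0.
have [k2|] := ltnP 1 (m - j); first by rewrite (nil2 _ k2) !mulr0.
move=> k1 j1; have -> : j = 1%N by lia.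
have -> : (m - 1 = 1)%N by lia.
by rewrite !expr1 !utM !(mul0r, mulr0, addr0) -ut0 mulr0.
Qed.

Lemma serre_value1 (S : nzRingType) (f : {rmorphism K -> S}) x y :
  serre_value q f 1 x y = y * x - x * y.
Proof.
rewrite /serre_value big_nat_recl // big_nat1 qbinom0 // qbinomn //.
by rewrite !expr0 !expr1 !mulr1 !mul1r rmorph1 mul1r rmorphN rmorph1 mulN1r.
Qed.
End SerreValues2.

(** The combinatorial data of a Serre presentation: half square lengths d and
    orders m i j = 1 - a_ij of the relations.  The last two fields are what is
    used of a Cartan matrix of finite type: a_ij and a_ji vanish together, and
    one of them is odd when they do not. *)
Record serre_data (n : nat) := SerreData {
  sd_len : 'I_n -> nat;
  sd_order : 'I_n -> 'I_n -> nat;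
  sd_len_gt0 : forall i, (0 < sd_len i)%N;
  sd_order_gt0 : forall i j, i != j -> (0 < sd_order i j)%N;
  sd_orderC : forall i j, i != j -> sd_order i j = 1%N -> sd_order j i = 1%N;
  sd_order_even : forall i j, i != j -> sd_order i j != 1%N ->
    ~~ odd (sd_order i j) || ~~ odd (sd_order j i)
}.

Section SerreAlgebra.
Variables (K : fieldType) (q : K).
Hypotheses (q_neq0 : q != 0) (qX_neq1 : forall n, (0 < n)%N -> q ^+ n != 1).
Variables (n : nat) (D : serre_data n) (S : relators K 'I_n).
Local Notation d := (sd_len D).
Local Notation m := (sd_order D).
Hypothesis SE : forall r, S r <-> exists i j : 'I_n, i != j /\
  r = qserre (q ^+ d i) (m i j) (free_gen K i) (free_gen K j).

Local Notation A := (presented_algebra S : algType K).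
Local Notation gen := (presented_gen S).

Lemma rep_serre (T : nzRingType) (f : {rmorphism K -> T}) (psi : A -> T) i j :
  is_rep f psi -> i != j ->
  serre_value (q ^+ d i) f (m i j) (psi (gen i)) (psi (gen j)) = 0.
Proof.
by move=> psiP ij; apply: presented_rep_relator => //; apply/SE; exists i, j.
Qed.

Lemma serre_lift (T : nzRingType) (f : {rmorphism K -> T}) (F : 'I_n -> T) :
    (forall c x, f c * x = x * f c) ->
    (forall i j, i != j -> serre_value (q ^+ d i) f (m i j) (F i) (F j) = 0) ->
  is_rep f (presented_lift (S := S) f F : A -> T)
  /\ forall i, presented_lift (S := S) f F (gen i) = F i.
Proof.
move=> fC rel.
have relF r : S r -> free_eval f F r = 0.
  move=> /SE[i [j [ij ->]]]; rewrite (rep_qserre (free_eval_rep F fC)).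
  by rewrite !free_eval_gen rel.
by split=> [|i]; [exact: presented_lift_rep|rewrite presented_lift_gen].
Qed.

Definition adjacent (i j : 'I_n) := (i != j) && (m i j != 1%N).

Lemma adjacentC i j : adjacent i j = adjacent j i.
Proof.
rewrite /adjacent eq_sym; case: eqVneq => //= ji.
by apply/idP/idP; apply: contra => /eqP /sd_orderC ->; rewrite // eq_sym.
Qed.

(** One of the two relations between adjacent generators has even order. *)
Lemma rep_adjacent (psi : A -> {poly K}) i j :
  is_rep polyC psi -> adjacent i j -> psi (gen i) = 0 \/ psi (gen j) = 0.
Proof.
move=> psiP /andP[ij mij].
have qd k := qXd_neq1 qX_neq1 (sd_len_gt0 D k).
have qd0 k : q ^+ d k != 0 by rewrite expf_neq0.
have ji : j != i by rewrite eq_sym.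
have := sd_order_even ij mij => /orP[] om.
  apply: (serre_value_domain (qd0 i) (qd i) _ om (rep_serre psiP ij)).
  exact: sd_order_gt0.
apply/or_comm; apply: (serre_value_domain (qd0 j) (qd j) _ om (rep_serre psiP ji)).
exact: sd_order_gt0.
Qed.

Lemma polyC_central (c : K) (x : {poly K}) : c%:P * x = x * c%:P.
Proof. exact: mulrC. Qed.

(** A curve of characters of A along one coordinate axis; its coefficient of
    degree 1 is a derivation at the augmentation. *)
Definition axis_rep k : A -> {poly K} :=
  presented_lift (S := S) polyC (fun i => if i == k then 'X else 0).

Lemma axis_repP k : is_rep polyC (axis_rep k)
  /\ forall i, axis_rep k (gen i) = if i == k then 'X else 0.
Proof.
apply: serre_lift polyC_central _ => i j ij.
have qd := qXd_neq1 qX_neq1 (sd_len_gt0 D i).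
have [ik|_] := eqVneq i k; last by rewrite serre_value0l ?sd_order_gt0.
rewrite (_ : (j == k) = false) ?serre_value0r //.
by rewrite -ik eq_sym (negbTE ij).
Qed.

(** Generators that are not adjacent commute, so that the axis curves span a
    plane of characters. *)
Lemma pair_rep k l s : k != l -> ~~ adjacent k l ->
  exists2 psi : A -> {poly K}, is_rep polyC psi &
    forall i, psi (gen i) = if i == k then 'X else if i == l then s *: 'X else 0.
Proof.
move=> kl nkl; pose F i := if i == k then 'X else if i == l then s *: 'X else 0.
have [|P G] := serre_lift (F := F) polyC_central; last by exists (presented_lift polyC F).
move=> i j ij; have qd := qXd_neq1 qX_neq1 (sd_len_gt0 D i).
have [Fi0|Fi] := eqVneq (F i) 0; first by rewrite Fi0 serre_value0l ?sd_order_gt0.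
have [->|Fj] := eqVneq (F j) 0; first by rewrite serre_value0r.
have mem x : F x != 0 -> (x == k) || (x == l).
  by rewrite /F; case: (x == k); case: (x == l) => //=; rewrite eqxx.
have m1 : m i j = 1%N.
  apply/eqP; move: nkl; rewrite -[_ == _]negbK; apply: contra => mij.
  have : adjacent i j by rewrite /adjacent ij.
  have := mem _ Fi => /orP[]/eqP ->; have := mem _ Fj => /orP[]/eqP -> //.
  - by rewrite /adjacent eqxx.
  - by rewrite adjacentC.
  - by rewrite /adjacent eqxx.
by rewrite m1 serre_value1 ?expf_neq0 // mulrC subrr.
Qed.

Lemma scalar_polyC_central (c : K) (x : 'M[{poly K}]_2) : scalar_polyC c * x = x * scalar_polyC c.
Proof. by rewrite /scalar_polyC /= -[LHS]scalar_mxC. Qed.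

(** Each zero rho of the q-binomial product of the relation (k, l) gives a
    representation in which gen k is diagonal with ratio rho and gen l is
    strictly upper triangular. *)
Lemma root_rep k l u : k != l -> (u < m k l)%N ->
  exists2 psi : A -> 'M[{poly K}]_2, is_rep (@scalar_polyC K) psi &
    forall i, psi (gen i) =
      if i == k then ut ((qroot (q ^+ d k) (m k l) u)^-1 *: 'X) 0 'X
      else if i == l then ut 0 'X 0 else 0.
Proof.
move=> kl um; set rho := qroot _ _ _.
have rho0 : rho != 0 by apply: qroot_neq0; rewrite expf_neq0.
pose F i := if i == k then ut (rho^-1 *: 'X : {poly K}) 0 'X
            else if i == l then ut 0 'X 0 else 0.
pose sp : {rmorphism K -> 'M[{poly K}]_2} := @scalar_polyC K.
have [|P G] := serre_lift (f := sp) (F := F) scalar_polyC_central; last first.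
  exists (presented_lift sp F).
    exact: P.
  exact: G.
move=> i j ij; have qd := qXd_neq1 qX_neq1 (sd_len_gt0 D i).
rewrite /F; case: (eqVneq i k) ij qd => [->|ik] ij qd.
  rewrite eq_sym (negbTE ij); case: (eqVneq j l) => [->|_]; last exact: serre_value0r.
  rewrite serre_value_ut ?expf_neq0 // (bigD1 (Ordinal um)) //= -/rho.
  rewrite mul_polyC scalerA divff // scale1r subrr mul0r mulr0.
  by rewrite -ut0.
case: (eqVneq i l) ij qd => [->|_] ij qd; last first.
  by rewrite serre_value0l ?sd_order_gt0.
case: (eqVneq j k) => [->|_]; last first.
  by rewrite eq_sym (negbTE ij) serre_value0r.
have lk : l != k by rewrite eq_sym.
have [m1|m1] := eqVneq (m l k) 1%N; last first.
  have mlk : (1 < m l k)%N by rewrite ltn_neqAle eq_sym m1 sd_order_gt0.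
  by apply: serre_value_ut_nil; rewrite ?expf_neq0.
rewrite m1 serre_value1 ?expf_neq0 //.
have mkl : m k l = 1%N by exact: sd_orderC.
have -> : rho = 1.
  have -> : rho = qroot (q ^+ d k) 1 0 by rewrite /rho mkl; move: um; rewrite mkl; case: u {rho0 F rho}.
  by rewrite /qroot !expr0 divr1.
by rewrite invr1 scale1r !utM !(mulr0, mul0r, addr0, add0r) subrr.
Qed.
End SerreAlgebra.
Arguments axis_rep [K n] S k x.

(** * Linear parts of homomorphisms *)

Record is_alg_hom (K : fieldType) (A B : lalgType K) (phi : A -> B) : Prop :=
  IsAlgHom {
  ahomD : {morph phi : x y / x + y};
  ahomM : {morph phi : x y / x * y};
  ahom1 : phi 1 = 1;
  ahomZ : forall c x, phi (c *: x) = c *: phi x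
}.

Section AlgHom.
Variables (K : fieldType) (A B : lalgType K).

Lemma lrmorphism_alg_hom (phi : {lrmorphism A -> B}) : is_alg_hom phi.
Proof. by split=> [||| c x]; [exact: rmorphD|exact: rmorphM|exact: rmorph1|exact: linearZ]. Qed.

Lemma alg_hom_inv (phi : A -> B) psi :
  is_alg_hom phi -> cancel phi psi -> cancel psi phi -> is_alg_hom psi.
Proof.
move=> P phiK psiK; split=> [x y|x y||c x]; apply: (can_inj phiK).
- by rewrite (ahomD P) !psiK.
- by rewrite (ahomM P) !psiK.
- by rewrite (ahom1 P) !psiK.
- by rewrite (ahomZ P) !psiK.
Qed.

Lemma rep_comp (phi : A -> B) (T : nzRingType) (f : K -> T) (psi : B -> T) :
  is_alg_hom phi -> is_rep f psi -> is_rep f (psi \o phi).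
Proof.
move=> P Q; split=> [x y|x y||c x] /=.
- by rewrite (ahomD P) (repD Q).
- by rewrite (ahomM P) (repM Q).
- by rewrite (ahom1 P) (rep1 Q).
- by rewrite (ahomZ P) (repZ Q).
Qed.
End AlgHom.

Lemma rep_coef0_id (K : fieldType) (A : lalgType K) (psi : A -> {poly K}) :
  is_rep polyC psi -> is_rep (idfun : K -> K) (fun x => (psi x)`_0).
Proof.
move=> P; split=> [x y|x y||c x] /=; first by rewrite (repD P) coefD.
- by rewrite rep_coef0M.
- by rewrite (rep1 P) coefC.
- by rewrite (repZ P) coefCM.
Qed.

Lemma presented_coef0_eq (K : fieldType) (I : choiceType) (S : relators K I)
    (psi1 psi2 : presented_algebra S -> {poly K}) :
    is_rep polyC psi1 -> is_rep polyC psi2 ->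
    (forall i, (psi1 (presented_gen S i))`_0 = (psi2 (presented_gen S i))`_0) ->
  forall x, (psi1 x)`_0 = (psi2 x)`_0.
Proof.
move=> /rep_coef0_id P1 /rep_coef0_id P2 e.
elim/presented_ind => [|i a IHa|a b IHa IHb|c a IHa].
- by rewrite (rep1 P1) (rep1 P2).
- by rewrite (repM P1) (repM P2) e IHa.
- by rewrite (repD P1) (repD P2) IHa IHb.
- by rewrite (repZ P1) (repZ P2) IHa.
Qed.

Lemma derivation_lin (K : fieldType) (A : lalgType K) (c0 c1 c2 : A -> K) t :
  is_derivation c0 c1 -> is_derivation c0 c2 ->
  is_derivation c0 (fun x => c1 x + t * c2 x).
Proof.
move=> P1 P2; split=> [x y|c x|x y].
- by rewrite (derD P1) (derD P2) mulrDr addrACA.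
- by rewrite (derZ P1) (derZ P2) mulrDr mulrCA.
- by rewrite (derM P1) (derM P2); ring.
Qed.

Lemma eq_derivation (K : fieldType) (A : lalgType K) (c0 c0' c1 : A -> K) :
  c0 =1 c0' -> is_derivation c0 c1 -> is_derivation c0' c1.
Proof.
move=> e P; split=> [x y|c x|x y]; first exact: derD P x y.
  exact: derZ P c x.
by rewrite (derM P) !e.
Qed.

Lemma derivation_sum (K : fieldType) (A : lalgType K) (I : Type) (r : seq I)
    (c0 : A -> K) (c1 : I -> A -> K) (t : I -> K) :
    (forall i, is_derivation c0 (c1 i)) ->
  is_derivation c0 (fun x => \sum_(i <- r) t i * c1 i x).
Proof.
move=> P; elim: r => [|i r IHr].
  by split=> [x y|c x|x y]; rewrite !big_nil ?(mulr0, addr0, mul0r).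
have := derivation_lin (t i) IHr (P i).
by case=> D Z M; split=> [x y|c x|x y]; rewrite !big_cons ![_ * _ + \sum_(j <- r) _]addrC.
Qed.

Section Transfer.
Variables (K : fieldType) (q : K).
Hypotheses (q_neq0 : q != 0) (qX_neq1 : forall n, (0 < n)%N -> q ^+ n != 1).
Variables (n1 n2 : nat) (D1 : serre_data n1) (D2 : serre_data n2).
Variables (S1 : relators K 'I_n1) (S2 : relators K 'I_n2).
Local Notation d1 := (sd_len D1).
Local Notation m1 := (sd_order D1).
Local Notation d2 := (sd_len D2).
Local Notation m2 := (sd_order D2).
Hypothesis SE1 : forall r, S1 r <-> exists i j : 'I_n1, i != j /\
  r = qserre (q ^+ d1 i) (m1 i j) (free_gen K i) (free_gen K j).
Hypothesis SE2 : forall r, S2 r <-> exists i j : 'I_n2, i != j /\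
  r = qserre (q ^+ d2 i) (m2 i j) (free_gen K i) (free_gen K j).
Local Notation A := (presented_algebra S1 : algType K).
Local Notation B := (presented_algebra S2 : algType K).
Variable phi : A -> B.
Hypothesis phiP : is_alg_hom phi.

Let axisP k := axis_repP qX_neq1 SE2 k.

(** The Jacobian matrix at the augmentation of B of the map that phi induces
    on characters. *)
Definition linear_part : 'M[K]_(n1, n2) :=
  \matrix_(i, k) (axis_rep S2 k (phi (presented_gen S1 i)))`_1.
Local Notation M := linear_part.

Let axis_coef0 k l x : (axis_rep S2 k x)`_0 = (axis_rep S2 l x)`_0.
Proof.
have [Pk Gk] := axisP k; have [Pl Gl] := axisP l.
apply: presented_coef0_eq => // i; rewrite Gk Gl.
by case: (i == k); case: (i == l); rewrite ?coefX ?coef0.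
Qed.

(** The chain rule: lift the generators of B to words a_k in those of A; the
    partial derivatives of a_k at the character of A induced by the augmentation
    of B give a left inverse. *)
Lemma linear_part_left_inverse :
  (forall y, exists x, phi x = y) -> exists N, N *m M = 1%:M.
Proof.
move=> surj.
have /choice[a aP] k : exists a, phi (presented_pi S1 a) = presented_gen S2 k.
  have [x <-] := surj (presented_gen S2 k).
  by have [a <-] := presented_pi_surj x; exists a.
pose c k i := (axis_rep S2 k (phi (presented_gen S1 i)))`_0.
pose F k i j : {poly K} := (c k j)%:P + (if j == i then 'X else 0).
exists (\matrix_(k, i) (free_eval (@polyC K) (F k i) (a k))`_1).
apply/matrixP => k l; rewrite !mxE.
have cl j : c k j = c l j by exact: axis_coef0.
have Fl i j : F k i j = F l i j by rewrite /F cl.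
have [Pl Gl] := axisP l.
have PlA := presented_rep_pi (rep_comp phiP Pl).
have PF i := free_eval_rep (F l i) (@polyC_central K).
have e0 i b : (axis_rep S2 l (phi (presented_pi S1 b)))`_0
            = (free_eval (@polyC K) (F l i) b)`_0.
  apply: (free_rep_eq (rep_coef0_id PlA) (rep_coef0_id (PF i))) => j /=.
  rewrite free_eval_gen coefD coefC /=.
  by case: (j == i); rewrite ?coefX ?coef0 addr0.
have Dl := rep_derivation PlA.
have DF i : is_derivation (fun b => (axis_rep S2 l (phi (presented_pi S1 b)))`_0)
                 (fun b => (free_eval (@polyC K) (F l i) b)`_1).
  by apply: eq_derivation (rep_derivation (PF i)) => b; rewrite (e0 i).
have D0 := free_derivation0
   (derivation_lin (-1) Dl (derivation_sum (index_enum 'I_n1) (fun i => M i l) DF)).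
have : (if k == l then 'X else 0)`_1
  - \sum_i M i l * (free_eval (@polyC K) (F l i) (a k))`_1 = 0 :> K.
  rewrite -mulN1r -Gl -aP; apply: D0 => [|j] /=.
    by have := rep1 PlA => /= ->; rewrite coefC.
  rewrite mulN1r (bigD1 j) //= free_eval_gen big1 => [|i ij].
    by rewrite addr0 /F eqxx coefD coefC coefX add0r mulr1 mxE subrr.
  by rewrite free_eval_gen /F eq_sym (negbTE ij) addr0 coefC mulr0.
move/eqP; rewrite subr_eq0 => /eqP E.
rewrite (_ : (k == l)%:R = (if k == l then 'X else 0 : {poly K})`_1); last first.
  by case: (k == l); rewrite ?coefX ?coef0.
rewrite E; apply: eq_bigr => i _; rewrite !mxE mulrC.
by rewrite (_ : F k i = F l i) //; apply/funext => j.
Qed.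

Lemma poly_avoid (p : {poly K}) : p != 0 -> exists s, p.[s] != 0.
Proof.
move=> p0; apply: contrapT => H.
have /(max_poly_roots p0) : all (root p) [seq q ^+ i | i <- iota 0 (size p)].
  apply/allP => s _; rewrite /root; apply/negPn/negP => ps; apply: H.
  by exists s.
rewrite map_inj_uniq ?iota_uniq; last exact: qX_inj.
by rewrite size_map size_iota ltnn => /(_ isT).
Qed.

(** If k and l were not adjacent, a line of characters of B in a generic
    direction of the (k, l)-plane would induce a curve of characters of A with
    nonzero velocity in both coordinates i and j, against [rep_adjacent]. *)
Lemma adjacent_transfer i j k l : k != l -> M i k != 0 -> M j l != 0 ->
  adjacent D1 i j -> adjacent D2 k l.
Proof.
move=> kl Mik Mjl aij; apply/negPn/negP => nkl.
pose p : {poly K} := ((M i k)%:P + M i l *: 'X) * ((M j k)%:P + M j l *: 'X).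
have /poly_avoid[s] : p != 0.
  rewrite mulf_neq0 //; apply/eqP => /polyP.
    by move=> /(_ 0%N); rewrite coefD coefC coefZ coefX mulr0 addr0 coef0 => /eqP; rewrite (negbTE Mik).
  by move=> /(_ 1%N); rewrite coefD coefC coefZ coefX mulr1 add0r coef0 => /eqP; rewrite (negbTE Mjl).
rewrite /p hornerM !(hornerD, hornerC, hornerZ, hornerX) => ps.
have [psi psiP psiG] := pair_rep q_neq0 qX_neq1 SE2 s kl nkl.
have [Pk Gk] := axisP k; have [Pl Gl] := axisP l.
have coef1 x : (psi x)`_1 = (axis_rep S2 k x)`_1 + s * (axis_rep S2 l x)`_1.
  have e0 b : (axis_rep S2 k b)`_0 = (psi b)`_0.
    apply: presented_coef0_eq => // a; rewrite Gk psiG.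
    by case: (a == k); case: (a == l); rewrite ?coefZ ?coefX ?coef0 ?mulr0.
  have e1 b : (axis_rep S2 l b)`_0 = (psi b)`_0 by rewrite -e0 (axis_coef0 l k).
  have Dk := eq_derivation e0 (rep_derivation Pk).
  have Dl := eq_derivation e1 (rep_derivation Pl).
  apply/eqP; rewrite -subr_eq0 -mulN1r; apply/eqP.
  apply: (presented_derivation0 (derivation_lin (-1) (rep_derivation psiP) (derivation_lin s Dk Dl))).
    by rewrite /= (rep1 psiP) coefC.
  move=> a; rewrite /= psiG Gk Gl.
  have [->|ak] := eqVneq a k; first by rewrite (negbTE kl) !coefX coef0 /=; ring.
  by case: (a == l); rewrite ?coefZ ?coefX ?coef0; ring.
have := rep_adjacent q_neq0 qX_neq1 SE1 (rep_comp phiP psiP) aij => /=.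
have E a : (psi (phi (presented_gen S1 a)))`_1 = M a k + M a l * s.
  by rewrite coef1 !mxE mulrC.
by case=> e; move: ps; rewrite -!E e coef0 ?(mul0r, mulr0) eqxx.
Qed.

(** Every ratio rho of the relation (k, l) is also one of the relation (i, j):
    to first order, the representation of B that realizes rho induces one of A
    in which the generator i is triangular with ratio rho and the generator j
    is strictly triangular. *)
Lemma order_transfer i j k l : k != l -> M i k != 0 -> M j l != 0 ->
  adjacent D1 i j -> (m2 k l <= m1 i j)%N.
Proof.
move=> kl Mik Mjl aij; have ij : i != j by case/andP: aij.
pose r1 v := qroot (q ^+ d1 i) (m1 i j) v.
pose r2 u := qroot (q ^+ d2 k) (m2 k l) u.
have qd1 := qXd_neq1 qX_neq1 (sd_len_gt0 D1 i).
have qd2 := qXd_neq1 qX_neq1 (sd_len_gt0 D2 k).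
suff sub : {subset [seq r2 u | u <- iota 0 (m2 k l)]
                <= [seq r1 v | v <- iota 0 (m1 i j)]}.
  have := uniq_leq_size _ sub; rewrite !size_map !size_iota; apply.
  rewrite map_inj_uniq ?iota_uniq //; apply: qroot_inj => //.
  by rewrite expf_neq0.
move=> x /mapP[u + ->] {x}; rewrite mem_iota add0n => /andP[_ um].
have r20 : r2 u != 0 by apply: qroot_neq0; rewrite expf_neq0.
have [Th ThP ThG] := root_rep q_neq0 qX_neq1 SE2 kl um.
rewrite -/(r2 u) in ThG.
have [Pk Gk] := axisP k; have [Pl Gl] := axisP l.
have lk : (l == k) = false by rewrite eq_sym (negbTE kl).
have coefM1 (f g : {poly K}) : (f * g)`_1 = f`_0 * g`_1 + f`_1 * g`_0.
  by rewrite coefM big_ord_recl big_ord1.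
have coefM0 (f g : {poly K}) : (f * g)`_0 = f`_0 * g`_0.
  by rewrite coefM big_ord1.
have mx2M (X Y : 'M[{poly K}]_2) a b : (X * Y) a b = X a 0 * Y 0 b + X a 1 * Y 1 b.
  by rewrite !mxE big_ord_recl big_ord1; congr (_ + _ * _); congr (_ _ _); apply: val_inj.
(* All values of Th are triangular, hence its diagonal entries are characters. *)
have low : forall b, Th b 1 0 = 0.
  apply: (presented_ind (P := fun b => Th b 1 0 = 0)) => [|a x IH|x y IHx IHy|c x IH].
  - by rewrite (rep1 ThP) mxE.
  - rewrite (repM ThP) mx2M IH mulr0 addr0 ThG.
    by case: (a == k); first rewrite mxE /= mul0r //; case: (a == l); rewrite !mxE /= mul0r.
  - by rewrite (repD ThP) mxE IHx IHy addr0.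
  - by rewrite (repZ ThP) scalar_polyCE mx2M IH !mxE /= mul0r mulr0 addr0.
have diag b : b = 0 \/ b = 1 -> is_rep polyC (fun x => Th x b b).
  move=> bP; split=> [x y|x y||c x] /=.
  - by rewrite (repD ThP) mxE.
  - rewrite (repM ThP) mx2M; case: bP => ->; rewrite low ?(mulr0, mul0r) ?addr0 ?add0r //.
  - by rewrite (rep1 ThP) mxE eqxx.
  - by rewrite (repZ ThP) scalar_polyCE mx2M; case: bP => ->; rewrite !mxE /= mul0r ?addr0 ?add0r.
(* To first order, Th is given by the axis curves for k, on the diagonal with
   ratio rho, and for l, off the diagonal. *)
pose good x := [/\ (Th x 0 0)`_0 = (axis_rep S2 l x)`_0,
  (Th x 1 1)`_0 = (axis_rep S2 l x)`_0, (Th x 0 1)`_0 = 0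
  & [/\ (Th x 0 1)`_1 = (axis_rep S2 l x)`_1,
  (Th x 0 0)`_1 = (r2 u)^-1 * (axis_rep S2 k x)`_1 &
  (Th x 1 1)`_1 = (axis_rep S2 k x)`_1]].
have goodP : forall x, good x.
  apply: (presented_ind (P := good)) => [|a x IH|x y IHx IHy|c x IH]; rewrite /good.
  - by rewrite (rep1 ThP) (rep1 Pk) (rep1 Pl) !mxE /= !coefC mulr0.
  - have [h1 h2 h3 [h4 h5 h6]] := IH.
    have hk : (axis_rep S2 k x)`_0 = (axis_rep S2 l x)`_0 by exact: axis_coef0.
    rewrite (repM ThP) (repM Pk) (repM Pl) !mx2M ThG Gk Gl low.
    rewrite !coefD !coefM1 !coefM0 h1 h2 h3 h4 h5 h6 hk.
    have [->|ak] := eqVneq a k; first rewrite (negbTE kl) !mxE /= !coefZ !coefX !coef0 /=.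
      by split; [ring|ring|ring|split; ring].
    have [_|al] := eqVneq a l; rewrite !mxE /= ?coefX !coef0 /=.
      by split; [ring|ring|ring|split; ring].
    by split; [ring|ring|ring|split; ring].
  - have [h1 h2 h3 [h4 h5 h6]] := IHx; have [g1 g2 g3 [g4 g5 g6]] := IHy.
    rewrite (repD ThP) (repD Pk) (repD Pl) !mxE !coefD.
    by rewrite h1 h2 h3 h4 h5 h6 g1 g2 g3 g4 g5 g6 mulrDr addr0.
  - have [h1 h2 h3 [h4 h5 h6]] := IH.
    rewrite (repZ ThP) (repZ Pk) (repZ Pl) scalar_polyCE !mx2M low !mxE /=.
    rewrite !coefD !coefM1 !coefM0 !coefC ?coef0 /= h1 h2 h3 h4 h5 h6.
    by split; [ring|ring|ring|split; ring].
have [_ _ _ [_ c00 c11]] := goodP (phi (presented_gen S1 i)).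
have [_ _ _ [c01 _ _]] := goodP (phi (presented_gen S1 j)).
set X := Th (phi (presented_gen S1 i)) in c00 c11.
set Y := Th (phi (presented_gen S1 j)) in c01.
have c00n : X 0 0 != 0.
  apply/eqP => e; move: c00; rewrite e coef0 => /esym/eqP.
  by rewrite mulf_eq0 invr_eq0 (negbTE r20); move: Mik; rewrite mxE => /negbTE ->.
have c11n : X 1 1 != 0.
  by apply/eqP => e; move: c11; rewrite e coef0 => /esym/eqP; move: Mik; rewrite mxE => /negbTE ->.
(* On each diagonal entry, i and j are adjacent and the value at i is nonzero. *)
have Y00 : Y 0 0 = 0.
  have := rep_adjacent q_neq0 qX_neq1 SE1 (rep_comp phiP (diag 0 (or_introl erefl))) aij.
  by case=> //= /eqP; rewrite (negbTE c00n).
have Y11 : Y 1 1 = 0.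
  have := rep_adjacent q_neq0 qX_neq1 SE1 (rep_comp phiP (diag 1 (or_intror erefl))) aij.
  by case=> //= /eqP; rewrite (negbTE c11n).
have YE : Y = ut 0 (Y 0 1) 0 by apply: mx2P; rewrite !mxE /= ?low.
have XE : X = ut (X 0 0) (X 0 1) (X 1 1) by apply: mx2P; rewrite !mxE /= ?low.
have := rep_serre SE1 (rep_comp phiP ThP) ij; rewrite /= -/X -/Y YE XE.
rewrite serre_value_ut ?expf_neq0 // => /matrixP/(_ 0 1); rewrite !mxE /= => /eqP.
rewrite mulf_eq0 => /orP[/eqP e|].
  by move: c01; rewrite e coef0 => /esym/eqP; move: Mjl; rewrite mxE => /negbTE ->.
rewrite prodf_seq_eq0 => /hasP[v _ /=]; rewrite subr_eq0 => /eqP e.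
apply/mapP; exists (v : nat); first by rewrite mem_iota /= add0n.
move: c11; rewrite e coefCM c00 => /eqP; rewrite mulrA -[X in _ == X]mul1r.
rewrite -subr_eq0 -mulrBl mulf_eq0; move: Mik; rewrite mxE => /negbTE ->.
by rewrite orbF subr_eq0 => /eqP/(canRL (mulfVK r20)); rewrite mul1r => <-.
Qed.
End Transfer.

(** * Isomorphic Serre algebras have relations of the same orders *)

(** Some term of the expansion of the determinant is nonzero. *)
Lemma unitmx_nonzero_perm (K : fieldType) n (M : 'M[K]_n) :
  M \in unitmx -> exists s : 'S_n, forall i, M i (s i) != 0.
Proof.
rewrite unitmxE unitfE => detM; apply: contrapT => H; case/eqP: detM.
rewrite /determinant big1 // => s _.
have [i /eqP Mi] : exists i, M i (s i) = 0.
  apply: contrapT => H'; apply: H; exists s => i; apply/eqP => Mi.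
  by apply: H'; exists i.
by rewrite (bigD1 i) //= (eqP Mi) mul0r mulr0.
Qed.

(** Two functions of pairs that are dominated by one another along permutations
    have the same sum, so the domination is an equality. *)
Lemma perm_domination_eq n (f g : 'I_n -> 'I_n -> nat) (s s' : 'S_n) :
    (forall i j, f i j <= g (s i) (s j))%N ->
    (forall i j, g i j <= f (s' i) (s' j))%N ->
  forall i j, f i j = g (s i) (s j).
Proof.
move=> fg gf.
have reindex_sum (h : 'I_n -> 'I_n -> nat) (t : 'S_n) :
    (\sum_(i < n) \sum_(j < n) h (t i) (t j) = \sum_(i < n) \sum_(j < n) h i j)%N.
  rewrite [RHS](reindex_inj (@perm_inj _ t)); apply: eq_bigr => i _.
  by rewrite [RHS](reindex_inj (@perm_inj _ t)).
have le1 : (\sum_(i < n) \sum_(j < n) g i j <= \sum_(i < n) \sum_(j < n) f i j)%N.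
  rewrite -(reindex_sum f s').
  by apply: leq_sum => i _; apply: leq_sum => j _.
have L i j : (f i j <= g (s i) (s j) ?= iff (f i j == g (s i) (s j)))%N.
  by split; first exact: fg.
have [_ /esym] := leqif_sum (fun i (_ : true) => leqif_sum (fun j (_ : true) => L i j)).
rewrite (reindex_sum g s) eqn_leq le1 andbT.
have -> : (\sum_(i < n) \sum_(j < n) f i j <= \sum_(i < n) \sum_(j < n) g i j)%N.
  rewrite -(reindex_sum g s).
  by apply: leq_sum => i _; apply: leq_sum => j _.
by move=> /forallP H i j; have /forallP/(_ j)/eqP := H i.
Qed.

Section Rigidity.
Variables (K : fieldType) (q : K).
Hypotheses (q_neq0 : q != 0) (qX_neq1 : forall n, (0 < n)%N -> q ^+ n != 1).

(** The nonzero entries of the Jacobian matrices of the isomorphism and of its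
    inverse give permutations along which adjacency, then the orders, can only
    decrease; so they are preserved. *)
Theorem serre_rigidity n1 n2 (D1 : serre_data n1) (D2 : serre_data n2)
    (S1 : relators K 'I_n1) (S2 : relators K 'I_n2) :
    (forall r, S1 r <-> exists i j : 'I_n1, i != j /\
       r = qserre (q ^+ sd_len D1 i) (sd_order D1 i j) (free_gen K i) (free_gen K j)) ->
    (forall r, S2 r <-> exists i j : 'I_n2, i != j /\
       r = qserre (q ^+ sd_len D2 i) (sd_order D2 i j) (free_gen K i) (free_gen K j)) ->
    alg_isomorphic (presented_algebra S1) (presented_algebra S2) ->
  exists2 s : 'I_n1 -> 'I_n2, bijective s &
    forall i j, i != j -> sd_order D1 i j = sd_order D2 (s i) (s j).
Proof.
move=> SE1 SE2 [phi [psi phiK psiK]].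
have phiP := lrmorphism_alg_hom phi.
have psiP := alg_hom_inv phiP phiK psiK.
have [N1 NM1] := linear_part_left_inverse qX_neq1 SE2 phiP
                   (fun y => ex_intro _ (psi y) (psiK y)).
have [N2 NM2] := linear_part_left_inverse qX_neq1 SE1 psiP
                   (fun x => ex_intro _ (phi x) (phiK x)).
have e : n1 = n2.
  by apply/eqP; rewrite eqn_leq (mulmx1_min NM1) (mulmx1_min NM2).
subst n2.
have [_ /unitmx_nonzero_perm[s sM]] := mulmx1_unit NM1.
have [_ /unitmx_nonzero_perm[t tM]] := mulmx1_unit NM2.
pose a1 i j : nat := adjacent D1 i j; pose a2 i j : nat := adjacent D2 i j.
have adj1 i j : adjacent D1 i j -> adjacent D2 (s i) (s j).
  move=> aij; apply: (adjacent_transfer q_neq0 qX_neq1 SE1 SE2 phiP _ (sM i) (sM j)) => //.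
  by rewrite (inj_eq perm_inj); case/andP: aij.
have adj2 i j : adjacent D2 i j -> adjacent D1 (t i) (t j).
  move=> aij; apply: (adjacent_transfer q_neq0 qX_neq1 SE2 SE1 psiP _ (tM i) (tM j)) => //.
  by rewrite (inj_eq perm_inj); case/andP: aij.
have nat_of_bool_inj : injective nat_of_bool by case=> [] [].
have adjE1 i j : adjacent D1 i j = adjacent D2 (s i) (s j).
  apply: nat_of_bool_inj; rewrite -/(a1 i j) -/(a2 (s i) (s j)).
  move: i j; apply: (@perm_domination_eq _ a1 a2 s t) => i j; rewrite /a1 /a2.
    by case h : (adjacent D1 i j); rewrite // (adj1 _ _ h).
  by case h : (adjacent D2 i j); rewrite // (adj2 _ _ h).
have adjE2 i j : adjacent D2 i j = adjacent D1 (t i) (t j).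
  apply: nat_of_bool_inj; rewrite -/(a2 i j) -/(a1 (t i) (t j)).
  move: i j; apply: (@perm_domination_eq _ a2 a1 t s) => i j; rewrite /a1 /a2.
    by case h : (adjacent D2 i j); rewrite // (adj2 _ _ h).
  by case h : (adjacent D1 i j); rewrite // (adj1 _ _ h).
have ord1 n (D : serre_data n) i j : i != j -> ~~ adjacent D i j -> sd_order D i j = 1%N.
  by move=> ij; rewrite /adjacent ij negbK => /eqP.
pose m1 i j := if i == j then 0%N else sd_order D1 i j.
pose m2 i j := if i == j then 0%N else sd_order D2 i j.
exists s; first by exists (s^-1)%g => i; rewrite ?permK ?permKV.
suff H : forall i j, m2 (s i) (s j) = m1 i j.
  by move=> i j ij; have := H i j; rewrite /m1 /m2 (inj_eq perm_inj) (negbTE ij).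
have le21 i j : (m2 (s i) (s j) <= m1 i j)%N.
  rewrite /m1 /m2 (inj_eq perm_inj); have [//|ij] := eqVneq i j.
  have [h|h] := boolP (adjacent D1 i j).
    apply: (order_transfer q_neq0 qX_neq1 SE1 SE2 phiP _ (sM i) (sM j) h).
    by rewrite (inj_eq perm_inj).
  by rewrite (ord1 _ D2) ?(inj_eq perm_inj) -?adjE1 // sd_order_gt0.
have le12 i j : (m1 (t i) (t j) <= m2 i j)%N.
  rewrite /m1 /m2 (inj_eq perm_inj); have [//|ij] := eqVneq i j.
  have [h|h] := boolP (adjacent D2 i j).
    apply: (order_transfer q_neq0 qX_neq1 SE2 SE1 psiP _ (tM i) (tM j) h).
    by rewrite (inj_eq perm_inj).
  by rewrite (ord1 _ D1) ?(inj_eq perm_inj) -?adjE2 // sd_order_gt0.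
move=> i j.
have := @perm_domination_eq _ m2 m1 (s^-1)%g (t^-1)%g _ _ (s i) (s j).
rewrite !permK; apply=> {}i {}j; first by have := le21 ((s^-1)%g i) ((s^-1)%g j); rewrite !permKV.
by have := le12 ((t^-1)%g i) ((t^-1)%g j); rewrite !permKV.
Qed.
End Rigidity.

(** * Relabelling the generators *)

Lemma alg_hom_lrmorphism (K : fieldType) (A B : algType K) (phi : A -> B) :
  is_alg_hom phi -> exists F : {lrmorphism A -> B}, F =1 phi.
Proof.
move=> P.
have L : linear phi by move=> c x y; rewrite (ahomD P) (ahomZ P).
have M : monoid_morphism phi by split; [exact: (ahom1 P)|exact: (ahomM P)].
pose F : {lrmorphism A -> B} := HB.pack phi
  (GRing.isLinear.Build K A B *:%R phi L) (GRing.isMonoidMorphism.Build A B phi M).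
by exists F.
Qed.

Section Relabel.
Variables (K : fieldType) (q : K) (n1 n2 : nat).
Variables (d1 : 'I_n1 -> nat) (m1 : 'I_n1 -> 'I_n1 -> nat).
Variables (d2 : 'I_n2 -> nat) (m2 : 'I_n2 -> 'I_n2 -> nat).
Variables (S1 : relators K 'I_n1) (S2 : relators K 'I_n2).
Hypothesis SE1 : forall r, S1 r -> exists i j : 'I_n1, i != j /\
  r = qserre (q ^+ d1 i) (m1 i j) (free_gen K i) (free_gen K j).
Hypothesis SE2 : forall i j : 'I_n2, i != j ->
  S2 (qserre (q ^+ d2 i) (m2 i j) (free_gen K i) (free_gen K j)).
Variable s : 'I_n1 -> 'I_n2.
Hypothesis s_inj : injective s.
Hypothesis sd : forall i, d1 i = d2 (s i).
Hypothesis sm : forall i j, i != j -> m1 i j = m2 (s i) (s j).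

Local Notation A := (presented_algebra S1 : algType K).
Local Notation B := (presented_algebra S2 : algType K).

Lemma relabel_hom : exists2 phi : A -> B, is_alg_hom phi &
  forall i, phi (presented_gen S1 i) = presented_gen S2 (s i).
Proof.
pose f := GRing.in_alg B.
have fC (c : K) (x : B) : f c * x = x * f c.
  by rewrite /f /= /GRing.in_alg mulr_algl mulr_algr.
pose F i : B := presented_gen S2 (s i).
have id_rep : is_rep f (id : B -> B).
  by split=> [x y|x y||c x]; [| | |exact: esym (mulr_algl c x)].
have relF r : S1 r -> free_eval f F r = 0.
  move=> /SE1[i [j [ij ->]]]; rewrite (rep_qserre (free_eval_rep F fC)).
  rewrite !free_eval_gen sd sm // /F.
  by apply: (presented_rep_relator id_rep); apply: SE2; rewrite (inj_eq s_inj).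
exists (presented_lift (S := S1) f F) => [|i]; last by rewrite presented_lift_gen.
have P := presented_lift_rep fC relF.
split=> [x y|x y||c x].
- exact: repD P x y.
- exact: repM P x y.
- exact: rep1 P.
- by rewrite (repZ P) /f /= mulr_algl.
Qed.
End Relabel.

Lemma relabel_isomorphic (K : fieldType) (q : K) (n1 n2 : nat)
    (d1 : 'I_n1 -> nat) (m1 : 'I_n1 -> 'I_n1 -> nat)
    (d2 : 'I_n2 -> nat) (m2 : 'I_n2 -> 'I_n2 -> nat)
    (S1 : relators K 'I_n1) (S2 : relators K 'I_n2) (s : 'I_n1 -> 'I_n2) :
    (forall r, S1 r <-> exists i j : 'I_n1, i != j /\
      r = qserre (q ^+ d1 i) (m1 i j) (free_gen K i) (free_gen K j)) ->
    (forall r, S2 r <-> exists i j : 'I_n2, i != j /\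
      r = qserre (q ^+ d2 i) (m2 i j) (free_gen K i) (free_gen K j)) ->
    bijective s -> (forall i, d1 i = d2 (s i)) ->
    (forall i j, i != j -> m1 i j = m2 (s i) (s j)) ->
  alg_isomorphic (presented_algebra S1) (presented_algebra S2).
Proof.
move=> SE1 SE2 [t sK tK] sd sm.
have [phi phiP phiG] : exists2 phi : presented_algebra S1 -> presented_algebra S2,
    is_alg_hom phi & forall i, phi (presented_gen S1 i) = presented_gen S2 (s i).
  apply: (relabel_hom (fun r => (SE1 r).1) _ (can_inj sK) sd sm) => i j ij.
  by apply/SE2; exists i, j.
have [psi psiP psiG] : exists2 psi : presented_algebra S2 -> presented_algebra S1,
    is_alg_hom psi & forall i, psi (presented_gen S2 i) = presented_gen S1 (t i).
  apply: (relabel_hom (fun r => (SE2 r).1) _ (can_inj tK)) => [i j ij|i|i j ij].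
  - by apply/SE1; exists i, j.
  - by rewrite sd tK.
  - by rewrite sm ?tK // (inj_eq (can_inj tK)).
have [F FE] := alg_hom_lrmorphism phiP; exists F; exists psi.
- move=> x; rewrite FE; move: x.
  apply: presented_ind => [|i a IH|a b IHa IHb|c a IH].
  + by rewrite (ahom1 phiP) (ahom1 psiP).
  + by rewrite (ahomM phiP) (ahomM psiP) IH phiG psiG sK.
  + by rewrite (ahomD phiP) (ahomD psiP) IHa IHb.
  + by rewrite (ahomZ phiP) (ahomZ psiP) IH.
- move=> x; rewrite FE; move: x.
  apply: presented_ind => [|i a IH|a b IHa IHb|c a IH].
  + by rewrite (ahom1 psiP) (ahom1 phiP).
  + by rewrite (ahomM psiP) (ahomM phiP) IH psiG phiG tK.
  + by rewrite (ahomD psiP) (ahomD phiP) IHa IHb.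
  + by rewrite (ahomZ psiP) (ahomZ phiP) IH.
Qed.

(** * Generalized eigenspaces and traces *)

Section Iter.
Variables (F : fieldType) (V : vectType F).
Implicit Types (f g : 'End(V)) (v : V).

Lemma iter_lin f k : linear (iter k f).
Proof.
move=> c u v; elim: k => //= k ->; by rewrite linearP.
Qed.

Lemma iter_lin0 f k : iter k f 0 = 0.
Proof. by elim: k => //= k ->; rewrite linear0. Qed.

Lemma iter_linD f k : {morph iter k f : u v / u + v}.
Proof. by move=> u v; have := iter_lin f k 1 u v; rewrite !scale1r. Qed.

Lemma iter_linZ f k c v : iter k f (c *: v) = c *: iter k f v.
Proof. by have := iter_lin f k c v 0; rewrite iter_lin0 !addr0. Qed.

Lemma iter_comm f g k v : (forall u, f (g u) = g (f u)) ->
  iter k f (g v) = g (iter k f v).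
Proof. by move=> fg; elim: k => //= k ->; rewrite fg. Qed.

Lemma iter_lin_le f j k v : (j <= k)%N -> iter j f v = 0 -> iter k f v = 0.
Proof. by move=> jk e; rewrite -(subnK jk) iterD e iter_lin0. Qed.

Definition loc_nilpotent f := forall v, exists k, iter k f v = 0.

Lemma nilvec_sum f (I : Type) (r : seq I) (P : pred I) (z : I -> V) :
    (forall i, P i -> exists k, iter k f (z i) = 0) ->
  exists k, iter k f (\sum_(i <- r | P i) z i) = 0.
Proof.
move=> H; elim/big_rec: _ => [|i v Pi [k vk]]; first by exists 0%N.
have [j zj] := H i Pi; exists (maxn j k); rewrite iter_linD.
by rewrite (iter_lin_le (leq_maxl j k) zj) (iter_lin_le (leq_maxr j k) vk) addr0.
Qed.

(** A maximal free family in P spans. *)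
Lemma exists_basis_in (P : V -> Prop) :
    (forall U : {vspace V}, (forall v, P v -> v \in U) -> U = fullv) ->
  exists2 b : (\dim {:V}).-tuple V, basis_of fullv b & forall i : 'I_(\dim {:V}), P b`_i.
Proof.
move=> spanP.
have step k : (k <= \dim {:V})%N -> exists s : seq V,
    [/\ size s = k, free s & forall v, v \in s -> P v].
  elim: k => [_|k IHk kn]; first by exists [::]; rewrite nil_free.
  have [s [sz fs Ps]] := IHk (ltnW kn).
  have [v Pv vs] : exists2 v, P v & v \notin <<s>>%VS.
    apply: contrapT => H; have sf : <<s>>%VS = fullv.
      by apply: spanP => v Pv; apply: contrapT => /negP vs; apply: H; exists v.
    by move: fs kn; rewrite /free sf sz => /eqP ->; rewrite ltnn.
  exists (v :: s); split=> [|| u]; first by rewrite /= sz.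
    by rewrite free_cons vs.
  by rewrite inE => /orP[/eqP ->|/Ps].
have [s [sz fs Ps]] := step _ (leqnn _).
have szb : size s == \dim {:V} by rewrite sz.
exists (Tuple szb) => [|i]; last by apply: Ps; rewrite mem_nth ?sz.
by rewrite basisEfree fs subvf /= sz leqnn.
Qed.
End Iter.

Section GenEigen.
Variables (F : fieldType) (V : vectType F) (f : 'End(V)).
Implicit Types (a c : F) (u v z : V).

Definition shift a : 'End(V) := f - a *: \1%VF.

Lemma shiftE a v : shift a v = f v - a *: v.
Proof. by rewrite /shift add_lfunE opp_lfunE scale_lfunE id_lfunE. Qed.

Lemma shiftC a c v : shift a (shift c v) = shift c (shift a v).
Proof.
by rewrite !shiftE !linearB /= !linearZ /= !scalerA [a * c]mulrC addrACA.
Qed.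

(** Generalized eigenvectors. *)
Definition geigen a v := exists k, iter k (shift a) v = 0.

Lemma geigen0 a : geigen a 0. Proof. by exists 0%N. Qed.

Lemma geigen_sum a (I : Type) (r : seq I) (P : pred I) (z : I -> V) :
  (forall i, P i -> geigen a (z i)) -> geigen a (\sum_(i <- r | P i) z i).
Proof. exact: nilvec_sum. Qed.

Lemma geigenD a u v : geigen a u -> geigen a v -> geigen a (u + v).
Proof.
move=> gu gv; have := @geigen_sum a bool [:: true; false] xpredT (fun b => if b then u else v).
by rewrite !big_cons big_nil addr0; apply; case.
Qed.

Lemma geigenZ a c v : geigen a v -> geigen a (c *: v).
Proof. by case=> k e; exists k; rewrite iter_linZ e scaler0. Qed.

Lemma geigenB a u v : geigen a u -> geigen a v -> geigen a (u - v).
Proof. by move=> gu gv; rewrite -scaleN1r; apply: geigenD => //; apply: geigenZ. Qed.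

Lemma geigen_shift a c v : geigen a v -> geigen a (shift c v).
Proof.
by case=> k e; exists k; rewrite iter_comm ?e ?linear0 // => u; rewrite shiftC.
Qed.

Lemma geigen_iter a c k v : geigen a v -> geigen a (iter k (shift c) v).
Proof. by move=> gv; elim: k => //= k IHk; apply: geigen_shift. Qed.

Lemma geigen_eigen a v : f v = a *: v -> geigen a v.
Proof. by move=> e; exists 1%N; rewrite /= shiftE e subrr. Qed.

Section Stable.
Variable W : {vspace V}.
Hypothesis Wf : forall v, v \in W -> f v \in W.

Lemma shift_stable a v : v \in W -> shift a v \in W.
Proof. by move=> vW; rewrite shiftE memvB ?memvZ // Wf. Qed.

Lemma iter_shift_stable a k v : v \in W -> iter k (shift a) v \in W.
Proof. by move=> vW; elim: k => //= k; apply: shift_stable. Qed.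

(** On a generalized eigenspace for a != c, shift c is the sum of a nonzero
    scalar and a nilpotent operator. *)
Lemma geigen_shift_mem a c z : a != c -> geigen a z -> shift c z \in W -> z \in W.
Proof.
move=> ac [k]; elim: k z => [|k IHk] z e; first by rewrite [z]e mem0v.
move=> cz; have az : shift a z \in W.
  by apply: IHk; [rewrite -iterSr|rewrite shiftC shift_stable].
have : (a - c) *: z \in W.
  have -> : (a - c) *: z = shift c z - shift a z.
    by rewrite scalerBl !shiftE opprB [RHS]addrC addrA subrK.
  exact: memvB.
by move=> /(memvZ (a - c)^-1); rewrite scalerA mulVf ?scale1r // subr_eq0.
Qed.

Lemma geigen_iter_mem a c k z :
  a != c -> geigen a z -> iter k (shift c) z \in W -> z \in W.
Proof.
move=> ac gz; elim: k => [//|k IHk h]; apply: IHk.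
exact: (geigen_shift_mem ac (geigen_iter c k gz) h).
Qed.

(** Apply a high power of shift c' for one of the other eigenvalues c': this
    removes one term, and the remaining ones can be recovered from their images. *)
Lemma geigen_components (cs : seq F) (z : F -> V) : uniq cs ->
    (forall c, geigen c (z c)) -> \sum_(c <- cs) z c \in W ->
  forall c, c \in cs -> z c \in W.
Proof.
elim: cs z => [|c0 cs IH] z //= /andP[c0cs ucs] gz.
rewrite big_cons => sW; have [k k0] := gz c0.
have rest c : c \in cs -> z c \in W.
  move=> cc; have cc0 : c != c0 by apply: contraNneq c0cs => <-.
  apply: (@geigen_iter_mem c c0 k) => //.
  apply: (IH (fun c => iter k (shift c0) (z c))) => //.
    by move=> c'; apply: geigen_iter.
  have -> : \sum_(i <- cs) iter k (shift c0) (z i)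
          = iter k (shift c0) (z c0 + \sum_(j <- cs) z j).
    rewrite iter_linD k0 add0r.
    by rewrite (big_morph _ (iter_linD (shift c0) k) (iter_lin0 (shift c0) k)).
  exact: iter_shift_stable.
move=> c; rewrite inE => /orP[/eqP ->|/rest //].
have -> : z c0 = (z c0 + \sum_(j <- cs) z j) - \sum_(j <- cs) z j by rewrite addrK.
by rewrite memvB // big_seq; apply: memv_suml.
Qed.
End Stable.
End GenEigen.

Section GenBasis.
Variables (F : closedFieldType) (V : vectType F) (f : 'End(V)).

(** The action of polynomials on V through f.  Annihilators are taken vector by
    vector, which avoids matrices. *)
Definition act (p : {poly F}) (v : V) : V := \sum_(i < size p) p`_i *: iter i f v.

Lemma actE n (p : {poly F}) v : (size p <= n)%N -> act p v = \sum_(i < n) p`_i *: iter i f v.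
Proof.
move=> pn; rewrite /act (big_ord_widen n (fun i => p`_i *: iter i f v)) //.
rewrite big_mkcond; apply: eq_bigr => i _; case: ltnP => // /(nth_default 0) ->.
by rewrite scale0r.
Qed.

Lemma act_mulXsubC (p : {poly F}) r v : act (p * ('X - r%:P)) v = act p (shift f r v).
Proof.
rewrite (@actE (size p).+1); last first.
  by apply: leq_trans (size_polyMleq _ _) _; rewrite size_XsubC addn2.
have e i : (p * ('X - r%:P))`_i = (if i == 0%N then 0 else p`_i.-1) - r * p`_i.
  by rewrite mulrBr coefB coefMX coefMC mulrC.
under eq_bigr => i _ do rewrite e scalerBl.
rewrite sumrB big_ord_recl /= scale0r add0r big_ord_recr /= nth_default // mulr0 scale0r addr0.
rewrite -sumrB /act; apply: eq_bigr => i _.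
rewrite /bump /= ?add0n ?add1n /= mulrC -scalerA -scalerBr; congr (_ *: _).
by rewrite shiftE iter_linD -!scaleNr iter_linZ -iterSr.
Qed.

Definition geigen_sums v := exists s : seq (F * V),
  (forall x, x \in s -> geigen f x.1 x.2) /\ v = \sum_(x <- s) x.2.

(** The factor 'X - r acts invertibly on the generalized eigenspaces for c != r. *)
Lemma shift_onto r c z : c != r -> geigen f c z ->
  exists2 y, geigen f c y & shift f r y = z.
Proof.
move=> cr [k]; elim: k z => [|k IHk] z e.
  by exists 0; [exact: geigen0|rewrite linear0].
have [|y gy yE] := IHk (shift f c z); first by rewrite -iterSr.
exists ((c - r)^-1 *: (z - y)).
  by apply: geigenZ; apply: geigenB => //; exists k.+1.
rewrite linearZ linearB /= yE !shiftE opprB [X in _ *: X]addrC addrA subrK.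
by rewrite -scalerBl scalerA mulVf ?scale1r // subr_eq0.
Qed.

(** The annihilating polynomial is split into linear factors, one at a time. *)
Lemma act_geigen_sums (p : {poly F}) v : p != 0 -> act p v = 0 -> geigen_sums v.
Proof.
have [n] := ubnP (size p); elim: n p v => // n IHn p v.
rewrite ltnS => sp p0 av; have [/eqP sp1|sp1] := eqVneq (size p) 1%N.
  have /size_poly1P[c c0 pc] := sp1.
  exists [::]; split=> //; rewrite big_nil.
  move: av; rewrite pc /act size_polyC c0 big_ord1 coefC /= => /eqP.
  by rewrite scaler_eq0 (negbTE c0) => /eqP.
have [r /factor_theorem[q pq]] := closed_rootP p sp1.
have q0 : q != 0 by apply: contraNneq p0 => q0; rewrite pq q0 mul0r.
have : geigen_sums (shift f r v).
  apply: (IHn q) => //; last by rewrite -act_mulXsubC -pq.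
  by apply: leq_trans sp; rewrite pq size_Mmonic ?monicXsubC // size_XsubC addn2.
case=> s [gs sE].
suff [y [gy yr]] : exists y, geigen_sums y /\ geigen f r (v - y).
  case: gy => t [gt tE]; exists ((r, v - y) :: t); split=> [x|].
    by rewrite inE => /orP[/eqP ->|/gt].
  by rewrite big_cons /= -tE subrK.
suff [y [gy yr]] : exists y, geigen_sums y /\ geigen f r (shift f r v - shift f r y).
  exists y; split=> //; case: yr => k; rewrite -linearB -iterSr => e.
  by exists k.+1.
rewrite sE; elim: s gs {sE} => [|[c z] s IHs] gs.
  exists 0; rewrite big_nil linear0 subr0; split; last exact: geigen0.
  by exists [::]; rewrite big_nil.
have [|y [gy yr]] := IHs; first by move=> x xs; apply: gs; rewrite inE xs orbT.
have gz : geigen f c z by apply: (gs (c, z)); rewrite inE eqxx.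
rewrite big_cons /=; have [ecr|cr] := eqVneq c r.
  by exists y; split=> //; rewrite -addrA; apply: geigenD => //; rewrite -ecr.
have [y' gy' yE'] := shift_onto cr gz; exists (y' + y); split; last first.
  by rewrite linearD /= yE' opprD addrACA subrr add0r.
case: gy => t [gt tE]; exists ((c, y') :: t); split=> [x|].
  by rewrite inE => /orP[/eqP ->|/gt].
by rewrite big_cons -tE.
Qed.

(** The n + 1 first iterates of f at v are linearly dependent. *)
Lemma exists_annihilator v : exists2 p : {poly F}, p != 0 & act p v = 0.
Proof.
pose X : seq V := [seq iter i f v | i <- iota 0 (\dim {:V}).+1].
have szX : size X == (\dim {:V}).+1 by rewrite size_map size_iota.
have : ~~ free (Tuple szX).
  apply/negP => /eqP fX; have := dimvS (subvf <<Tuple szX>>).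
  by rewrite fX (eqP szX) ltnn.
move=> /freeP H; have [k [k0 [i ki]]] : exists k : 'I_(\dim {:V}).+1 -> F,
    \sum_(i < (\dim {:V}).+1) k i *: (Tuple szX)`_i = 0 /\ exists i, k i != 0.
  apply: contrapT => N; apply: H => k k0 i; apply/eqP/negPn/negP => ki.
  by apply: N; exists k; split=> //; exists i.
pose p := \poly_(i < (\dim {:V}).+1) k (inord i).
have pE (j : 'I_(\dim {:V}).+1) : p`_j = k j by rewrite coef_poly ltn_ord inord_val.
exists p; first by apply: contraNneq ki => p0; rewrite -pE p0 coef0.
rewrite (actE _ (size_poly _ _)) -[RHS]k0; apply: eq_bigr => j _.
by rewrite pE /= (nth_map 0%N) ?size_iota // nth_iota.
Qed.

Lemma geigen_span (U : {vspace V}) :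
  (forall a v, geigen f a v -> v \in U) -> U = fullv.
Proof.
move=> gU; apply/vspaceP => v; rewrite memvf.
have [p p0 /(act_geigen_sums p0)[s [gs ->]]] := exists_annihilator v.
by rewrite big_seq; apply: memv_suml => x /gs /gU.
Qed.

Lemma geigen_basis : exists (b : (\dim {:V}).-tuple V) (a : 'I_(\dim {:V}) -> F),
  basis_of fullv b /\ forall i : 'I_(\dim {:V}), geigen f (a i) b`_i.
Proof.
have [|b bb gb] := @exists_basis_in _ V (fun v => exists a, geigen f a v).
  by move=> U gU; apply: geigen_span => a v gv; apply: gU; exists a.
by have /choice[a aP] := gb; exists b, a.
Qed.
End GenBasis.

Section Trace.
Variables (F : fieldType) (V : vectType F).
Local Notation n := (\dim {:V}).
Local Notation e := (vbasis {:V}).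
Implicit Types f g : 'End(V).

(** The trace of an endomorphism, which [ltr_basis] shows to be independent of
    the basis. *)
Definition ltr f : F := \tr (mxof e e f).

Lemma ltr_is_linear : linear (ltr : 'End(V) -> F^o).
Proof. by move=> c f g; rewrite /ltr !linearP. Qed.
HB.instance Definition _ := GRing.isLinear.Build F 'End(V) F^o *:%R ltr ltr_is_linear.

Lemma ltrC f g : ltr (f \o g)%VF = ltr (g \o f)%VF.
Proof. by rewrite /ltr !(mxof_comp _ _ (vbasisP _)) // mxtrace_mulC. Qed.

Lemma ltr_basis (b : n.-tuple V) f : basis_of fullv b ->
  ltr f = \sum_(i < n) coord b i (f b`_i).
Proof.
move=> bb; have eb := vbasisP {:V}.
have -> : ltr f = \tr (mxof b b f).
  rewrite /ltr -[f in LHS]comp_lfun1l -[f in LHS]comp_lfun1r.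
  rewrite (mxof_comp e e bb) (mxof_comp e b bb) mxtrace_mulC mulmxA.
  rewrite -(mxof_comp b b eb) comp_lfun1l mxof1 ?mul1mx //.
  exact: basis_free bb.
by apply: eq_bigr => i _; rewrite !mxE /= vecof_delta.
Qed.
End Trace.

(** The only eigenvalue is 0, so the characteristic polynomial is a power
    of 'X. *)
Lemma nilpotent_ltr (F : closedFieldType) (V : vectType F) (f : 'End(V)) :
  loc_nilpotent f -> ltr f = 0.
Proof.
move=> nf; rewrite /ltr; set A := mxof _ _ _.
have [d0|d0] := posnP (\dim {:V}).
  by move: A; rewrite d0 => A; rewrite /mxtrace big_ord0.
have [rs rsE] := closed_field_poly_normal (char_poly A).
have rs0 r : r \in rs -> r = 0.
  move=> rrs; have : root (char_poly A) r.
    rewrite rsE (monicP (char_poly_monic A)) scale1r root_prod_XsubC //.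
  rewrite -eigenvalue_root_char => /eigenvalueP[u uA u0].
  pose v := vecof (vbasis {:V}) u.
  have fv : f v = r *: v.
    by rewrite /v (hom_vecof _ (vbasisP _)) uA linearZ.
  have v0 : v != 0 by rewrite /v vecof_eq0 // vbasisP.
  have [k] := nf v; have -> : iter k f v = r ^+ k *: v.
    elim: k => [|k IHk]; first by rewrite scale1r.
    by rewrite iterS IHk linearZ /= fv scalerA exprSr.
  by move/eqP; rewrite scaler_eq0 (negbTE v0) orbF expf_eq0 => /andP[_ /eqP].
have cE : char_poly A = 'X^(size rs).
  rewrite rsE (monicP (char_poly_monic A)) scale1r.
  rewrite (eq_big_seq (fun _ => 'X)); last by move=> r /rs0 ->; rewrite subr0.
  by rewrite big_const_seq count_predT iter_mulr mulr1.
have := char_poly_trace A d0; have := size_char_poly A.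
rewrite cE size_polyXn => [[->]]; rewrite coefXn.
by rewrite (ltn_eqF (_ : _.-1 < _)%N) ?prednK // => /esym/eqP; rewrite oppr_eq0 => /eqP.
Qed.

(** * Scaling operators and derivations *)

Section Scaling.
Variables (F : closedFieldType) (V : vectType F) (f : 'End(V)).

(** S is defined on a basis of generalized eigenvectors; it is right on all of
    them because generalized eigenspaces for distinct eigenvalues are
    independent. *)
Lemma geigen_scaling (phi : F -> F) : exists S : 'End(V),
  forall a v, geigen f a v -> S v = phi a *: v.
Proof.
have [b [a [bb gb]]] := geigen_basis f.
pose Sf v := \sum_i coord b i v *: (phi (a i) *: b`_i).
have Slin : linear Sf.
  move=> c u v; rewrite /Sf scaler_sumr -big_split; apply: eq_bigr => i _ /=.
  by rewrite linearP /= scalerDl scalerA.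
pose Sl : {linear V -> V} := HB.pack Sf (GRing.isLinear.Build F V V *:%R Sf Slin).
exists (linfun Sl) => c v gv; rewrite lfunE /= /Sf.
have vE : v = \sum_i coord b i v *: b`_i by rewrite -(coord_basis bb) ?memvf.
rewrite [in RHS]vE scaler_sumr; apply/eqP; rewrite -subr_eq0 -sumrB.
pose cs := undup (c :: [seq a i | i <- enum 'I_(\dim {:V})]).
pose z c' := (\sum_(i | a i == c') coord b i v *: b`_i) - (if c' == c then v else 0).
have mem_cs i : a i \in cs.
  by rewrite mem_undup inE (map_f a) ?orbT // mem_enum.
have c_cs : c \in cs by rewrite mem_undup mem_head.
have split_sum (w : 'I_(\dim {:V}) -> V) :
    \sum_i w i = \sum_(c' <- cs) \sum_(i | a i == c') w i.
  rewrite (exchange_big_dep xpredT) //=; apply: eq_bigr => i _.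
  rewrite big_mkcond (bigD1_seq (a i)) ?undup_uniq //= eqxx big1 ?addr0 // => c' c'i.
  by rewrite ifN // eq_sym.
have z0 c' : c' \in cs -> z c' = 0.
  move=> c'cs; apply/eqP; rewrite -memv0.
  apply: (geigen_components (f := f) (W := 0%VS) (z := z) _ (undup_uniq _) _ _ c'cs).
  - by move=> u; rewrite !memv0 => /eqP ->; rewrite linear0.
  - move=> d; apply: geigenB.
      by apply: geigen_sum => i /eqP <-; apply: geigenZ.
    by case: eqP => [->|_] //; exact: geigen0.
  - rewrite /z sumrB -split_sum -vE (bigD1_seq c) ?undup_uniq //= eqxx.
    by rewrite big1 ?addr0 ?subrr ?mem0v // => d /negbTE ->.
rewrite split_sum big1_seq // => c' /andP[_ c'cs].
have [c'c|c'c] := eqVneq c' c.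
  by rewrite big1 // => i /eqP ->; rewrite c'c scalerA scalerA mulrC subrr.
have := z0 _ c'cs; rewrite /z (negbTE c'c) subr0 => zc'.
transitivity ((phi c' - phi c) *: \sum_(i | a i == c') coord b i v *: b`_i).
  rewrite scaler_sumr; apply: eq_bigr => i /eqP ->.
  by rewrite scalerBl !scalerA [coord b i v * _]mulrC.
by rewrite zc' scaler0.
Qed.

Lemma ext_on_basis (b : (\dim {:V}).-tuple V) (h k : 'End(V)) :
  basis_of fullv b -> (forall i : 'I_(\dim {:V}), h b`_i = k b`_i) -> h = k.
Proof.
move=> bb e; apply/lfunP => v; rewrite (coord_basis bb (memvf v)) !linear_sum.
by apply: eq_bigr => i _; rewrite !linearZ /= e.
Qed.

Lemma loc_nilpotent_on_basis (b : (\dim {:V}).-tuple V) (h : 'End(V)) :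
    basis_of fullv b ->
    (forall i : 'I_(\dim {:V}), exists k, iter k h b`_i = 0) -> loc_nilpotent h.
Proof.
move=> bb e v; rewrite (coord_basis bb (memvf v)); apply: nilvec_sum => i _.
by have [k ek] := e i; exists k; rewrite iter_linZ ek scaler0.
Qed.

(** The semisimple part T of f may replace it, since (f - T) o S is
    nilpotent. *)
Lemma ltr_scaling (b : (\dim {:V}).-tuple V) (a : 'I_(\dim {:V}) -> F)
    (phi : F -> F) (S : 'End(V)) :
    basis_of fullv b -> (forall i : 'I_(\dim {:V}), geigen f (a i) b`_i) ->
    (forall a v, geigen f a v -> S v = phi a *: v) ->
  ltr (f \o S)%VF = \sum_i a i * phi (a i).
Proof.
move=> bb gb SP; have [T TP] := geigen_scaling id.
have -> : (f \o S)%VF = (T \o S)%VF + ((f - T) \o S)%VF.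
  by apply/lfunP => v; rewrite add_lfunE !comp_lfunE add_lfunE opp_lfunE addrCA subrr addr0.
rewrite linearD /= [X in _ + X]nilpotent_ltr ?addr0; last first.
  apply: (loc_nilpotent_on_basis bb) => i; have [k] := gb i => e.
  exists k; suff H j v : geigen f (a i) v ->
      iter j ((f - T) \o S)%VF v = phi (a i) ^+ j *: iter j (shift f (a i)) v.
    by rewrite H // e scaler0.
  move=> gv; elim: j => [|j IHj]; first by rewrite scale1r.
  rewrite !iterS IHj linearZ /= comp_lfunE.
  have gj : geigen f (a i) (iter j (shift f (a i)) v) by exact: geigen_iter.
  rewrite (SP _ _ gj) linearZ /= scalerA -exprSr; congr (_ *: _).
  by rewrite add_lfunE opp_lfunE (TP _ _ gj) shiftE.
rewrite (ltr_basis _ bb); apply: eq_bigr => i _.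
rewrite comp_lfunE (SP _ _ (gb i)) linearZ /= (TP _ _ (gb i)) scalerA linearZ /=.
rewrite coord_free ?(basis_free bb) // eqxx mulr1; exact: mulrC.
Qed.
End Scaling.

Section LieBasics.
Variables (F : fieldType) (g : lieAlgType F).
Implicit Types (x y z : g).

Lemma lieDl x y z : lie (x + y) z = lie x z + lie y z.
Proof. by have := lie_is_linearl z 1 x y; rewrite !scale1r. Qed.

Lemma lieDr x y z : lie x (y + z) = lie x y + lie x z.
Proof. by have := lie_is_linearr x 1 y z; rewrite !scale1r. Qed.

Lemma lie0l y : lie 0 y = 0 :> g.
Proof. by apply: (addrI (lie 0 y)); rewrite -lieDl !addr0. Qed.

Lemma lie0r y : lie y 0 = 0 :> g.
Proof. by apply: (addrI (lie y 0)); rewrite -lieDr !addr0. Qed.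

Lemma lieZl c x y : lie (c *: x) y = c *: lie x y.
Proof. by have := lie_is_linearl y c x 0; rewrite !addr0 lie0l addr0. Qed.

Lemma lieZr c x y : lie x (c *: y) = c *: lie x y.
Proof. by have := lie_is_linearr x c y 0; rewrite !addr0 lie0r addr0. Qed.

Lemma lieNl x y : lie (- x) y = - lie x y.
Proof. by rewrite -scaleN1r lieZl scaleN1r. Qed.

Lemma lieNr x y : lie x (- y) = - lie x y.
Proof. by rewrite -scaleN1r lieZr scaleN1r. Qed.

Lemma lieBl x y z : lie (x - y) z = lie x z - lie y z.
Proof. by rewrite lieDl lieNl. Qed.

Lemma lieBr x y z : lie x (y - z) = lie x y - lie x z.
Proof. by rewrite lieDr lieNr. Qed.

Lemma lieC x y : lie x y = - lie y x.
Proof.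
apply/eqP; rewrite -subr_eq0 opprK; apply/eqP.
by have := liexx (x + y); rewrite lieDl !lieDr !liexx add0r addr0.
Qed.

Lemma lie_suml (I : Type) (r : seq I) (P : pred I) (v : I -> g) y :
  lie (\sum_(i <- r | P i) v i) y = \sum_(i <- r | P i) lie (v i) y.
Proof. exact: (big_morph (lie^~ y) (fun u v => lieDl u v y) (lie0l y)). Qed.

Lemma lie_sumr (I : Type) (r : seq I) (P : pred I) (v : I -> g) y :
  lie y (\sum_(i <- r | P i) v i) = \sum_(i <- r | P i) lie y (v i).
Proof. exact: (big_morph (lie y) (lieDr y) (lie0r y)). Qed.

Lemma lieJ x y z : lie x (lie y z) = lie (lie x y) z + lie y (lie x z).
Proof.
have := lie_jacobi x y z; rewrite [lie z x]lieC [lie z _]lieC lieNr.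
by move=> /eqP; rewrite -addrA -opprD subr_eq0 => /eqP ->; rewrite addrC.
Qed.

Definition ad x : 'End(g) := linfun (HB.pack_for {linear g -> g} (lie x)
  (GRing.isLinear.Build F g g *:%R (lie x) (lie_is_linearr x))).

Lemma adE x y : ad x y = lie x y.
Proof. by rewrite /ad lfunE. Qed.

Lemma adD x y : ad (x + y) = ad x + ad y.
Proof. by apply/lfunP => z; rewrite add_lfunE !adE lieDl. Qed.

Lemma adZ c x : ad (c *: x) = c *: ad x.
Proof. by apply/lfunP => z; rewrite scale_lfunE !adE lieZl. Qed.

Lemma ad_lie x y : ad (lie x y) = (ad x \o ad y)%VF - (ad y \o ad x)%VF.
Proof.
by apply/lfunP => z; rewrite add_lfunE opp_lfunE !comp_lfunE !adE (lieJ x) addrK.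
Qed.

Definition derivation (D : 'End(g)) :=
  forall y z, D (lie y z) = lie (D y) z + lie y (D z).

Lemma ad_derivation x : derivation (ad x).
Proof. by move=> y z; rewrite !adE lieJ. Qed.

Lemma derivation_ad D x : derivation D -> ad (D x) = (D \o ad x)%VF - (ad x \o D)%VF.
Proof.
move=> dD; apply/lfunP => z; rewrite add_lfunE opp_lfunE !comp_lfunE !adE dD.
by rewrite addrK.
Qed.

(** The Leibniz formula for powers of D - (a + b). *)
Lemma geigen_lie D a b y z : derivation D ->
  geigen D a y -> geigen D b z -> geigen D (a + b) (lie y z).
Proof.
move=> dD [i ei] [j ej]; have [n] := ubnP (i + j).
elim: n i j y z ei ej => // n IHn [|i] j y z ei ej.
  by move: ei => /= ->; rewrite lie0l => _; exact: geigen0.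
case: j ej => [|j] ej; first by move: ej => /= ->; rewrite lie0r => _; exact: geigen0.
rewrite addSn addnS !ltnS => ijn.
have [k ek] : geigen D (a + b) (shift D (a + b) (lie y z)).
  have -> : shift D (a + b) (lie y z) = lie (shift D a y) z + lie y (shift D b z).
    by rewrite !shiftE dD lieBl lieBr lieZl lieZr scalerDl opprD addrACA.
  apply: geigenD; first by apply: (IHn i j.+1); rewrite -?iterSr ?addnS.
  by apply: (IHn i.+1 j); rewrite -?iterSr ?addSn.
by exists k.+1; rewrite iterSr.
Qed.
End LieBasics.

Section ScalingDerivation.
Variables (F : closedFieldType) (g : lieAlgType F).

(** Additivity of phi matches the addition of eigenvalues in brackets; the
    cases of interest are the identity, which gives semisimple parts, and complex
    conjugation. *)
Lemma scaling_derivation (D S : 'End(g)) (phi : F -> F) :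
    derivation D -> {morph phi : a b / a + b} ->
    (forall a v, geigen D a v -> S v = phi a *: v) ->
  derivation S.
Proof.
move=> dD phiD SP y z; have [b [a [bb gb]]] := geigen_basis D.
rewrite (coord_basis bb (memvf y)) (coord_basis bb (memvf z)).
rewrite !linear_sum /= !lie_suml linear_sum -big_split; apply: eq_bigr => i _ /=.
rewrite !lie_sumr linear_sum -big_split; apply: eq_bigr => j _ /=.
rewrite !linearZ /= !lieZl !lieZr !linearZ /=.
rewrite (SP _ _ (gb i)) (SP _ _ (gb j)) (SP _ _ (geigen_lie dD (gb i) (gb j))).
rewrite phiD lieZl lieZr scalerDl !scalerDr.
by congr (_ + _); rewrite !scalerA [coord b j z * _]mulrC.
Qed.
End ScalingDerivation.

(** * Simultaneous diagonalization, the theorem of Engel, the Killing form *)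

Section PropVspace.
Variables (F : fieldType) (V : vectType F).

(** In finite dimension every linear condition defines a subspace: a subspace
    contained in P is enlarged as long as possible. *)
Lemma prop_vspace (P : V -> Prop) :
    P 0 -> (forall c u v, P u -> P v -> P (c *: u + v)) ->
  exists U : {vspace V}, forall v, v \in U <-> P v.
Proof.
move=> P0 Plin.
have grow n (U : {vspace V}) : (forall v, v \in U -> P v) ->
    (\dim {:V} - \dim U <= n)%N -> exists U : {vspace V}, forall v, v \in U <-> P v.
  elim: n U => [|n IHn] U UP dU.
    exists U => v; split=> [/UP //|_].
    have -> : U = fullv by apply/eqP; rewrite eqEdim subvf -subn_eq0 -leqn0.
    exact: memvf.
  have [H|/existsNP[v /not_implyP[Pv vU]]] := pselect (forall v, P v -> v \in U).
    by exists U => v; split=> [/UP|/H].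
  apply: (IHn (U + <[v]>)%VS).
    move=> _ /memv_addP[u uU [_ /vlineP[c ->] ->]].
    by rewrite addrC; apply: Plin => //; exact: UP.
  have vn : v \notin U by apply/negP.
  have v0 : v != 0 by apply: contraNneq vn => ->; exact: mem0v.
  rewrite dimv_disjoint_sum ?dim_vline ?v0; first by move: dU; lia.
  apply/eqP; rewrite -subv0; apply/subvP => w; rewrite memv_cap => /andP[wU /vlineP[c wc]].
  rewrite memv0; apply: contraNT vn => w0; have c0 : c != 0.
    by apply: contraNneq w0 => c0; rewrite wc c0 scale0r.
  by rewrite -[v](scalerK c0) -wc memvZ.
by apply: (grow (\dim {:V}) 0%VS); rewrite ?dimv0 ?subn0 // => v; rewrite memv0 => /eqP ->.
Qed.
End PropVspace.

Section Diagonalizable.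
Variables (F : fieldType) (V : vectType F).
Implicit Types (f : 'End(V)) (W : {vspace V}).

Definition diagonal_on f (b : seq V) := forall y, y \in b -> exists c, f y = c *: y.

(** Diagonalizability passes to stable subspaces, in a form that needs no
    restriction of f. *)
Lemma diagonal_sum_in f b W y : basis_of fullv b -> diagonal_on f b ->
    (forall v, v \in W -> f v \in W) -> y \in W ->
  exists2 s : seq (F * V),
    forall p, p \in s -> f p.2 = p.1 *: p.2 /\ p.2 \in W & y = \sum_(p <- s) p.2.
Proof.
move=> bb fb Wf yW.
have /choice[a aP] (i : 'I_(size b)) : exists c, f b`_i = c *: b`_i.
  by apply: fb; apply: mem_nth.
have yE : y = \sum_(i < size b) coord (in_tuple b) i y *: b`_i.
  by rewrite -(coord_basis (X := in_tuple b) bb) ?memvf.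
pose cs := undup [seq a i | i <- enum 'I_(size b)].
pose z c := \sum_(i | a i == c) coord (in_tuple b) i y *: b`_i.
have fz c : f (z c) = c *: z c.
  rewrite /z linear_sum scaler_sumr; apply: eq_bigr => i /eqP <-.
  by rewrite linearZ /= aP !scalerA mulrC.
have yz : y = \sum_(c <- cs) z c.
  rewrite {1}yE (exchange_big_dep xpredT) //=; apply: eq_bigr => i _.
  have ics : a i \in cs by rewrite mem_undup map_f ?mem_enum.
  rewrite big_mkcond (bigD1_seq (a i)) ?undup_uniq //= eqxx big1 ?addr0 // => c' c'i.
  by rewrite ifN // eq_sym.
exists [seq (c, z c) | c <- cs]; last by rewrite big_map.
move=> _ /mapP[c ccs ->] /=; split; first exact: fz.
apply: (geigen_components (f := f) Wf (undup_uniq _) _ _ ccs).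
  by move=> d; apply: geigen_eigen.
by rewrite -yz.
Qed.

Definition diagonalizable_op f := exists2 b, basis_of fullv b & diagonal_on f b.

(** Each operator preserves the eigenspaces of the ones before it. *)
Lemma common_eigenbasis (fs : seq 'End(V)) :
    (forall f h, f \in fs -> h \in fs -> forall v, f (h v) = h (f v)) ->
    (forall f, f \in fs -> diagonalizable_op f) ->
  exists2 b : (\dim {:V}).-tuple V, basis_of fullv b &
    forall f, f \in fs -> diagonal_on f b.
Proof.
move=> fsC fsD.
have [|b bb bP] := @exists_basis_in _ V (fun v => forall f, f \in fs -> exists c, f v = c *: v).
  move=> U HU; apply/vspaceP => v; rewrite memvf.
  suff H (W : {vspace V}) y : (forall f, f \in fs -> forall v, v \in W -> f v \in W) ->
      y \in W -> exists2 s : seq V,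
        forall u, u \in s -> u \in W /\ forall f, f \in fs -> exists c, f u = c *: u
        & y = \sum_(u <- s) u.
    have [//|s sP ->] := H fullv v _ (memvf v); first by move=> *; exact: memvf.
    by rewrite big_seq; apply: memv_suml => u /sP[_] /HU.
  elim: fs fsC fsD W y {U HU v} => [|f fs IH] fsC fsD W y Wfs yW.
    by exists [:: y]; rewrite ?big_seq1 // => u; rewrite inE => /eqP ->.
  have [b bb fb] := fsD f (mem_head _ _).
  have [s sP ->] := diagonal_sum_in bb fb (Wfs f (mem_head _ _)) yW.
  elim: s sP => [|[c z] s IHs] sP; first by exists [::]; rewrite ?big_nil.
  have [|s1 s1P s1E] := IHs; first by move=> p ps; apply: sP; rewrite inE ps orbT.
  have [/= fz zW] := sP (c, z) (mem_head _ _).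
  have inf f' : f' \in fs -> f' \in f :: fs by move=> h; rewrite inE h orbT.
  pose E := (W :&: lker (f - c *: \1%VF))%VS.
  have memE u : (u \in E) = (u \in W) && (f u == c *: u).
    rewrite memv_cap memv_ker add_lfunE opp_lfunE scale_lfunE id_lfunE.
    by rewrite subr_eq0.
  have [] := IH _ _ E z.
  - by move=> f1 f2 /inf h1 /inf h2; apply: fsC.
  - by move=> f1 /inf; apply: fsD.
  - move=> f1 h1 u; rewrite !memE => /andP[uW /eqP fu].
    by rewrite Wfs ?inf //= (fsC f f1) ?mem_head ?inf // fu linearZ.
  - by rewrite memE zW fz eqxx.
  move=> s2 s2P zE; exists (s2 ++ s1); last by rewrite big_cat big_cons /= zE s1E.
  move=> u; rewrite mem_cat => /orP[/s2P|/s1P //]; rewrite memE => -[/andP[uW /eqP fu] us].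
  split=> // f'; rewrite inE => /orP[/eqP ->|/us //]; by exists c.
exists b => // f ffs y; case/(nthP 0) => i; rewrite size_tuple => ib <-.
exact: (bP (Ordinal ib) f ffs).
Qed.
End Diagonalizable.

Section Engel.
Variables (F : fieldType) (g : lieAlgType F).
Implicit Types (K L W U : {vspace g}) (x y z : g).

Definition nil_on x W := forall v, v \in W -> exists k, iter k (ad x) v = 0.

Definition normalizes K W := forall x v, x \in K -> v \in W -> lie x v \in W.

(** The conclusion of the theorem of Engel for K acting on W / U, a nonzero
    vector killed by K, stated without quotients. *)
Definition engel_property K := forall W U,
  (forall x, x \in K -> nil_on x W) -> normalizes K W -> normalizes K U ->
  ~~ (W <= U)%VS -> exists w, [/\ w \in W, w \notin U & forall x, x \in K -> lie x w \in U].

(** Induction on the dimension of a subalgebra K of L: the property of K for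
    the pair (L, K) provides an element z that normalizes K, and K + <[z]> again
    has the property. *)
Lemma engel L : lie_subalgebra L -> (forall x, x \in L -> nil_on x L) ->
  engel_property L.
Proof.
move=> Lsub Lnil.
have grow k : (k <= \dim L)%N -> exists K,
    [/\ (K <= L)%VS, \dim K = k, lie_subalgebra K & engel_property K].
  elim: k => [_|k IHk kL].
    exists 0%VS; split; rewrite ?sub0v ?dimv0 //.
      by move=> x y; rewrite !memv0 => /eqP -> _; rewrite lie0l.
    move=> W U _ _ _ /subvPn[w wW wU]; exists w; split=> // x; rewrite memv0 => /eqP ->.
    by rewrite lie0l mem0v.
  have [K [KL dK Ksub KE]] := IHk (ltnW kL).
  have LKn : ~~ (L <= K)%VS.
    by apply: contraL kL => /dimvS; rewrite dK -leqNgt.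
  have [||||z [zL zK Kz]] := KE L K.
  - by move=> x xK; apply: Lnil; apply: (subvP KL).
  - by move=> x v xK vL; apply: Lsub => //; apply: (subvP KL).
  - by move=> x v; apply: Ksub.
  - by [].
  (* z is an element of L outside K that brackets K into K. *)
  exists (K + <[z]>)%VS; split.
  - rewrite subv_add KL /=; apply/subvP => _ /vlineP[c ->]; exact: memvZ.
  - have z0 : z != 0 by apply: contraNneq zK => ->; exact: mem0v.
    rewrite dimv_disjoint_sum ?dim_vline ?z0 ?dK ?addn1 //.
    apply/eqP; rewrite -subv0; apply/subvP => w; rewrite memv_cap => /andP[wK /vlineP[c wc]].
    rewrite memv0; apply: contraNT zK => w0; have c0 : c != 0.
      by apply: contraNneq w0 => c0; rewrite wc c0 scale0r.
    by rewrite -[z](scalerK c0) -wc memvZ.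
  - move=> _ _ /memv_addP[u uK [_ /vlineP[c ->] ->]] /memv_addP[v vK [_ /vlineP[d ->] ->]].
    apply: (subvP (addvSl _ _)).
    rewrite lieDl !lieDr !lieZl !lieZr liexx !scaler0 addr0.
    by rewrite !memvD ?Ksub ?memvZ ?Kz // lieC memvN Kz.
  - move=> W U nilW KW KU WU.
    have [||||w [wW wU Kw]] := KE W U.
    + by move=> x xK; apply: nilW; apply: (subvP (addvSl _ _)).
    + by move=> x v xK; apply: KW; apply: (subvP (addvSl _ _)).
    + by move=> x v xK; apply: KU; apply: (subvP (addvSl _ _)).
    + by [].
    have zK' : z \in (K + <[z]>)%VS by apply: (subvP (addvSr _ _)); exact: memv_line.
    have invW m : iter m (ad z) w \in W.
      by elim: m => //= m IHm; rewrite adE; apply: KW.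
    have invK m x : x \in K -> lie x (iter m (ad z) w) \in U.
      elim: m x => [|m IHm] x xK; first exact: Kw.
      rewrite /= adE lieJ memvD ?IHm ?Kz //; apply: KU => //; exact: IHm.
    have exm : exists m, iter m (ad z) w \in U.
      have [m e] := nilW z zK' w wW; by exists m; rewrite e mem0v.
    (* The last iterate of w under ad z that is not in U is moved into U by z. *)
    case: (ex_minnP exm) => [[|m]] mU mmin; first by rewrite mU in wU.
    exists (iter m (ad z) w); split=> //.
      by apply/negP => /mmin; rewrite ltnn.
    move=> _ /memv_addP[u uK [_ /vlineP[c ->] ->]].
    rewrite lieDl lieZl; apply: memvD; first exact: invK.
    by apply: memvZ; rewrite -adE; exact: mU.
have [K [KL dK _ KE]] := grow _ (leqnn _).
by have -> : L = K by apply/eqP; rewrite eq_sym eqEdim KL dK leqnn.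
Qed.
End Engel.

Section Killing.
Variables (F : closedFieldType) (g : lieAlgType F).
Implicit Types (x y z : g).

Definition killing x y : F := ltr (ad x \o ad y)%VF.
Local Notation kappa := killing.

Lemma killingC x y : kappa x y = kappa y x.
Proof. exact: ltrC. Qed.

Lemma killingDl x y z : kappa (x + y) z = kappa x z + kappa y z.
Proof. by rewrite /killing adD comp_lfunDl linearD. Qed.

Lemma killingZl c x z : kappa (c *: x) z = c * kappa x z.
Proof. by rewrite /killing adZ -comp_lfunZl linearZ. Qed.

Lemma killingDr x y z : kappa x (y + z) = kappa x y + kappa x z.
Proof. by rewrite ![kappa x _]killingC killingDl. Qed.

Lemma killingZr c x z : kappa x (c *: z) = c * kappa x z.
Proof. by rewrite ![kappa x _]killingC killingZl. Qed.

Lemma killing0l x : kappa 0 x = 0.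
Proof. by rewrite -[X in kappa X](scale0r 0) killingZl mul0r. Qed.

Lemma killingNl x y : kappa (- x) y = - kappa x y.
Proof. by rewrite -scaleN1r killingZl mulN1r. Qed.

Lemma killingNr x y : kappa x (- y) = - kappa x y.
Proof. by rewrite -scaleN1r killingZr mulN1r. Qed.

Lemma ltr_ad_lie (D : 'End(g)) x y :
  ltr (D \o ad (lie x y))%VF = ltr (((D \o ad x) - (ad x \o D)) \o ad y)%VF.
Proof.
rewrite ad_lie comp_lfunDr comp_lfunDl comp_lfunNr comp_lfunNl !linearD !linearN /=.
by rewrite !comp_lfunA [X in _ - X]ltrC !comp_lfunA.
Qed.

Lemma killing_lie x y z : kappa (lie x y) z = kappa x (lie y z).
Proof.
rewrite /killing ltr_ad_lie ad_lie !comp_lfunDl !comp_lfunNl !linearD !linearN /=.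
by congr (_ - _); rewrite !comp_lfunA.
Qed.
End Killing.

(** * Cartan subalgebras are their own centralizers *)

(** On the generalized eigenspace for a, f - S is shift a. *)
Lemma nilpotent_part (F : closedFieldType) (V : vectType F) (f S : 'End(V)) :
  (forall a v, geigen f a v -> S v = a *: v) -> loc_nilpotent (f - S).
Proof.
move=> SP; have [b [a [bb gb]]] := geigen_basis f.
apply: (loc_nilpotent_on_basis bb) => i; have [k e] := gb i; exists k.
suff H j v : geigen f (a i) v -> iter j (f - S) v = iter j (shift f (a i)) v.
  by rewrite H.
move=> gv; elim: j => //= j ->; rewrite add_lfunE opp_lfunE shiftE.
by congr (_ - _); apply: SP; exact: geigen_iter.
Qed.

Lemma comm_loc_nilpotent (F : fieldType) (V : vectType F) (f h : 'End(V)) :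
  (forall v, f (h v) = h (f v)) -> loc_nilpotent f -> loc_nilpotent (f \o h)%VF.
Proof.
move=> fh nf v; have [k e] := nf v; exists k.
have -> : iter k (f \o h)%VF v = iter k h (iter k f v).
  elim: k {e} v => //= k IHk v; rewrite IHk comp_lfunE -iterS iterSr.
  rewrite -[RHS]/(h (iter k h (f (iter k f v)))) -iterSr -iterS.
  by rewrite fh (iter_comm (f := h) (g := f)) ?iterS // -iterS iterSr.
by rewrite e iter_lin0.
Qed.

Section Simple.
Variables (F : numClosedFieldType) (g : lieAlgType F).
Hypothesis simple_g : lie_simple g.
Implicit Types (x y z : g).
Local Notation kappa := (@killing F g).

(** This lets ideals be given by predicates. *)
Lemma simple_prop_ideal (P : g -> Prop) :
    P 0 -> (forall c u v, P u -> P v -> P (c *: u + v)) ->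
    (forall x y, P y -> P (lie x y)) ->
  (forall x, P x -> x = 0) \/ (forall x, P x).
Proof.
move=> P0 Plin Pid; have [U UP] := prop_vspace P0 Plin.
have idU : lie_ideal U by move=> x y /UP Py; apply/UP; exact: Pid.
case: (simple_g.2 U idU) => UE; [left|right] => x.
  by move=> /UP; rewrite UE memv0 => /eqP.
by apply/UP; rewrite UE memvf.
Qed.

Lemma simple_center x : (forall y, lie y x = 0) -> x = 0.
Proof.
have [||y z cz|H|H] := @simple_prop_ideal (fun x => forall y, lie y x = 0).
- by move=> y; rewrite lie0r.
- by move=> c u v cu cv y; rewrite lieDr lieZr cu cv scaler0 addr0.
- by move=> u; rewrite cz lie0r.
- exact: H.
by have [u [v]] := simple_g.1; rewrite H eqxx.
Qed.

Lemma simple_not_nilpotent : ~ (forall x, loc_nilpotent (ad x)).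
Proof.
move=> nil; have [x0 [y0 xy0]] := simple_g.1.
have [||||||w [_ w0 wc]] := @engel F g fullv _ _ fullv 0%VS.
- by move=> *; exact: memvf.
- by move=> x _ v _; exact: nil.
- by move=> x _ v _; exact: nil.
- by move=> *; exact: memvf.
- by move=> x v _; rewrite !memv0 => /eqP ->; rewrite lie0r.
- rewrite subv0; apply: contraNneq xy0 => full0.
  by have := memvf (lie x0 y0); rewrite full0 memv0.
case/negP: w0; rewrite memv0; apply/eqP/simple_center => y.
by apply/eqP; rewrite -memv0 wc ?memvf.
Qed.

(** A form of the criterion of Cartan.  The radical is an ideal.  If it were
    everything, the operator that acts by the conjugate eigenvalues of ad x would
    be a derivation whose trace pairing kills brackets; so the sum of the squared
    moduli of the eigenvalues would vanish, all ad x would be nilpotent, and the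
    theorem of Engel would give a center. *)
Lemma killing_nondegenerate x : (forall y, kappa x y = 0) -> x = 0.
Proof.
have [||u v kv|H|H] := @simple_prop_ideal (fun x => forall y, kappa x y = 0).
- by move=> y; rewrite killing0l.
- by move=> c u v ku kv y; rewrite killingDl killingZl ku kv mulr0 addr0.
- by move=> y; rewrite lieC killingNl killing_lie kv oppr0.
- exact: H.
(* The radical of the form is everything: it remains to see that ad x is nilpotent. *)
case: simple_not_nilpotent => {}x.
have [b [a [bb gb]]] := geigen_basis (ad x).
have [S SP] := geigen_scaling (ad x) (fun a => Num.conj a).
have dS : derivation S.
  by apply: (scaling_derivation (ad_derivation x) _ SP) => c d; exact: rmorphD.
have trS0 u v : ltr (S \o ad (lie u v))%VF = 0.
  by rewrite ltr_ad_lie -derivation_ad // -[LHS]/(kappa _ _) H.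
have trS : ltr (S \o ad x)%VF = 0.
  have [||u v _|Q|Q] := @simple_prop_ideal (fun x => ltr (S \o ad x)%VF = 0).
  - by rewrite -(lie0l (0 : g)) trS0.
  - move=> c u v eu ev; rewrite adD adZ comp_lfunDr -comp_lfunZr.
    by rewrite linearD linearZ /= eu ev scaler0 addr0.
  - exact: trS0.
  - by have [u [v]] := simple_g.1; rewrite (Q _ (trS0 u v)) eqxx.
  exact: Q.
move: trS; rewrite ltrC (ltr_scaling bb gb SP) => /eqP.
rewrite psumr_eq0 => [/allP a0|i _]; last exact: mul_conjC_ge0.
apply: (loc_nilpotent_on_basis bb) => i.
have ai : a i = 0.
  by have /eqP := a0 i (mem_index_enum i); move=> /eqP; rewrite mul_conjC_eq0 => /eqP.
have [k e] := gb i; exists k; rewrite -[RHS]e ai; apply: eq_iter => v.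
by rewrite shiftE scale0r subr0.
Qed.

Lemma killing_represents (L : {linear g -> F^o}) : exists y, forall x, kappa y x = L x.
Proof.
pose kl y : 'Hom(g, F^o) := linfun (HB.pack_for {linear g -> F^o} (kappa y)
  (GRing.isLinear.Build F g F^o *:%R (kappa y) (fun c u v =>
     etrans (killingDr y (c *: u) v) (congr1 (+%R^~ _) (killingZr c y u))))).
have klE y x : kl y x = kappa y x by rewrite lfunE.
have kllin : linear kl.
  move=> c u v; apply/lfunP => x.
  by rewrite add_lfunE scale_lfunE !klE killingDl killingZl.
pose km : 'Hom(g, 'Hom(g, F^o)) := linfun (HB.pack_for {linear g -> 'Hom(g, F^o)} kl
  (GRing.isLinear.Build F g _ *:%R kl kllin)).
have kmE y x : km y x = kappa y x by rewrite [km y]lfunE klE.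
have km0 : lker km == 0%VS.
  rewrite -subv0; apply/subvP => y; rewrite memv_ker memv0 => /eqP e.
  by apply/eqP/killing_nondegenerate => x; rewrite -kmE e zero_lfunE.
have kmf : limg km = fullv.
  apply/eqP; rewrite eqEdim subvf limg_dim_eq ?(eqP km0) ?capv0 //.
  by rewrite !dimvf /= /dim /= muln1.
have /memv_imgP[y _ yE] : linfun L \in limg km by rewrite kmf memvf.
by exists y => x; rewrite -kmE -yE lfunE.
Qed.

(** Represent x |-> tr (D o ad x) by the Killing form: the difference of D and
    the inner derivation is a derivation that is orthogonal to all ad u, and
    is zero by nondegeneracy. *)
Lemma derivation_inner (D : 'End(g)) : derivation D -> exists y, forall x, D x = lie y x.
Proof.
move=> dD.
pose L (x : g) : F^o := ltr (D \o ad x)%VF.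
have Llin : linear L.
  move=> c u v; rewrite /L adD adZ comp_lfunDr -comp_lfunZr linearD linearZ //.
have [y yE] := killing_represents (HB.pack_for {linear g -> F^o} L
  (GRing.isLinear.Build F g F^o *:%R L Llin)).
rewrite /= /L in yE; exists y => x; apply/eqP; rewrite -subr_eq0; apply/eqP.
apply: killing_nondegenerate => z.
have E u : ltr ((D - ad y) \o ad u)%VF = 0.
  by rewrite comp_lfunDl comp_lfunNl linearD linearN /= -yE subrr.
have dE : derivation (D - ad y).
  move=> u v; rewrite !add_lfunE !opp_lfunE dD !adE lieJ lieDl lieDr lieNl lieNr.
  by rewrite opprD addrACA.
have -> : D x - lie y x = (D - ad y) x by rewrite add_lfunE opp_lfunE adE.
by rewrite /killing derivation_ad // -ltr_ad_lie E.
Qed.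

Section CartanCentralizer.
Variable h : {vspace g}.
Hypothesis hP : cartan_subalgebra h.

Lemma ad_diagonalizable_op x : ad_diagonalizable x <-> diagonalizable_op (ad x).
Proof.
split=> -[b bb bP]; exists b => // y yb.
  by have [c e] := bP y yb; exists c; rewrite adE.
by have [c e] := bP y yb; exists c; rewrite -adE.
Qed.

(** A diagonalizable operator with square 0 at y is 0 at y. *)
Lemma diagonalizable_nil x y : ad_diagonalizable x -> lie x (lie x y) = 0 -> lie x y = 0.
Proof.
move=> /ad_diagonalizable_op[b bb xb] e.
have [s sP yE] := diagonal_sum_in bb xb (W := fullv) (fun v _ => memvf _) (memvf y).
pose z c := \sum_(p <- s | p.1 == c) p.2; pose cs := undup [seq p.1 | p <- s].
have zE c : lie x (z c) = c *: z c.
  rewrite /z lie_sumr scaler_sumr big_seq_cond [RHS]big_seq_cond.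
  by apply: eq_bigr => p /andP[/sP[+ _] /eqP <-]; rewrite adE.
have yz : y = \sum_(c <- cs) z c.
  rewrite yE [RHS](exchange_big_dep xpredT) //= [LHS]big_seq [RHS]big_seq.
  apply: eq_bigr => p ps.
  have pcs : p.1 \in cs by rewrite mem_undup map_f.
  rewrite big_mkcond (bigD1_seq p.1) ?undup_uniq //= eqxx big1 ?addr0 // => c' c'i.
  by rewrite ifN // eq_sym.
rewrite yz lie_sumr big1_seq // => c /andP[_ ccs]; rewrite zE.
have : (c * c) *: z c \in (0%VS : {vspace g}).
  apply: (geigen_components (f := ad x) (z := fun c => (c * c) *: z c) _ (undup_uniq _) _ _ ccs).
  - by move=> v; rewrite !memv0 => /eqP ->; rewrite linear0.
  - by move=> d; apply: geigenZ; apply: geigen_eigen; rewrite adE.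
  - rewrite memv0 -[X in _ == X]e yz !lie_sumr; apply/eqP; apply: eq_bigr => d _.
    by rewrite zE lieZr zE scalerA.
by rewrite memv0 scaler_eq0 mulf_eq0 orbb -scaler_eq0 => /eqP.
Qed.

(** If [x, p] = c p with p in h, then ad p annihilates [p, x], and so
    already x ([diagonalizable_nil]). *)
Lemma cartan_abelian x y : x \in h -> y \in h -> lie x y = 0.
Proof.
have [[hsub hdiag] _] := hP; move=> xh yh.
have /ad_diagonalizable_op[b bb xb] := hdiag x xh.
have [|s sP ->] := diagonal_sum_in bb xb (W := h) _ yh.
  by move=> v vh; rewrite adE; exact: hsub.
rewrite lie_sumr big1_seq // => p /andP[_ /sP[]]; rewrite adE => pE ph.
have : lie p.2 x = 0.
  apply: diagonalizable_nil; first exact: hdiag.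
  by rewrite (lieC _ x) pE lieNr lieZr liexx scaler0 oppr0.
by move=> e; rewrite lieC e oppr0.
Qed.

Lemma cartan_eigenbasis : exists2 b : (\dim {:g}).-tuple g, basis_of fullv b &
  forall t, t \in h -> forall i : 'I_(\dim {:g}), exists c, lie t b`_i = c *: b`_i.
Proof.
have [[hsub hdiag] _] := hP.
have [||b bb bP] := @common_eigenbasis _ _ [seq ad t | t <- vbasis h].
- move=> _ _ /mapP[t th ->] /mapP[u uh ->] v; rewrite !adE lieJ.
  by rewrite (cartan_abelian (vbasis_mem th) (vbasis_mem uh)) lie0l add0r.
- by move=> _ /mapP[t th ->]; apply/ad_diagonalizable_op/hdiag/vbasis_mem.
exists b => // t th i; have bi : b`_i \in b by rewrite mem_nth ?size_tuple.
have /choice[c cP] (j : 'I_(\dim h)) : exists c, lie (vbasis h)`_j b`_i = c *: b`_i.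
  have hj : (vbasis h)`_j \in vbasis h by rewrite mem_nth ?size_tuple.
  by have [c e] := bP _ (map_f (@ad F g) hj) _ bi; exists c; rewrite -adE.
exists (\sum_j coord (vbasis h) j t * c j).
rewrite {1}(coord_vbasis th) lie_suml scaler_suml; apply: eq_bigr => j _.
by rewrite lieZl cP scalerA.
Qed.

(** By maximality: h + <[s]> is again toral. *)
Lemma cartan_absorbs s : (forall t, t \in h -> lie t s = 0) -> ad_diagonalizable s ->
  s \in h.
Proof.
move=> hs ds; have [[hsub hdiag] hmax] := hP.
suff T : toral (h + <[s]>)%VS.
  by rewrite -(hmax _ T (addvSl _ _)) (subvP (addvSr _ _)) ?memv_line.
split.
  move=> _ _ /memv_addP[u uh [_ /vlineP[c ->] ->]] /memv_addP[v vh [_ /vlineP[d ->] ->]].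
  rewrite lieDl !lieDr !lieZl !lieZr liexx (hs _ uh) cartan_abelian // [lie s v]lieC hs //.
  by rewrite oppr0 !scaler0 !addr0 mem0v.
move=> _ /memv_addP[u uh [_ /vlineP[c ->] ->]].
have [||b bb bP] := @common_eigenbasis _ _ [:: ad u; ad s].
- have us v : lie u (lie s v) = lie s (lie u v) by rewrite lieJ hs // lie0l add0r.
  move=> f k; rewrite !inE => /orP[]/eqP -> /orP[]/eqP -> v //.
  + by rewrite !adE us.
  + by rewrite !adE us.
- by move=> f; rewrite !inE => /orP[]/eqP ->; apply/ad_diagonalizable_op => //; exact: hdiag.
exists b => // y yb.
have [|d1 e1] := bP (ad u) _ y yb; first by rewrite mem_head.
have [|d2 e2] := bP (ad s) _ y yb; first by rewrite !inE eqxx orbT.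
exists (d1 + c * d2); move: e1 e2; rewrite !adE => e1 e2.
by rewrite lieDl lieZl e1 e2 scalerA scalerDl.
Qed.

Definition centralizes_cartan x := forall t, t \in h -> lie t x = 0.

(** The abstract Jordan decomposition: the semisimple part of ad x is a
    derivation, hence of the form ad s, and s lies in h by [cartan_absorbs]. *)
Lemma centralizer_jordan x : centralizes_cartan x ->
  exists s, [/\ s \in h, centralizes_cartan (x - s) & loc_nilpotent (ad (x - s))].
Proof.
move=> cx; have [S SP] := geigen_scaling (ad x) id.
have dS : derivation S by exact: (scaling_derivation (ad_derivation x) _ SP).
have [s sE] := derivation_inner dS.
have cs t : t \in h -> lie t s = 0.
  move=> th; rewrite lieC -sE (SP 0) ?scale0r ?oppr0 //.
  by apply: geigen_eigen; rewrite adE lieC cx // oppr0 scale0r.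
have sh : s \in h.
  apply: cartan_absorbs => //; have [b [a [bb gb]]] := geigen_basis (ad x).
  exists b => // y; case/(nthP 0) => i; rewrite size_tuple => ib <-; exists (a (Ordinal ib)).
  by rewrite -sE (SP _ _ (gb (Ordinal ib))).
exists s; split=> // [t th|]; first by rewrite lieBr cx // cs // subrr.
have -> : ad (x - s) = ad x - S; last exact: nilpotent_part.
by apply/lfunP => y; rewrite add_lfunE opp_lfunE !adE sE lieBl.
Qed.

(** ad n and ad y commute, so their composite is nilpotent. *)
Lemma killing_nilpotent n y : lie n y = 0 -> loc_nilpotent (ad n) -> kappa n y = 0.
Proof.
move=> ny nn; apply: nilpotent_ltr; apply: comm_loc_nilpotent => // v.
by rewrite !adE lieJ ny lie0l add0r.
Qed.

(** The Killing form pairs the centralizer of h only with itself: on a common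
    eigenvector outside the centralizer, invariance gives 0. *)
Lemma killing_centralizer_nondegenerate c : centralizes_cartan c ->
  (forall y, centralizes_cartan y -> kappa c y = 0) -> c = 0.
Proof.
move=> cc k0; apply: killing_nondegenerate => y.
have [b bb bP] := cartan_eigenbasis.
rewrite (coord_basis bb (memvf y)) (big_morph _ (killingDr c) (_ : _ = 0)); last first.
  by rewrite killingC killing0l.
apply: big1 => i _; rewrite killingZr.
suff -> : kappa c b`_i = 0 by rewrite mulr0.
have [H|/existsNP[t /not_implyP[th tb]]] := pselect (centralizes_cartan b`_i).
  exact: k0.
have [d e] := bP t th i.
have d0 : d != 0 by apply: contra_not_neq tb => d0; rewrite e d0 scale0r.
apply: (mulfI d0); rewrite mulr0 -killingZr -e -killing_lie lieC cc //.
by rewrite oppr0 killing0l.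
Qed.

(** Let W be the part of the centralizer that is orthogonal to h.  The
    centralizer acts on W by nilpotent operators; a nonzero W would by the
    theorem of Engel contain a nonzero vector w that commutes with the centralizer,
    and the Jordan decomposition shows w to be orthogonal to the centralizer.  So
    W = 0; nilpotent parts of elements of the centralizer lie in W. *)
Theorem cartan_self_centralizing x : centralizes_cartan x -> x \in h.
Proof.
have cent0 : centralizes_cartan 0 by move=> t _; rewrite lie0r.
have centlin c u v : centralizes_cartan u -> centralizes_cartan v ->
    centralizes_cartan (c *: u + v).
  by move=> cu cv t th; rewrite lieDr lieZr cu // cv // scaler0 addr0.
have [C CP] := prop_vspace cent0 centlin.
have [W WP] : exists W : {vspace g}, forall v, v \in W <->
    centralizes_cartan v /\ forall t, t \in h -> kappa v t = 0.
  apply: prop_vspace => [|c u v [cu ku] [cv kv]].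
    by split=> // t _; rewrite killing0l.
  split=> [|t th]; first exact: centlin.
  by rewrite killingDl killingZl ku // kv // mulr0 addr0.
have Csub u v : centralizes_cartan u -> centralizes_cartan v -> centralizes_cartan (lie u v).
  by move=> cu cv t th; rewrite lieJ (cu t th) (cv t th) lie0l lie0r addr0.
(* On the centralizer, ad u agrees with the adjoint action of its nilpotent part. *)
have nilC u : u \in C -> nil_on u C.
  move=> /CP cu v /CP cv; have [s [sh cn nn]] := centralizer_jordan cu.
  have [k e] := nn v; exists k; rewrite -[RHS]e {e}.
  have cit j : centralizes_cartan (iter j (ad (u - s)) v).
    by elim: j => //= j IHj; rewrite adE; exact: Csub.
  elim: k => //= k ->; rewrite !adE lieBl (cit k s sh) subr0 //.
have W0 v : v \in W -> v = 0.
  move=> vW; apply: contrapT => /eqP v0.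
  have [|||||w [wW w0 wC]] := @engel F g C _ nilC W 0%VS _ _ _ _.
  - by move=> u u' /CP cu /CP cu'; apply/CP; exact: Csub.
  - move=> u uC w /WP[cw _]; apply: nilC => //; exact/CP.
  - move=> u w /CP cu /WP[cw kw]; apply/WP; split; first exact: Csub.
    by move=> t th; rewrite killing_lie lieC (cw t th) oppr0 killingC killing0l.
  - by move=> u w _; rewrite !memv0 => /eqP ->; rewrite lie0r.
  - by apply/subvPn; exists v; rewrite ?memv0.
  have {}wC u : centralizes_cartan u -> lie u w = 0.
    by move=> /CP /wC; rewrite memv0 => /eqP.
  have /WP[cw kw] := wW; case/negP: w0; rewrite memv0; apply/eqP.
  have [s [sh cn nn]] := centralizer_jordan cw.
  (* The nilpotent part of w is orthogonal to the centralizer, since w, and so w - s,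
     commutes with it; hence w = s lies in h. *)
  have n0 : w - s = 0.
    apply: killing_centralizer_nondegenerate => // y cy; apply: killing_nilpotent => //.
    by rewrite lieBl (cy s sh) subr0 lieC wC // oppr0.
  apply: killing_centralizer_nondegenerate => // y cy.
  have [t [th cn' nn']] := centralizer_jordan cy.
  rewrite -[y](subrK t) killingDr (kw t th) addr0 killingC.
  by apply: killing_nilpotent => //; exact: wC.
move=> cx; have [s [sh cn nn]] := centralizer_jordan cx.
suff n0 : x - s = 0 by rewrite (subr0_eq n0).
apply: W0; apply/WP; split=> // t th.
by apply: killing_nilpotent => //; rewrite lieC cn // oppr0.
Qed.
End CartanCentralizer.
End Simple.

(** * Weights and sl2-triples *)

Section Sl2.
Variables (F : numClosedFieldType) (g : lieAlgType F) (e f t : g).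
Hypotheses (ef : lie e f = t) (te : lie t e = 2 *: e) (tf : lie t f = - 2 *: f).

Lemma sl2_weight la v k : lie t v = la *: v ->
  lie t (iter k (lie f) v) = (la - (2 * k)%:R) *: iter k (lie f) v.
Proof.
move=> tv; elim: k => [|k IHk] /=; first by rewrite tv subr0.
rewrite lieJ tf IHk lieZl lieZr -scalerDl; congr (_ *: _).
by rewrite mulnS natrD; ring.
Qed.

Lemma sl2_raise la v k : lie t v = la *: v -> lie e v = 0 ->
  lie e (iter k.+1 (lie f) v) = (k.+1%:R * (la - k%:R)) *: iter k (lie f) v.
Proof.
move=> tv ev; elim: k => [|k IHk].
  by rewrite /= lieJ ev ef tv lie0r addr0 mul1r subr0.
rewrite iterS lieJ ef (sl2_weight _ tv) IHk lieZr -iterS -scalerDl; congr (_ *: _).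
by rewrite natrM; ring.
Qed.

(** By [sl2_raise], the first vanishing iterate under f forces the eigenvalue. *)
Lemma sl2_primitive la v : v != 0 -> lie t v = la *: v -> lie e v = 0 ->
    (exists k, iter k (lie f) v = 0) ->
  exists n : nat, [/\ la = n%:R, forall j, (j <= n)%N -> iter j (lie f) v != 0
                   & iter n.+1 (lie f) v = 0].
Proof.
move=> v0 tv ev nil.
have exk : exists k, iter k (lie f) v == 0 by have [k /eqP] := nil; exists k.
case: (ex_minnP exk) => [[|k]] /eqP k0 kmin; first by rewrite -[v]/(iter 0 (lie f) v) k0 eqxx in v0.
have nz j : (j <= k)%N -> iter j (lie f) v != 0.
  by move=> jk; apply/negP => /kmin; rewrite ltnNge jk.
exists k; split=> //.
have := sl2_raise k tv ev; rewrite k0 lie0r => /esym/eqP.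
rewrite scaler_eq0 (negbTE (nz k _)) // orbF mulf_eq0 pnatr_eq0 /= subr_eq0.
by move=> /eqP.
Qed.
End Sl2.

Section RootSpaces.
Variables (R : realType) (g : lieAlgType R[i]) (h : {vspace g}).
Local Notation C := R[i].
Implicit Types (al be mu : dual h) (x y z : g).

Lemma rspD al x y : in_root_space al x -> in_root_space al y -> in_root_space al (x + y).
Proof. by move=> rx ry t; rewrite lieDr rx ry scalerDr. Qed.

Lemma rspZ al c x : in_root_space al x -> in_root_space al (c *: x).
Proof. by move=> rx t; rewrite lieZr rx !scalerA mulrC. Qed.

Lemma rspB al x y : in_root_space al x -> in_root_space al y -> in_root_space al (x - y).
Proof. by move=> rx ry; rewrite -scaleN1r; apply: rspD => //; apply: rspZ. Qed.

Lemma rsp_lie al be x y : in_root_space al x -> in_root_space be y ->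
  in_root_space (al + be) (lie x y).
Proof.
move=> rx ry t; rewrite lieJ rx ry lieZl lieZr -scalerDl; congr (_ *: _).
by rewrite add_lfunE.
Qed.

Lemma rsp_iter al be x y k : in_root_space al x -> in_root_space be y ->
  in_root_space (be + al *+ k) (iter k (lie x) y).
Proof.
move=> rx ry; elim: k => [|k IHk] /=; first by rewrite addr0.
by rewrite mulrS addrCA; exact: rsp_lie.
Qed.

Lemma dual_neqP al be : al != be -> exists t, al t != be t.
Proof. by move=> /lfunPn. Qed.

Definition is_weight mu := exists2 x : g, x != 0 & in_root_space mu x.

Hypotheses (simple_g : lie_simple g) (hP : cartan_subalgebra h).
Local Notation kappa := (@killing _ g).
Local Notation n := (\dim {:g}).

Lemma exists_weight_basis : exists (b : n.-tuple g) (w : 'I_n -> dual h),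
  basis_of fullv b /\ forall i : 'I_n, in_root_space (w i) b`_i.
Proof.
have [b bb bP] := cartan_eigenbasis hP.
have /choice[w wP] (i : 'I_n) : exists w : dual h, in_root_space w b`_i.
  pose L (t : subvs_of h) : C^o := coord b i (lie (vsval t) b`_i).
  have Llin : linear L.
    move=> c u v; rewrite /L linearD linearZ /= lieDl lieZl linearD linearZ //.
  exists (linfun (HB.pack_for {linear subvs_of h -> C^o} L
     (GRing.isLinear.Build C (subvs_of h) C^o *:%R L Llin))) => t.
  rewrite lfunE /= /L; have [c e] := bP _ (subvsP t) i.
  by rewrite e linearZ /= coord_free ?(basis_free bb) // eqxx mulr1.
by exists b, w.
Qed.

Lemma rsp0P x : in_root_space (0 : dual h) x <-> x \in h.
Proof.
split=> [rx|xh t]; last by rewrite zero_lfunE scale0r (cartan_abelian hP) ?subvsP.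
apply: (cartan_self_centralizing simple_g hP) => t th.
by rewrite -(vsprojK th) rx zero_lfunE scale0r.
Qed.

Lemma killing_h_nondegenerate t : t \in h -> (forall u, u \in h -> kappa t u = 0) -> t = 0.
Proof.
move=> th k0; apply: (killing_centralizer_nondegenerate simple_g hP) => [u uh|u cu].
  exact: (cartan_abelian hP).
by apply/k0/(cartan_self_centralizing simple_g hP).
Qed.

Lemma killing_rsp_orthogonal al be x y :
  in_root_space al x -> in_root_space be y -> al + be != 0 -> kappa x y = 0.
Proof.
move=> rx ry /dual_neqP[t]; rewrite add_lfunE zero_lfunE => ab0.
apply: (mulfI ab0); rewrite mulr0 mulrDl -killingZl -killingZr -rx -ry.
by rewrite lieC killingNl killing_lie addNr.
Qed.

Section WithBasis.
Variables (b : n.-tuple g) (w : 'I_n -> dual h).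
Hypotheses (bb : basis_of fullv b) (wP : forall i : 'I_n, in_root_space (w i) b`_i).

Lemma basisE x : x = \sum_i coord b i x *: b`_i.
Proof. exact: coord_basis (memvf x). Qed.

Lemma rsp_coord al x i : in_root_space al x -> w i != al -> coord b i x = 0.
Proof.
move=> rx /dual_neqP[t wa]; apply/eqP.
have : coord b i (lie (vsval t) x) = w i t * coord b i x.
  rewrite {1}(basisE x) lie_sumr linear_sum (bigD1 i) //= big1 => [|j ji].
    rewrite addr0 lieZr wP !linearZ /= coord_free ?(basis_free bb) // eqxx.
    by rewrite mulr1 mulrC.
  rewrite lieZr wP !linearZ /= coord_free ?(basis_free bb) //.
  by rewrite ?[i == j]eq_sym (negbTE ji) !mulr0.
rewrite rx linearZ /= => /eqP; rewrite -subr_eq0 -mulrBl mulf_eq0 subr_eq0 eq_sym.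
by rewrite (negbTE wa).
Qed.

Lemma is_weightP mu : is_weight mu <-> exists i, w i = mu.
Proof.
split=> [[x x0 rx]|[i <-]].
  apply: contrapT => H; case/negP: x0; rewrite [x]basisE big1 // => i _.
  by rewrite (rsp_coord rx) ?scale0r //; apply/eqP => e; apply: H; exists i.
by exists b`_i => //; rewrite (basis_not0 bb) // mem_nth ?size_tuple.
Qed.

Lemma basis_prop (P : g -> Prop) :
    (forall u v, P u -> P v -> P (u + v)) -> (forall c u, P u -> P (c *: u)) -> P 0 ->
    (forall mu x, in_root_space mu x -> P x) -> forall x, P x.
Proof.
move=> PD PZ P0 Pw x; rewrite [x]basisE; elim/big_ind: _ => // i _.
by apply: PZ; apply: Pw.
Qed.

Lemma exists_nu mu : exists t : subvs_of h, forall u : subvs_of h,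
  kappa (vsval t) (vsval u) = mu u.
Proof.
pose L (x : g) : C^o := \sum_(i | w i == 0) coord b i x * mu (vsproj h b`_i).
have Llin : linear L.
  move=> c u v; rewrite /L scaler_sumr -big_split; apply: eq_bigr => i _ /=.
  by rewrite linearP /= mulrDl -mulrA.
have [y yE] := killing_represents simple_g (HB.pack_for {linear g -> C^o} L
     (GRing.isLinear.Build C g C^o *:%R L Llin)).
rewrite /= in yE.
have Lb i : w i != 0 -> L b`_i = 0.
  move=> wi0; rewrite /L big1 // => j /eqP wj0.
  rewrite coord_free ?(basis_free bb) //; case: eqP => [ij|]; last by rewrite mul0r.
  by move: wi0; rewrite ij wj0 eqxx.
have yh : y \in h.
  apply: (cartan_self_centralizing simple_g hP) => t th.
  apply: (killing_nondegenerate simple_g) => z; rewrite [z]basisE.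
  rewrite (big_morph _ (killingDr _) (_ : _ = 0)); last by rewrite killingC killing0l.
  apply: big1 => i _; rewrite killingZr lieC killingNl killing_lie.
  rewrite -(vsprojK th) wP killingZr yE.
  have [->|/Lb ->] := eqVneq (w i) 0; last by rewrite mulr0 oppr0 mulr0.
  by rewrite zero_lfunE mul0r oppr0 mulr0.
exists (vsproj h y) => u; rewrite vsprojK // yE.
have uE : vsval u = \sum_(i | w i == 0) coord b i (vsval u) *: b`_i.
  rewrite {1}[vsval u]basisE [RHS]big_mkcond; apply: eq_bigr => i _.
  case: ifP => // /negbT wi; rewrite (@rsp_coord 0) ?scale0r //.
  by apply/rsp0P; exact: subvsP.
rewrite -{2}(vsvalK u) {2}uE /L !linear_sum; apply: eq_bigr => i _.
by rewrite !linearZ.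
Qed.
End WithBasis.

(** Linear conditions on g are checked on weight vectors. *)
Lemma rsp_prop (P : g -> Prop) :
    (forall u v, P u -> P v -> P (u + v)) -> (forall c u, P u -> P (c *: u)) -> P 0 ->
    (forall mu x, in_root_space mu x -> P x) -> forall x, P x.
Proof. by have [b [w [bb wP]]] := exists_weight_basis; exact: (basis_prop bb wP). Qed.

Lemma nu_exists mu : {t : subvs_of h | forall u : subvs_of h,
  kappa (vsval t) (vsval u) = mu u}.
Proof.
by apply: cid; have [b [w [bb wP]]] := exists_weight_basis; exact: (exists_nu bb wP).
Qed.

(** The identification of the dual of h with h by the Killing form. *)
Definition nu mu : subvs_of h := sval (nu_exists mu).

Lemma nuP mu (u : subvs_of h) : kappa (vsval (nu mu)) (vsval u) = mu u.
Proof. exact: svalP (nu_exists mu) u. Qed.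

(** Both sides lie in h and have the same pairing with h, by invariance. *)
Lemma lie_opposite al x y : in_root_space al x -> in_root_space (- al) y ->
  lie x y = kappa x y *: vsval (nu al).
Proof.
move=> rx ry; apply/eqP; rewrite -subr_eq0; apply/eqP.
have xyh : lie x y \in h.
  by apply/rsp0P; rewrite -(subrr al); apply: rsp_lie.
apply: killing_h_nondegenerate => [|u uh]; first by rewrite memvB ?memvZ ?subvsP.
rewrite killingDl killingNl killingZl killing_lie -(vsprojK uh) nuP.
by rewrite lieC ry opp_lfunE scaleNr opprK killingZr mulrC subrr.
Qed.

(** The Killing form is nondegenerate and pairs g_al with g_(-al) only. *)
Lemma rsp_pairing al x : in_root_space al x -> x != 0 ->
  exists2 y, in_root_space (- al) y & kappa x y = 1.
Proof.
move=> rx x0; have [b [w [bb wP]]] := exists_weight_basis.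
have [i ki] : exists i : 'I_n, kappa x b`_i != 0.
  apply: contrapT => H; case/negP: x0; apply/eqP.
  apply: (killing_nondegenerate simple_g) => z; rewrite [z](basisE bb).
  rewrite (big_morph _ (killingDr _) (_ : _ = 0)); last by rewrite killingC killing0l.
  apply: big1 => i _; rewrite killingZr; have [->|ki] := eqVneq (kappa x b`_i) 0.
    by rewrite mulr0.
  by case: H; exists i.
have wi : w i = - al.
  apply/eqP; rewrite -addr_eq0 addrC; apply: contraNT ki => H.
  by apply/eqP; apply: killing_rsp_orthogonal rx (wP i) H.
exists ((kappa x b`_i)^-1 *: b`_i); first by apply: rspZ; rewrite -wi.
by rewrite killingZr mulVf.
Qed.

Lemma is_rootN al : is_root al -> is_root (- al).
Proof.
move=> [a0 [x x0 rx]]; split; first by rewrite oppr_eq0.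
have [y ry k1] := rsp_pairing rx x0; exists y => //.
by apply: contraNneq (oner_neq0 C) => y0; rewrite -k1 y0 killingC killing0l.
Qed.

Lemma is_root_weight al : is_root al <-> al != 0 /\ is_weight al.
Proof. by []. Qed.

Lemma h_center (t : subvs_of h) :
  (forall mu, is_weight mu -> mu t = 0) -> vsval t = 0.
Proof.
move=> H; apply: (simple_center simple_g) => y.
suff : lie (vsval t) y = 0 by move=> e; rewrite lieC e oppr0.
apply: (rsp_prop (P := fun y => lie (vsval t) y = 0)) => [u v eu ev|c u eu||mu x rx].
- by rewrite lieDr eu ev addr0.
- by rewrite lieZr eu scaler0.
- exact: lie0r.
have [->|x0] := eqVneq x 0; first exact: lie0r.
by rewrite rx H ?scale0r //; exists x.
Qed.

(** If al (nu al) vanished, ad (nu al) = [ad e, ad f] would commute with the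
    operator of conjugate eigenvalues, so its eigenvalues would vanish. *)
Lemma root_nu_neq0 al : is_root al -> al (nu al) != 0 :> C.
Proof.
move=> [al0 [e e0 re]]; have [f rf ef1] := rsp_pairing re e0.
have efE : lie e f = vsval (nu al) by rewrite (lie_opposite re rf) ef1 scale1r.
apply/eqP => ant; have [b [w [bb wP]]] := exists_weight_basis.
have gw mu x : in_root_space mu x -> geigen (ad (vsval (nu al))) (mu (nu al) : C) x.
  by move=> rx; apply: geigen_eigen; rewrite adE rx.
have [S SP] := geigen_scaling (ad (vsval (nu al))) (fun a => Num.conj a).
have eS : (S \o ad e)%VF = (ad e \o S)%VF.
  apply: (ext_on_basis bb) => i; rewrite !comp_lfunE !adE.
  rewrite (SP _ _ (gw _ _ (wP i))) (SP _ _ (gw _ _ (rsp_lie re (wP i)))).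
  by rewrite add_lfunE ant add0r lieZr.
have := ltr_scaling bb (fun i => gw _ _ (wP i)) SP.
rewrite -efE [LHS]ltrC ltr_ad_lie eS subrr comp_lfun0l linear0 => /esym/eqP.
rewrite psumr_eq0 => [/allP a0|i _]; last exact: mul_conjC_ge0.
have t0 : vsval (nu al) = 0.
  apply: h_center => mu /(is_weightP bb wP)[i <-].
  by have /= := a0 i (mem_index_enum i); rewrite mul_conjC_eq0 => /eqP.
case/negP: al0; apply/eqP/lfunP => u.
by rewrite -nuP t0 killing0l zero_lfunE.
Qed.

(** There are finitely many weights, and iterating ad x translates by al. *)
Lemma rsp_nilpotent al mu x v : al != 0 -> in_root_space al x -> in_root_space mu v ->
  exists k, iter k (lie x) v = 0.
Proof.
move=> al0 rx rv; apply: contrapT => H.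
have [b [w [bb wP]]] := exists_weight_basis.
have /choice[i iP] k : exists i, w i = mu + al *+ k.
  apply/(is_weightP bb wP); exists (iter k (lie x) v); last exact: rsp_iter.
  by apply/eqP => e; apply: H; exists k.
have inj : injective (fun k : 'I_n.+1 => i k).
  move=> j k /= e; apply/val_inj/eqP => /=.
  have : al *+ j = al *+ k by apply: (addrI mu); rewrite -!iP e.
  move/eqP; rewrite -[al *+ j]scaler_nat -[al *+ k]scaler_nat -subr_eq0 -scalerBl scaler_eq0 (negbTE al0) orbF.
  by rewrite subr_eq0 eqr_nat.
by have := leq_card _ inj; rewrite !card_ord ltnn.
Qed.

Section Triple.
Variables (al : dual h) (e f : g) (t : subvs_of h).
Hypotheses (re : in_root_space al e) (rf : in_root_space (- al) f)
  (efE : lie e f = vsval t) (alt : al t = 2).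

Lemma triple_neq0 : al != 0.
Proof.
apply/eqP => a0; have /eqP : (2 : C) = 0 by rewrite -[LHS]alt a0 zero_lfunE.
by rewrite pnatr_eq0.
Qed.

Lemma triple_tf : lie (vsval t) f = - 2 *: f. Proof. by rewrite rf opp_lfunE alt. Qed.

Lemma primitive_weight mu v : in_root_space mu v -> v != 0 -> lie e v = 0 ->
  exists m : nat, [/\ mu t = m%:R, forall j, (j <= m)%N -> iter j (lie f) v != 0
                   & iter m.+1 (lie f) v = 0].
Proof.
move=> rv v0 ev; have a0 : - al != 0 by rewrite oppr_eq0 triple_neq0.
exact: (sl2_primitive efE triple_tf v0 (rv t) ev (rsp_nilpotent a0 rf rv)).
Qed.

Lemma exists_primitive mu v : in_root_space mu v -> v != 0 ->
  exists p : nat, iter p (lie e) v != 0 /\ lie e (iter p (lie e) v) = 0.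
Proof.
move=> rv v0; have exk : exists k, iter k (lie e) v == 0.
  by have [k /eqP] := rsp_nilpotent triple_neq0 re rv; exists k.
case: (ex_minnP exk) => [[|k]] /eqP k0 kmin; first by rewrite -[v]/(iter 0 (lie e) v) k0 eqxx in v0.
by exists k; split=> //; apply/negP => /kmin; rewrite ltnn.
Qed.

(** Raise to a primitive vector, then lower. *)
Lemma weight_string mu : is_weight mu ->
  exists m p : nat, mu t = m%:R - (2 * p)%:R /\
    forall j, (j <= m)%N -> is_weight (mu + al *+ p - al *+ j).
Proof.
move=> [v v0 rv]; have [p [u0 eu]] := exists_primitive rv v0.
have ru := rsp_iter p re rv.
have [m [muE nz _]] := primitive_weight ru u0 eu; exists m, p; split.
  move: muE; rewrite add_lfunE -[al *+ p]scaler_nat scale_lfunE alt.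
  rewrite -[_ + _]/(_ + _ * _ : C) => muE.
  by rewrite -muE natrM [2 * _]mulrC addrK.
move=> j jm; exists (iter j (lie f) (iter p (lie e) v)); first exact: nz.
by rewrite -mulNrn; exact: rsp_iter.
Qed.
End Triple.
End RootSpaces.

(** * Coroots, reflections and positivity *)

Section RootSystem.
Variables (R : realType) (g : lieAlgType R[i]) (h : {vspace g}).
Local Notation C := R[i].
Implicit Types (al be mu la : dual h) (x y z : g).
Hypotheses (simple_g : lie_simple g) (hP : cartan_subalgebra h).
Local Notation kappa := (@killing _ g).
Local Notation nu := (nu simple_g hP).

Definition dual_form la mu : C := la (nu mu).

Lemma dual_formE la mu : dual_form la mu = kappa (vsval (nu la)) (vsval (nu mu)).
Proof. by rewrite /dual_form nuP. Qed.

Lemma dual_formC la mu : dual_form la mu = dual_form mu la.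
Proof. by rewrite !dual_formE killingC. Qed.

Lemma dual_formDl la la' mu : dual_form (la + la') mu = dual_form la mu + dual_form la' mu.
Proof. by rewrite /dual_form add_lfunE. Qed.

Lemma dual_formZl c la mu : dual_form (c *: la) mu = c * dual_form la mu.
Proof. by rewrite /dual_form scale_lfunE. Qed.

Lemma dual_formDr la la' mu : dual_form mu (la + la') = dual_form mu la + dual_form mu la'.
Proof. by rewrite ![dual_form mu _]dual_formC dual_formDl. Qed.

Lemma dual_formZr c la mu : dual_form mu (c *: la) = c * dual_form mu la.
Proof. by rewrite ![dual_form mu _]dual_formC dual_formZl. Qed.

Lemma dual_form0l mu : dual_form 0 mu = 0.
Proof. by rewrite /dual_form zero_lfunE. Qed.

Lemma dual_form_suml (I : Type) (r : seq I) (P : pred I) (v : I -> dual h) mu :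
  dual_form (\sum_(i <- r | P i) v i) mu = \sum_(i <- r | P i) dual_form (v i) mu.
Proof. exact: (big_morph (dual_form^~ mu) (fun u v => dual_formDl u v mu) (dual_form0l mu)). Qed.

(** The element of h that [corootP] identifies with the coroot. *)
Definition coroot al : subvs_of h := (2 / dual_form al al) *: nu al.

Lemma eval_coroot mu al : mu (coroot al) = 2 * dual_form mu al / dual_form al al.
Proof. by rewrite linearZ /= -[LHS]/(_ * _ : C) mulrAC. Qed.

Lemma root_form_neq0 al : is_root al -> dual_form al al != 0.
Proof. exact: root_nu_neq0. Qed.

Lemma coroot2 al : is_root al -> al (coroot al) = 2.
Proof. by move=> /root_form_neq0 nz; rewrite eval_coroot mulfK. Qed.

Lemma exists_triple al x : is_root al -> in_root_space al x -> x != 0 ->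
  exists f, [/\ in_root_space (- al) f, lie x f = vsval (coroot al) & f != 0].
Proof.
move=> ral rx x0; have [f rf k1] := rsp_pairing simple_g hP rx x0.
exists ((2 / dual_form al al) *: f); split; first exact: rspZ.
  by rewrite lieZr (lie_opposite simple_g hP rx rf) k1 scale1r.
rewrite scaler_eq0 mulf_eq0 invr_eq0 (negbTE (root_form_neq0 ral)) pnatr_eq0 /=.
by apply: contraNneq (oner_neq0 C) => f0; rewrite -k1 f0 killingC killing0l.
Qed.

Lemma corootP al : is_root al -> is_coroot al (coroot al).
Proof.
move=> ral; have [_ [x x0 rx]] := ral; split; last exact: coroot2.
by have [f [rf e _]] := exists_triple ral rx x0; exists x, f.
Qed.

(** The reflected weight lies in one of the strings that [weight_string]
    produces for the triple and for the opposite one: the parameters of the two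
    cannot both be too short. *)
Lemma reflection_weight al mu : is_root al -> is_weight mu ->
  (exists z : int, mu (coroot al) = z%:~R) /\
  is_weight (mu - (mu (coroot al) : C) *: al).
Proof.
move=> ral wmu; have [_ [e e0 re]] := ral.
have [f [rf efE _]] := exists_triple ral re e0.
have [m [p [mE mP]]] := weight_string hP re rf efE (coroot2 ral) wmu.
split.
  exists (m%:Z - (2 * p)%:Z); rewrite mE rmorphB /= -!pmulrn //.
have [pm|mp] := leqP p m.
  have := mP (m - p)%N (leq_subr _ _); congr is_weight.
  rewrite mE -[RHS]/(mu - (_ : C) *: al) -addrA; congr (_ + _).
  rewrite -[al *+ p]scaler_nat -[al *+ (m - p)]scaler_nat -scalerBl -scaleNr.
  by congr (_ *: _); rewrite natrB // natrM; ring.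
have rf' : in_root_space (- - al) e by rewrite opprK.
have ef' : lie f e = vsval (- coroot al) by rewrite lieC efE linearN.
have al' : (- al) (- coroot al) = 2 by rewrite linearN /= opp_lfunE opprK coroot2.
have [m' [p' [mE' mP']]] := weight_string hP rf rf' ef' al' wmu.
have E : mu (coroot al) = (2 * p')%:R - m'%:R.
  by rewrite -[coroot al]opprK linearN /= mE' opprB.
have pm' : (p' <= m')%N.
  have /eqP : m%:R + m'%:R = (2 * p')%:R + (2 * p)%:R :> C.
    have E' : m%:R - (2 * p)%:R = (2 * p')%:R - m'%:R :> C by rewrite -mE -E.
    by rewrite -[m%:R](subrK (2 * p)%:R) E'; ring.
  by rewrite -!natrD eqr_nat => /eqP; lia.
have := mP' (m' - p')%N (leq_subr _ _); congr is_weight.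
rewrite E -addrA; congr (_ + _).
rewrite !mulNrn opprK -[al *+ p']scaler_nat -[al *+ (m' - p')]scaler_nat.
rewrite -!scaleNr -scalerDl; congr (_ *: _).
by rewrite natrB // natrM; ring.
Qed.

Lemma eval_coroot_int al mu : is_root al -> is_weight mu ->
  exists z : int, mu (coroot al) = z%:~R.
Proof. by move=> ral wmu; have [] := reflection_weight ral wmu. Qed.

Definition reflection al mu := mu - (mu (coroot al) : C) *: al.

Lemma reflection_linear al : linear (reflection al).
Proof.
move=> c u v; rewrite /reflection add_lfunE scale_lfunE.
rewrite -[_ + _ : C^o]/(_ + _ : C) -[c *: _ : C^o]/(c * _ : C) scalerDl opprD addrACA.
by rewrite scalerBr scalerA.
Qed.

Lemma reflectionK al : is_root al -> involutive (reflection al).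
Proof.
move=> ral mu; rewrite /reflection add_lfunE opp_lfunE scale_lfunE coroot2 //.
rewrite -[_ *: 2 : C^o]/(_ * 2 : C) -[_ - _ : C^o]/(_ - _ : C).
set c : C := mu _; rewrite -addrA -opprD -scalerDl.
by rewrite (_ : c + (c - c * 2) = 0) ?scale0r ?subr0 //; ring.
Qed.

Lemma reflection_self al : is_root al -> reflection al al = - al.
Proof.
move=> ral; rewrite /reflection coroot2 // (_ : (2 : C) = 1 + 1) // scalerDl scale1r.
by rewrite opprD addrA subrr sub0r.
Qed.

Lemma reflection_root al be : is_root al -> is_root be -> is_root (reflection al be).
Proof.
move=> ral [b0 wb]; split; last exact: (reflection_weight ral wb).2.
apply: contraNneq b0 => e; rewrite -(reflectionK ral be) e.
by rewrite /reflection zero_lfunE scale0r subr0.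
Qed.

(** A vector z of g_al orthogonal to f commutes with f, so that it would be
    primitive for the opposite triple, of eigenvalue -2. *)
Lemma root_dim1 al x y : is_root al -> in_root_space al x -> x != 0 ->
  in_root_space al y -> exists c, y = c *: x.
Proof.
move=> ral rx x0 ry; have [f [rf xf f0]] := exists_triple ral rx x0.
have rNal : is_root (- al) by exact: (is_rootN simple_g hP).
have rx' : in_root_space (- - al) x by rewrite opprK.
have fx : lie f x = vsval (- coroot al) by rewrite lieC xf linearN.
have al' : (- al) (- coroot al) = 2 by rewrite linearN /= opp_lfunE opprK coroot2.
have fx0 : kappa f x != 0.
  apply/eqP => k0; have := al'; have -> : - coroot al = 0.
    by apply/subvs_inj; rewrite -fx (lie_opposite simple_g hP rf rx') k0 scale0r.
  by rewrite linear0 => /esym/eqP; rewrite -[_ == _]/((2 : C) == 0) pnatr_eq0.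
exists (kappa f y / kappa f x); apply/eqP; rewrite -subr_eq0; apply/eqP.
set z := y - _; have rz : in_root_space al z by apply: rspB => //; exact: rspZ.
have fz : lie f z = 0.
  have rz' : in_root_space (- - al) z by rewrite opprK.
  rewrite (lie_opposite simple_g hP rf rz') /z killingDr killingNr killingZr.
  by rewrite divfK // subrr scale0r.
apply: contrapT => /eqP z0.
have [m [mE _ _]] := primitive_weight hP rx' fx al' rz z0 fz.
move: mE; rewrite linearN /= coroot2 // => /eqP.
rewrite -[_ == _]/(- (2 : C) == m%:R) eq_sym -addr_eq0 -natrD pnatr_eq0.
by rewrite addnS.
Qed.

(** Lowering a primitive vector of weight N al leads through g_al, which
    consists of multiples of e and is killed by e; but e kills no member of a
    string except its top. *)
Lemma root_no_multiple al k : is_root al -> (1 < k)%N -> ~ is_weight (al *+ k).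
Proof.
move=> ral k1 [x x0 rx]; have [al0 [e e0 re]] := ral.
have [f [rf efE f0]] := exists_triple ral re e0.
have al2 := coroot2 ral.
have [p [y0 ey]] := exists_primitive hP re al2 rx x0.
have ry := rsp_iter p re rx; rewrite -mulrnDr in ry.
set y := iter p (lie e) x in y0 ey ry; set N := (k + p)%N in ry.
have N1 : (1 < N)%N by rewrite ltn_addr.
have [m [mE nz _]] := primitive_weight hP rf efE al2 ry y0 ey.
(* The top y has weight N al, and the f-string of y meets g_al after N - 1 steps. *)
have mN : m = (2 * N)%N.
  move: mE; rewrite -scaler_nat scale_lfunE al2 -[_ *: _]/(N%:R * 2 : C) -natrM => /eqP.
  by rewrite eqr_nat => /eqP <-; rewrite mulnC.
have ru := rsp_iter (N.-1) rf ry.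
have {}ru : in_root_space al (iter N.-1 (lie f) y).
  move: ru; congr in_root_space; rewrite mulNrn -mulrnBr ?leq_pred //.
  by rewrite (_ : N - N.-1 = 1)%N //; lia.
have [c cE] := root_dim1 ral re e0 ru.
have Npred : N.-1 = N.-2.+1 by lia.
have tf := triple_tf rf al2.
have := sl2_raise efE tf N.-2 (ry _) ey; rewrite -Npred cE lieZr liexx scaler0.
move/esym/eqP; rewrite scaler_eq0 (negbTE (nz _ _)); last by rewrite mN; lia.
rewrite orbF mulf_eq0 pnatr_eq0 Npred /= mE mN subr_eq0 eqr_nat.
by move=> /eqP; lia.
Qed.

Lemma killing_weights (b : (\dim {:g}).-tuple g) (w : 'I_(\dim {:g}) -> dual h) t u :
  basis_of fullv b -> (forall i : 'I_(\dim {:g}), in_root_space (w i) b`_i) ->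
  kappa (vsval t) (vsval u) = \sum_i (w i t : C) * w i u.
Proof.
move=> bb wP; rewrite /killing (ltr_basis _ bb); apply: eq_bigr => i _.
rewrite comp_lfunE !adE wP lieZr wP !linearZ /= coord_free ?(basis_free bb) //.
by rewrite eqxx mulr1 mulrC.
Qed.

Lemma dual_form_weights (b : (\dim {:g}).-tuple g) (w : 'I_(\dim {:g}) -> dual h) la :
  basis_of fullv b -> (forall i : 'I_(\dim {:g}), in_root_space (w i) b`_i) ->
  dual_form la la = \sum_i dual_form (w i) la ^+ 2.
Proof.
move=> bb wP; rewrite dual_formE (killing_weights _ _ bb wP).
by apply: eq_bigr => i _; rewrite expr2.
Qed.

Lemma dual_form_coroot mu al : is_root al ->
  dual_form mu al = (mu (coroot al) : C) * dual_form al al / 2.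
Proof.
by move=> /root_form_neq0 nz; rewrite eval_coroot divfK // mulrC mulKf ?pnatr_eq0.
Qed.

(** By [dual_form_weights], form al al = Z * form al al ^+ 2, where Z is a sum
    of squares of half-integers. *)
Lemma root_form_gt0 al : is_root al -> 0 < dual_form al al.
Proof.
move=> ral; have nz := root_form_neq0 ral.
have [b [w [bb wP]]] := exists_weight_basis hP.
have /choice[z zP] i : exists z : int, w i (coroot al) = z%:~R.
  by apply: eval_coroot_int => //; apply/(is_weightP bb wP); exists i.
pose Z : C := \sum_i ((z i)%:~R / 2) ^+ 2.
have E : dual_form al al = Z * dual_form al al ^+ 2.
  rewrite {1}(dual_form_weights _ bb wP) /Z mulr_suml; apply: eq_bigr => i _.
  by rewrite dual_form_coroot // zP -exprMn; congr (_ ^+ 2); ring.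
have Z1 : Z * dual_form al al = 1.
  by apply: (mulIf nz); rewrite mul1r -mulrA -expr2 -E.
have Z0 : 0 <= Z.
  apply: sumr_ge0 => i _; rewrite -realEsqr rpredM ?rpredV ?realz //.
  by rewrite realn.
rewrite -(pmulr_rgt0 _ (_ : 0 < Z)) ?Z1 ?ltr01 // lt_neqAle Z0 andbT eq_sym.
by apply: contraTneq (oner_neq0 C) => Z0'; rewrite -Z1 Z0' mul0r eqxx.
Qed.

Lemma dual_form_real mu al : is_root al -> is_weight mu -> dual_form mu al \is Num.real.
Proof.
move=> ral wmu; rewrite dual_form_coroot //; have [z ->] := eval_coroot_int ral wmu.
by rewrite !rpredM ?rpredV ?realz ?realn // ger0_real // ltW // root_form_gt0.
Qed.

(** The form is positive definite on the real span of the roots, being a sum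
    of squares of real numbers. *)
Lemma dual_form_eq0 (I : finType) (c : I -> C) (al : I -> dual h) :
    (forall i, c i \is Num.real) -> (forall i, is_root (al i)) ->
    dual_form (\sum_i c i *: al i) (\sum_i c i *: al i) <= 0 ->
  \sum_i c i *: al i = 0.
Proof.
move=> cr rr; set la := \sum_i _.
have [b [w [bb wP]]] := exists_weight_basis hP.
have wr i : dual_form (w i) la \is Num.real.
  rewrite dual_formC /la dual_form_suml rpred_sum // => j _.
  rewrite dual_formZl rpredM // dual_formC dual_form_real //.
  by apply/(is_weightP bb wP); exists i.
rewrite (dual_form_weights _ bb wP) => le0.
have : \sum_i dual_form (w i) la ^+ 2 == 0.
  by rewrite eq_le le0 sumr_ge0 // => i _; rewrite -realEsqr.
rewrite psumr_eq0 => [/allP a0|i _]; last by rewrite -realEsqr.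
have n0 : vsval (nu la) = 0.
  apply: (h_center simple_g hP) => mu /(is_weightP bb wP)[i <-].
  have := a0 i (mem_index_enum i).
  by rewrite /= expf_eq0 => /andP[_ /eqP].
by apply/lfunP => u; rewrite -(nuP simple_g hP) n0 killing0l zero_lfunE.
Qed.
End RootSystem.

(** * Simple roots and Chevalley generators *)

Lemma killing_suml (F : closedFieldType) (g : lieAlgType F) (I : Type) (r : seq I)
    (P : pred I) (v : I -> g) y :
  killing (\sum_(i <- r | P i) v i) y = \sum_(i <- r | P i) killing (v i) y.
Proof.
exact: (big_morph ((@killing F g)^~ y) (fun u v => killingDl u v y) (killing0l y)).
Qed.

Section SimpleFamily.
Variables (R : realType) (g : lieAlgType R[i]) (h : {vspace g}).
Local Notation C := R[i].

(** A base of the root system, with a free choice of index set: this makes it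
    possible to negate, reflect or transport a base. *)
Record simple_family (I : finType) (al : I -> dual h) : Prop := SimpleFamily {
  sf_root : forall i, is_root (al i);
  sf_free : forall c : I -> C, \sum_i c i *: al i = 0 -> forall i, c i = 0;
  sf_span : forall mu, exists c : I -> C, mu = \sum_i c i *: al i;
  sf_sign : forall be, is_root be -> exists c : I -> nat,
    be = \sum_i al i *+ c i \/ be = - \sum_i al i *+ c i
}.

Lemma simple_system_family (Pi : seq (dual h)) : simple_system Pi ->
  simple_family (fun i : 'I_(size Pi) => Pi`_i).
Proof.
move=> [bPi rPi sPi]; split=> [i|c c0|mu|be /sPi //].
- by apply: rPi; rewrite mem_nth.
- have fr : free (in_tuple Pi) := basis_free bPi.
  by move/freeP: fr => /(_ c c0).
- exists (fun i => coord (in_tuple Pi) i mu).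
  exact: (coord_basis (X := in_tuple Pi) bPi (memvf mu)).
Qed.

Section Theory.
Variables (I : finType) (al : I -> dual h).
Hypothesis alP : simple_family al.

Lemma sf_coord_inj (c d : I -> C) :
  \sum_i c i *: al i = \sum_i d i *: al i -> forall i, c i = d i.
Proof.
move=> e i; apply/eqP; rewrite -subr_eq0; apply/eqP.
apply: (sf_free alP (c := fun i => c i - d i)); rewrite -[RHS](subrr (\sum_i d i *: al i)) -{1}e.
by rewrite -sumrB; apply: eq_bigr => j _; rewrite scalerBl.
Qed.

Lemma sf_natE (c : I -> nat) : \sum_i al i *+ c i = \sum_i (c i)%:R *: al i.
Proof. by apply: eq_bigr => i _; rewrite scaler_nat. Qed.

Lemma sf_delta i : al i = \sum_j (j == i)%:R *: al j.
Proof.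
rewrite (bigD1 i) //= eqxx scale1r big1 ?addr0 // => j /negbTE ->.
by rewrite scale0r.
Qed.

Lemma sf_inj : injective al.
Proof.
move=> i j ij; have : \sum_l (l == i)%:R *: al l = \sum_l (l == j)%:R *: al l.
  exact: etrans (esym (sf_delta i)) (etrans ij (sf_delta j)).
move/sf_coord_inj/(_ i)/eqP; rewrite eqxx eqr_nat.
by case: (eqVneq i j).
Qed.

Lemma sf_same_sign (c : I -> C) : is_root (\sum_i c i *: al i) ->
  exists k : I -> nat, (forall i, c i = (k i)%:R) \/ (forall i, c i = - (k i)%:R).
Proof.
move=> /(sf_sign alP)[k]; rewrite sf_natE => -[/sf_coord_inj e|]; exists k; first by left.
right; move: b; rewrite -sumrN => e; apply: sf_coord_inj; rewrite e.
by apply: eq_bigr => j _; rewrite scaleNr.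
Qed.

(** Its coordinates have opposite signs. *)
Lemma sf_diff i j : i != j -> ~ is_weight (al j - al i).
Proof.
move=> ij wij.
have E : al j - al i = \sum_l ((l == j)%:R - (l == i)%:R) *: al l.
  rewrite {1}(sf_delta i) {1}(sf_delta j) -sumrB; apply: eq_bigr => l _.
  by rewrite scalerBl.
have : is_root (al j - al i).
  by split=> //; rewrite subr_eq0; apply: contra_neq ij => /sf_inj ->.
rewrite E => /sf_same_sign[k [] kP].
  have := kP i; rewrite eqxx (negbTE ij) sub0r => /eqP.
  by rewrite eq_sym -addr_eq0 -natrD pnatr_eq0 addn1.
have := kP j; rewrite eqxx eq_sym (negbTE ij) subr0 => /eqP.
by rewrite -addr_eq0 -natrD pnatr_eq0.
Qed.
End Theory.

(** The two halves of the root system can be exchanged: what holds for the e_i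
    holds for the f_i. *)
Lemma simple_familyN (I : finType) (al : I -> dual h) (simple_g : lie_simple g)
    (hP : cartan_subalgebra h) :
  simple_family al -> simple_family (fun i => - al i).
Proof.
move=> P; split=> [i|c|mu|be rbe].
- exact: (is_rootN simple_g hP (sf_root P i)).
- rewrite (eq_bigr (fun i => - (c i *: al i))) ?sumrN => [/eqP|i _]; last by rewrite scalerN.
  by rewrite oppr_eq0 => /eqP; exact: sf_free.
- have [c ->] := sf_span P mu; exists (fun i => - c i).
  by apply: eq_bigr => i _; rewrite scalerN scaleNr opprK.
have [c cP] := sf_sign P rbe; exists c.
have -> : \sum_i - al i *+ c i = - \sum_i al i *+ c i.
  by rewrite -sumrN; apply: eq_bigr => i _; rewrite mulNrn.
by rewrite opprK; case: cP => ->; [right|left].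
Qed.

Hypotheses (simple_g : lie_simple g) (hP : cartan_subalgebra h).
Local Notation nu := (nu simple_g hP).
Local Notation coroot := (coroot simple_g hP).
Local Notation form := (dual_form simple_g hP).
Local Notation kappa := (@killing _ g).

(** A vector of weight be is killed by f, so it generates a string for the
    opposite triple.  If the string went one step further, reflection would
    turn its end into the excluded weight be - al. *)
Lemma string_from_bottom (al be : dual h) : is_root al -> is_weight be ->
    ~ is_weight (be - al) ->
  exists k : nat, [/\ be (coroot al) = - k%:R,
    forall l, (l <= k)%N -> is_weight (be + al *+ l)
    & ~ is_weight (be + al *+ k.+1)].
Proof.
move=> ral [x x0 rx] nw; have [_ [e e0 re]] := ral.
have [f [rf efE f0]] := exists_triple simple_g hP ral re e0.
have rf' : in_root_space (- - al) e by rewrite opprK.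
have ef' : lie f e = vsval (- coroot al) by rewrite lieC efE linearN.
have al' : (- al) (- coroot al) = 2 by rewrite linearN /= opp_lfunE opprK coroot2.
have fx : lie f x = 0.
  apply: contrapT => /eqP fx0; apply: nw; exists (lie f x) => //.
  by rewrite addrC; exact: rsp_lie.
have [k [kE nz z]] := primitive_weight hP rf' ef' al' rx x0 fx.
have E : be (coroot al) = - k%:R by rewrite -[coroot al]opprK linearN /= kE.
have W l : (l <= k)%N -> is_weight (be + al *+ l).
  move=> lk; exists (iter l (lie e) x); first exact: nz.
  by exact: rsp_iter.
exists k; split=> // wk; apply: nw.
have := (reflection_weight simple_g hP ral wk).2; congr is_weight.
rewrite add_lfunE -[al *+ k.+1]scaler_nat scale_lfunE E coroot2 //.
rewrite -[_ *: 2 : C^o]/(_ * 2 : C) -[_ + _ : C^o]/(_ + _ : C).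
rewrite -addrA -scalerBl -[- al]scaleN1r; congr (_ + _ *: _).
by rewrite -natr1; ring.
Qed.

Section Positive.
Variables (I : finType) (al : I -> dual h).
Hypothesis alP : simple_family al.

(** Induction on the height: a root vector of weight be that were not
    generated would give a y in g_(-be) killed by all e_i, so that be would have
    nonpositive inner product with every simple root, hence with itself. *)
Lemma generates_positive_family (P : g -> Prop) (e : I -> g) :
    (forall c x, P x -> P (c *: x)) -> (forall x y, P x -> P y -> P (lie x y)) -> P 0 ->
    (forall i, [/\ in_root_space (al i) (e i), e i != 0 & P (e i)]) ->
  forall (k : I -> nat) x, is_root (\sum_i al i *+ k i) ->
    in_root_space (\sum_i al i *+ k i) x -> P x.
Proof.
move=> PZ Plie P0 eP k; have [m] := ubnP (\sum_i k i)%N.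
elim: m k => // m IHm k km x rbe rx.
set be := \sum_i al i *+ k i in rbe rx.
have [->|x0] := eqVneq x 0; first exact: P0.
have [[i bei]|nsimple] := pselect (exists i, be = al i).
  have [re e0 Pe] := eP i; rewrite bei in rx.
  by have [c ->] := root_dim1 simple_g hP (sf_root alP i) re e0 rx; exact: PZ.
apply: contrapT => nPx.
have Pu i u : in_root_space (be - al i) u -> P u.
  move=> ru; have [->|u0] := eqVneq u 0; first exact: P0.
  have rbi : is_root (be - al i).
    split; last by exists u.
    by rewrite subr_eq0; apply/eqP => bei; apply: nsimple; exists i.
  have [ki0|ki] := posnP (k i).
    have E : be - al i = \sum_l ((k l)%:R - (l == i)%:R) *: al l.
      rewrite /be sf_natE {1}(sf_delta al i) -sumrB.
      by apply: eq_bigr => l _; rewrite scalerBl.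
    move: (rbi); rewrite E => /(sf_same_sign alP)[k' [] k'P].
      have := k'P i; rewrite ki0 eqxx sub0r => /eqP.
      by rewrite eq_sym -addr_eq0 -natrD pnatr_eq0 addn1.
    have k0 l : k l = 0%N.
      have [-> //|li] := eqVneq l i.
      have := k'P l; rewrite (negbTE li) subr0 => /eqP.
      by rewrite -addr_eq0 -natrD pnatr_eq0 addn_eq0 => /andP[/eqP].
    case: rbe => /eqP[]; rewrite /be big1 // => l _; rewrite k0 //.
  have E : be - al i = \sum_l al l *+ (k l - (l == i)).
    rewrite /be (bigD1 i) //= [RHS](bigD1 i) //= eqxx addrAC; congr (_ + _).
      by rewrite mulrnBr // mulr1n.
    by apply: eq_bigr => l /negbTE ->; rewrite subn0.
  move: rbi ru; rewrite E; apply: IHm; move: km.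
  rewrite (bigD1 i) //= [X in _ -> (X < _)%N](bigD1 i) //= eqxx.
  rewrite [X in (_ + X < m)%N](eq_bigr k) => [|l /negbTE ->]; last by rewrite subn0.
  by lia.
(* Otherwise the bracket would be a nonzero multiple of x, which is not in P. *)
have eu i u : in_root_space (be - al i) u -> lie (e i) u = 0.
  move=> ru; have [re e0 Pe] := eP i.
  have reu : in_root_space be (lie (e i) u).
    by have := rsp_lie re ru; rewrite addrCA subrr addr0.
  have [c cE] := root_dim1 simple_g hP rbe rx x0 reu.
  have [c0|c0] := eqVneq c 0; first by rewrite cE c0 scale0r.
  by case: nPx; rewrite -[x](scalerK c0) -cE; apply: PZ; apply: Plie => //; exact: (Pu i).
have [y ry k1] := rsp_pairing simple_g hP rx x0.
have y0 : y != 0.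
  by apply: contraNneq (oner_neq0 C) => y0; rewrite -k1 y0 killingC killing0l.
(* By invariance of the Killing form, as e_i kills the space paired with [e_i, y]. *)
have ey i : lie (e i) y = 0.
  apply: contrapT => /eqP ey0; have [re e0 Pe] := eP i.
  have rey := rsp_lie re ry.
  have [u ru ku] := rsp_pairing simple_g hP rey ey0.
  have ru' : in_root_space (be - al i) u by move: ru; rewrite opprD opprK addrC.
  move: ku; rewrite lieC killingNl killing_lie (eu i) // killingC killing0l oppr0.
  by move/esym/eqP; rewrite oner_eq0.
have neg i : form (al i) be <= 0.
  have [re e0 Pe] := eP i.
  have [f [rf efE _]] := exists_triple simple_g hP (sf_root alP i) re e0.
  have [j [jE _ _]] := primitive_weight hP rf efE (coroot2 simple_g hP (sf_root alP i)) ry y0 (ey i).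
  rewrite dual_formC (dual_form_coroot simple_g hP _ (sf_root alP i)).
  have -> : be (coroot (al i)) = - j%:R by rewrite -jE opp_lfunE opprK.
  rewrite -[- _ : C^o]/(- _ : C) -mulrA mulNr oppr_le0 mulr_ge0 ?ler0n //.
  rewrite divr_ge0 ?ler0n // ltW //; apply: root_form_gt0; exact: (sf_root alP i).
have le0 : form be be <= 0.
  rewrite {1}/be dual_form_suml -oppr_ge0 -sumrN; apply: sumr_ge0 => i _.
  by rewrite -[al i *+ _]scaler_nat dual_formZl oppr_ge0 mulr_ge0_le0 ?ler0n.
by have := lt_le_trans (root_form_gt0 simple_g hP rbe) le0; rewrite ltxx.
Qed.

End Positive.

Section Generation.
Variables (I : finType) (al : I -> dual h).
Hypothesis alP : simple_family al.

Lemma coroots_span (t : subvs_of h) : exists c : I -> C, t = \sum_i c i *: coroot (al i).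
Proof.
pose L (u : subvs_of h) : C^o := kappa (vsval t) (vsval u).
have Llin : linear L.
  by move=> c u v; rewrite /L linearD linearZ /= killingDr killingZr.
pose mu : dual h := linfun (HB.pack_for {linear subvs_of h -> C^o} L
  (GRing.isLinear.Build C (subvs_of h) C^o *:%R L Llin)).
have muE u : mu u = kappa (vsval t) (vsval u) by rewrite lfunE.
have [c cE] := sf_span alP mu.
exists (fun i => c i * (form (al i) (al i) / 2)).
apply/subvs_inj/eqP; rewrite -subr_eq0; apply/eqP.
apply: (killing_h_nondegenerate simple_g hP) => [|u uh]; first by rewrite memvB ?subvsP.
rewrite killingDl killingNl -(vsprojK uh) -muE cE sum_lfunE [vsval (\sum_i _)]linear_sum /=.
rewrite killing_suml -sumrB big1 // => i _.
have nz := root_form_neq0 simple_g hP (sf_root alP i).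
rewrite scalerA (_ : c i * _ * _ = c i); last by field; rewrite nz.
by rewrite killingZl nuP scale_lfunE; exact: subrr.
Qed.

Record chevalley (e f : I -> g) : Prop := Chevalley {
  ch_e : forall i, in_root_space (al i) (e i);
  ch_f : forall i, in_root_space (- al i) (f i);
  ch_ef : forall i, lie (e i) (f i) = vsval (coroot (al i));
  ch_e0 : forall i, e i != 0;
  ch_f0 : forall i, f i != 0
}.

Lemma exists_chevalley : exists e f, chevalley e f.
Proof.
have /choice[e eP] i : exists e, e != 0 /\ in_root_space (al i) e.
  by have [_ [x x0 rx]] := sf_root alP i; exists x.
have /choice[f fP] i := exists_triple simple_g hP (sf_root alP i) (eP i).2 (eP i).1.
by exists e, f; split=> i; have [] := fP i; have [] := eP i.
Qed.

Lemma chevalley_generates e f : chevalley e f -> forall P : g -> Prop,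
    (forall x y, P x -> P y -> P (x + y)) -> (forall c x, P x -> P (c *: x)) ->
    (forall x y, P x -> P y -> P (lie x y)) -> (forall i, P (e i)) -> (forall i, P (f i)) ->
    P 0 -> forall x, P x.
Proof.
move=> ef P PD PZ Plie Pe Pf P0; apply: (rsp_prop hP) => // mu x rx.
have [mu0|mu0] := eqVneq mu 0.
  have xh : x \in h by apply/(rsp0P simple_g hP); rewrite -mu0.
  rewrite -(vsprojK xh); have [c ->] := coroots_span (vsproj h x).
  elim/big_ind: _ => [|u v Pu Pv|i _]; [exact: P0|exact: PD|apply: (PZ _ (vsval _))].
  by rewrite -(ch_ef ef); apply: Plie.
have [->//|x0] := eqVneq x 0.
have rmu : is_root mu by split=> //; exists x.
have [k [] kE] := sf_sign alP rmu.
  rewrite kE in rx rmu; apply: (generates_positive_family alP (e := e) PZ Plie P0 _ rmu rx) => i.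
  by split=> //; [exact: (ch_e ef)|exact: (ch_e0 ef)].
have NP := simple_familyN simple_g hP alP.
rewrite kE -sumrN in rx rmu.
rewrite (eq_bigr (fun i => - al i *+ k i)) in rx rmu; last by move=> i _; rewrite mulNrn.
apply: (generates_positive_family NP (e := f) PZ Plie P0 _ rmu rx) => i.
by split=> //; [exact: (ch_f ef)|exact: (ch_f0 ef)].
Qed.

(** The difference of two simple roots is not a weight. *)
Lemma chevalley_e_f e f i j : chevalley e f -> i != j -> lie (e i) (f j) = 0.
Proof.
move=> ef ij; apply: contrapT => /eqP nz; apply: (sf_diff alP (i := j) (j := i)).
  by rewrite eq_sym.
by exists (lie (e i) (f j)) => //; apply: rsp_lie; [exact: (ch_e ef)|exact: (ch_f ef)].
Qed.
End Generation.
End SimpleFamily.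

(** * Cartan integers and connectedness *)

Section CartanIntegers.
Variables (R : realType) (g : lieAlgType R[i]) (h : {vspace g}).
Local Notation C := R[i].
Hypotheses (simple_g : lie_simple g) (hP : cartan_subalgebra h).
Local Notation coroot := (coroot simple_g hP).
Local Notation form := (dual_form simple_g hP).
Variables (I : finType) (al : I -> dual h).
Hypothesis alP : simple_family al.

Lemma is_weightN (mu : dual h) : is_weight mu -> is_weight (- mu).
Proof.
have [->|mu0 wmu] := eqVneq mu 0; first by rewrite oppr0.
by have [] := is_rootN simple_g hP (conj mu0 wmu).
Qed.

Lemma cartan_string i j : i != j -> exists k : nat,
  [/\ al j (coroot (al i)) = - k%:R,
    forall l, (l <= k)%N -> is_weight (al j + al i *+ l)
    & ~ is_weight (al j + al i *+ k.+1)].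
Proof.
move=> ij; apply: string_from_bottom; first exact: (sf_root alP i).
  exact: (sf_root alP j).2.
exact: (sf_diff alP ij).
Qed.

Lemma cartan_zero_sym i j : al j (coroot (al i)) = 0 -> al i (coroot (al j)) = 0.
Proof.
move=> e; rewrite eval_coroot dual_formC.
by rewrite (dual_form_coroot simple_g hP _ (sf_root alP i)) e -[0%R : C^o]/(0 : C) !(mul0r, mulr0).
Qed.

(** A strict Cauchy-Schwarz inequality for two independent roots. *)
Lemma cartan_product_lt4 i j (a b : nat) : i != j ->
  al j (coroot (al i)) = - a%:R -> al i (coroot (al j)) = - b%:R -> (a * b < 4)%N.
Proof.
move=> ij ea eb; rewrite ltnNge; apply/negP => ab.
have ri := sf_root alP i; have rj := sf_root alP j.
have gi := root_form_gt0 simple_g hP ri; have gj := root_form_gt0 simple_g hP rj.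
set Bi := form _ _ in gi; set Bj := form _ _ in gj.
have Eij : form (al j) (al i) = - a%:R * Bi / 2 by rewrite (dual_form_coroot simple_g hP _ ri) ea.
have Eji : form (al j) (al i) = - b%:R * Bj / 2.
  by rewrite dual_formC (dual_form_coroot simple_g hP _ rj) eb.
have aBi : a%:R * Bi = b%:R * Bj.
  have : - a%:R * Bi / 2 = - b%:R * Bj / 2 by rewrite -Eij.
  have h2 : (2^-1 : C) != 0 by rewrite invr_eq0 pnatr_eq0.
  by move/(mulIf h2); rewrite !mulNr => /oppr_inj.
pose c l : C := if l == i then a%:R else if l == j then 2 else 0.
have laE : \sum_l c l *: al l = a%:R *: al i + 2 *: al j.
  rewrite (bigD1 i) //= (bigD1 j) 1?eq_sym //= big1 => [|l /andP[li lj]].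
    by rewrite /c !eqxx eq_sym (negbTE ij) addr0.
  by rewrite /c (negbTE li) (negbTE lj) scale0r.
have la0 : \sum_l c l *: al l = 0.
  apply: (dual_form_eq0 (simple_g := simple_g) (hP := hP)) => [l|l|].
  - by rewrite /c; case: ifP => _; [|case: ifP => _]; rewrite ?realn ?real0.
  - exact: (sf_root alP l).
  rewrite laE !(dual_formDl, dual_formDr, dual_formZl, dual_formZr).
  rewrite [form (al i) (al j)]dual_formC Eij -/Bi -/Bj.
  rewrite [X in X <= 0](_ : _ = 4 * Bj - a%:R * (a%:R * Bi)); last by field.
  rewrite aBi mulrA -natrM -mulrBl pmulr_lle0 // subr_le0.
  by rewrite -[4]/(4%:R) ler_nat.
have := sf_free alP la0 j; rewrite /c eq_sym (negbTE ij) eqxx => /eqP.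
by rewrite pnatr_eq0.
Qed.

Section Chevalley.
Variables (e f : I -> g).
Hypothesis ef : chevalley simple_g hP al e f.

Lemma chevalley_orthogonal i j : i != j -> al j (coroot (al i)) = 0 ->
  lie (e j) (e i) = 0 /\ lie (f j) (f i) = 0.
Proof.
move=> ij a0; have [k [kE _]] := cartan_string ij.
have -> : k = 0%N.
  by apply/eqP; rewrite -(eqr_nat C) -oppr_eq0; apply/eqP; rewrite -kE a0.
rewrite mulr1n => nw; split; apply: contrapT => /eqP nz; apply: nw.
  by exists (lie (e j) (e i)) => //; apply: rsp_lie; exact: (ch_e ef).
rewrite -[al j + al i]opprK; apply: is_weightN; rewrite opprD.
by exists (lie (f j) (f i)) => //; apply: rsp_lie; exact: (ch_f ef).
Qed.

(** The elements that commute with e_j and f_j for all j outside J form a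
    subspace stable under the generators, hence an ideal, which contains the
    e_i for i in J but not the coroots outside J. *)
Lemma sf_connected (J : pred I) i0 : J i0 ->
    (forall i j, J i -> ~~ J j -> al j (coroot (al i)) = 0) -> forall j, J j.
Proof.
move=> Ji0 orth j0; apply/negPn/negP => nJj0.
pose Z x := forall j, ~~ J j -> lie (e j) x = 0 /\ lie (f j) x = 0.
have Z0 : Z 0 by move=> j _; rewrite !lie0r.
have Zlin c u v : Z u -> Z v -> Z (c *: u + v).
  move=> Zu Zv j nJj; have [e1 e2] := Zu j nJj; have [e3 e4] := Zv j nJj.
  by rewrite !lieDr !lieZr e1 e2 e3 e4 scaler0 addr0.
have ZD u v : Z u -> Z v -> Z (u + v).
  by move=> Zu Zv; rewrite -[u]scale1r; exact: Zlin.
have ZZ c u : Z u -> Z (c *: u) by move=> Zu; rewrite -[_ *: _]addr0; exact: Zlin.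
have efne i j : i != j -> lie (f j) (e i) = 0.
  by move=> ij; rewrite lieC (chevalley_e_f alP ef ij) oppr0.
have [] := simple_prop_ideal simple_g Z0 Zlin.
- apply: (chevalley_generates alP ef) => [x x' Px Px' y Zy|c x Px y Zy|x x' Px Px' y Zy|i y Zy|i y Zy|y Zy].
  + by rewrite lieDl; apply: ZD; [exact: Px|exact: Px'].
  + by rewrite lieZl; apply: ZZ; exact: Px.
  + have -> : lie (lie x x') y = lie x (lie x' y) - lie x' (lie x y) by rewrite (lieJ x) addrK.
    by rewrite -scaleN1r addrC; apply: Zlin; [apply/Px'/Px|apply/Px/Px'].
  + have [Ji|nJi] := boolP (J i); last by rewrite (Zy i nJi).1.
    move=> j nJj; have ij : i != j by apply: contraNneq nJj => <-.
    have [e1 e2] := Zy j nJj.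
    rewrite !(lieJ _ (e i)) e1 e2 !lie0r !addr0 efne // lie0l.
    by rewrite (chevalley_orthogonal ij (orth _ _ Ji nJj)).1 lie0l.
  + have [Ji|nJi] := boolP (J i); last by rewrite (Zy i nJi).2.
    move=> j nJj; have ij : i != j by apply: contraNneq nJj => <-.
    have [e1 e2] := Zy j nJj.
    rewrite !(lieJ _ (f i)) e1 e2 !lie0r !addr0 (chevalley_orthogonal ij (orth _ _ Ji nJj)).2.
    by rewrite (chevalley_e_f alP ef) 1?eq_sym // !lie0l.
  + by rewrite lie0l.
- move=> H; case/negP: (ch_e0 ef i0); apply/eqP; apply: H => j nJj.
  have ij : i0 != j by apply: contraNneq nJj => <-.
  by rewrite (chevalley_orthogonal ij (orth _ _ Ji0 nJj)).1 efne.
- move=> H; have [e1 _] := H (vsval (coroot (al j0))) j0 nJj0.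
  move: e1; rewrite lieC (ch_e ef) coroot2; last exact: (sf_root alP j0).
  move/eqP; rewrite oppr_eq0 scaler_eq0 (negbTE (ch_e0 ef j0)) orbF.
  by rewrite -[_ == _]/((2 : C) == 0) pnatr_eq0.
Qed.
End Chevalley.
End CartanIntegers.

(** * Triangular decomposition *)

Section ProductLie.
Variables (F : fieldType) (g1 g2 : lieAlgType F).

Definition lie_prod (x y : g1 * g2) : g1 * g2 := (lie x.1 y.1, lie x.2 y.2).

Fact lie_prod_linearl y : linear (lie_prod^~ y).
Proof. by move=> c u v; congr pair; rewrite /= lieDl lieZl. Qed.

Fact lie_prod_linearr x : linear (lie_prod x).
Proof. by move=> c u v; congr pair; rewrite /= lieDr lieZr. Qed.

Fact lie_prodxx x : lie_prod x x = 0.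
Proof. by rewrite /lie_prod !liexx. Qed.

Fact lie_prod_jacobi x y z :
  lie_prod x (lie_prod y z) + lie_prod y (lie_prod z x) + lie_prod z (lie_prod x y) = 0.
Proof. by congr pair; exact: lie_jacobi. Qed.

HB.instance Definition _ := Vector_isLie.Build F (g1 * g2)%type
  lie_prod_linearl lie_prod_linearr lie_prodxx lie_prod_jacobi.
End ProductLie.

(** Triangular decomposition of the subalgebra generated by elements that
    satisfy the relations of Chevalley generators. *)
Section Triangular.
Variables (F : fieldType) (g : lieAlgType F) (I : finType).

(** The iterated bracket [e_l1, [e_l2, ... e_i]]. *)
Definition word (e : I -> g) i (l : seq I) := foldr (fun j z => lie (e j) z) (e i) l.

Inductive word_span (e : I -> g) : g -> Prop :=
| word_span0 : word_span e 0
| word_spanD c i l z : word_span e z -> word_span e (c *: word e i l + z).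

Lemma word_span_add e u v : word_span e u -> word_span e v -> word_span e (u + v).
Proof. by elim=> [|c i l z _ IH] sv; rewrite ?add0r // -addrA; apply: word_spanD; apply: IH. Qed.

Lemma word_span_scale e c u : word_span e u -> word_span e (c *: u).
Proof.
elim=> [|d i l z _ IH]; first by rewrite scaler0; exact: word_span0.
by rewrite scalerDr scalerA; apply: word_spanD.
Qed.

Lemma word_span_word e i l : word_span e (word e i l).
Proof. by rewrite -[word _ _ _]scale1r -[_ *: _]addr0; apply/word_spanD/word_span0. Qed.

Lemma word_span_lie e j u : word_span e u -> word_span e (lie (e j) u).
Proof.
elim=> [|d i l z _ IH]; first by rewrite lie0r; exact: word_span0.
by rewrite lieDr lieZr; apply: (word_spanD d i (j :: l)).
Qed.

Record chevalley_relations (A : I -> I -> F) (e f t : I -> g) : Prop := ChevalleyRelations {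
  cr_ef : forall i j, lie (e i) (f j) = if i == j then t i else 0;
  cr_te : forall i j, lie (t i) (e j) = A i j *: e j;
  cr_tf : forall i j, lie (t i) (f j) = - A i j *: f j;
  cr_tt : forall i j, lie (t i) (t j) = 0
}.

(** What is proved for words in the e applies to words in the f. *)
Lemma chevalley_relations_swap A e f t : chevalley_relations A e f t ->
  chevalley_relations A f e (fun i => - t i).
Proof.
move=> P; split=> i j.
- rewrite lieC (cr_ef P) eq_sym; case: eqP => [->|_] //; exact: oppr0.
- by rewrite lieNl (cr_tf P) scaleNr opprK.
- by rewrite lieNl (cr_te P) scaleNr.
- by rewrite lieNl lieNr (cr_tt P) !oppr0.
Qed.

Definition torus_span (t : I -> g) z := exists c : I -> F, z = \sum_i c i *: t i.

Lemma torus_span_lin t c u v : torus_span t u -> torus_span t v -> torus_span t (c *: u + v).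
Proof.
move=> [a ->] [b ->]; exists (fun i => c * a i + b i).
rewrite scaler_sumr -big_split; apply: eq_bigr => i _ /=.
by rewrite scalerDl scalerA.
Qed.

Lemma torus_span0 t : torus_span t 0.
Proof. by exists (fun _ => 0); rewrite big1 // => i _; rewrite scale0r. Qed.

Lemma torus_span_gen t i : torus_span t (t i).
Proof.
exists (fun j => (j == i)%:R); rewrite (bigD1 i) //= eqxx scale1r big1 ?addr0 //.
by move=> j /negbTE ->; rewrite scale0r.
Qed.

Section Raise.
Variables (A : I -> I -> F) (e f t : I -> g).
Hypothesis P : chevalley_relations A e f t.

Lemma word_t i j l : exists c, lie (t i) (word e j l) = c *: word e j l.
Proof.
elim: l => [|k l [c IH]] /=; first by exists (A i j); exact: (cr_te P).
by exists (A i k + c); rewrite lieJ (cr_te P) IH lieZl lieZr scalerDl.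
Qed.

Lemma word_span_t i z : word_span e z -> word_span e (lie (t i) z).
Proof.
elim=> [|c j l u _ IH]; first by rewrite lie0r; exact: word_span0.
rewrite lieDr lieZr; apply: word_span_add => //; apply: word_span_scale.
by have [d ->] := word_t i j l; apply/word_span_scale/word_span_word.
Qed.

Lemma torus_lie_e i z : torus_span t z -> word_span e (lie (e i) z).
Proof.
move=> [c ->]; rewrite lie_sumr; elim/big_ind: _ => [||j _].
- exact: word_span0.
- exact: word_span_add.
- rewrite lieZr lieC (cr_te P) -scaleNr; do 2!apply: word_span_scale.
  exact: (word_span_word e i [::]).
Qed.

(** Bracketing a word with f_j either shortens it or leaves it in the sum; the
    torus part appears when the word has length 1. *)
Lemma word_span_f j z : word_span e z ->
  exists b c, [/\ torus_span t b, word_span e c & lie (f j) z = b + c].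
Proof.
elim=> [|d i l u _ [b2 [c2 [tb2 sc2 E2]]]].
  by exists 0, 0; split; [exact: torus_span0|exact: word_span0|rewrite lie0r addr0].
have [b1 [c1 [tb1 sc1 E1]]] : exists b c,
    [/\ torus_span t b, word_span e c & lie (f j) (word e i l) = b + c].
  elim: l => [|k l [b [c [tb sc E]]]] /=.
    exists (lie (f j) (e i)), 0; split; [|exact: word_span0|by rewrite addr0].
    rewrite lieC (cr_ef P); case: eqP => _; last by rewrite oppr0; exact: torus_span0.
    rewrite -[- _]addr0 -scaleN1r; apply: torus_span_lin; first exact: torus_span_gen.
    exact: torus_span0.
  exists 0, (lie (lie (f j) (e k)) (word e i l) + lie (e k) (b + c)).
  split; [exact: torus_span0| |by rewrite add0r lieJ E].
  apply: word_span_add; last first.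
    by rewrite lieDr; apply: word_span_add; [exact: torus_lie_e|exact: word_span_lie].
  rewrite [lie (f j) _]lieC (cr_ef P); case: eqP => _; last first.
    by rewrite oppr0 lie0l; exact: word_span0.
  rewrite lieNl -scaleN1r; apply/word_span_scale/word_span_t/word_span_word.
exists (d *: b1 + b2), (d *: c1 + c2); split; first exact: torus_span_lin.
  by apply: word_span_add => //; exact: word_span_scale.
by rewrite lieDr lieZr E1 E2 scalerDr addrACA.
Qed.
End Raise.

Inductive generated (e f : I -> g) : g -> Prop :=
| gen_e i : generated e f (e i)
| gen_f i : generated e f (f i)
| gen_0 : generated e f 0
| gen_lin c u v : generated e f u -> generated e f v -> generated e f (c *: u + v)
| gen_lie u v : generated e f u -> generated e f v -> generated e f (lie u v).

(** The sum of spans of words in the f, of the t, and of words in the e. *)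
Definition triangular (e f t : I -> g) z := exists a b c,
  [/\ word_span f a, torus_span t b, word_span e c & z = a + b + c].

Lemma triangular_swap e f t z : triangular e f t z <-> triangular f e (fun i => - t i) z.
Proof.
have torusN t' b : torus_span t' b -> torus_span (fun i => - t' i) b.
  move=> [c ->]; exists (fun i => - c i); apply: eq_bigr => i _.
  by rewrite scalerN scaleNr opprK.
split=> [[a [b [c [sa tb sc ->]]]]|[a [b [c [sa tb sc ->]]]]].
  by exists c, b, a; split=> //; [exact: torusN|rewrite addrC [a + b]addrC addrA].
exists c, b, a; split=> //; last by rewrite addrC [a + b]addrC addrA.
have /= := torusN _ _ tb; case=> d ->; exists d.
by apply: eq_bigr => i _; rewrite opprK.
Qed.

Lemma triangular_lin e f t c u v :
  triangular e f t u -> triangular e f t v -> triangular e f t (c *: u + v).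
Proof.
move=> [a1 [b1 [c1 [sa1 tb1 sc1 ->]]]] [a2 [b2 [c2 [sa2 tb2 sc2 ->]]]].
exists (c *: a1 + a2), (c *: b1 + b2), (c *: c1 + c2); split.
- by apply: word_span_add => //; exact: word_span_scale.
- exact: torus_span_lin.
- by apply: word_span_add => //; exact: word_span_scale.
by rewrite !scalerDr addrACA [X in X + _]addrACA.
Qed.

Lemma triangular_e A e f t i z : chevalley_relations A e f t ->
  triangular e f t z -> triangular e f t (lie (e i) z).
Proof.
move=> P [a [b [c [sa tb sc ->]]]].
have [b' [a' [tb' sa' E]]] := word_span_f (chevalley_relations_swap P) i sa.
have [d dE] := tb'; exists a', b', (lie (e i) b + lie (e i) c); split=> //.
- exists (fun i => - d i); rewrite dE; apply: eq_bigr => k _.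
  by rewrite scalerN scaleNr.
- by apply: word_span_add; [exact: (torus_lie_e P)|exact: word_span_lie].
by rewrite !lieDr E [b' + a']addrC !addrA.
Qed.

(** The triangular sum contains the generators and is stable under bracketing
    with them, which generates all brackets by the Jacobi identity. *)
Lemma generated_triangular A e f t z : chevalley_relations A e f t ->
  generated e f z -> triangular e f t z.
Proof.
move=> P Dz; suff [] : triangular e f t z /\
    forall y, triangular e f t y -> triangular e f t (lie z y) by [].
have T0 : triangular e f t 0.
  by exists 0, 0, 0; rewrite !addr0; split; [exact: word_span0|exact: torus_span0|exact: word_span0|].
elim: Dz => [i|i||c u v _ [Tu Iu] _ [Tv Iv]|u v _ [Tu Iu] _ [Tv Iv]].
- split=> [|y]; last exact: (triangular_e i P).
  exists 0, 0, (e i); rewrite !add0r; split=> //; [exact: word_span0|exact: torus_span0|].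
  exact: (word_span_word e i [::]).
- split=> [|y].
    exists (f i), 0, 0; rewrite !addr0; split=> //; [|exact: torus_span0|exact: word_span0].
    exact: (word_span_word f i [::]).
  move=> /triangular_swap H; apply/triangular_swap.
  exact: (triangular_e i (chevalley_relations_swap P) H).
- by split=> // y _; rewrite lie0l.
- split; first exact: triangular_lin.
  by move=> y Ty; rewrite lieDl lieZl; apply: triangular_lin; [exact: Iu|exact: Iv].
- split; first exact: Iu.
  move=> y Ty; have -> : lie (lie u v) y = - 1 *: lie v (lie u y) + lie u (lie v y).
    by rewrite scaleN1r (lieJ u) addrC addrK.
  by apply: triangular_lin; [apply/Iv/Iu|apply/Iu/Iv].
Qed.
End Triangular.

(** * The Cartan matrix determines the Lie algebra *)

Section OneSide.
Variables (R : realType) (g : lieAlgType R[i]) (h : {vspace g}).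
Local Notation C := R[i].
Hypotheses (simple_g : lie_simple g) (hP : cartan_subalgebra h).
Local Notation coroot := (coroot simple_g hP).
Variables (I : finType) (al : I -> dual h).
Hypothesis alP : simple_family al.

Lemma sf_nonempty : inhabited I.
Proof.
apply: contrapT => nI; have [e [f ef]] := exists_chevalley simple_g hP alP.
have noI (i : I) : False by apply: nI; exact: (inhabits i).
have [x [y xy]] := simple_g.1; case/negP: xy; apply/eqP.
apply: (chevalley_generates alP ef (P := fun z => z = 0)) => //.
- by move=> u v -> ->; rewrite addr0.
- by move=> c u ->; rewrite scaler0.
- by move=> u v -> _; rewrite lie0l.
Qed.

Lemma word_weight (e : I -> g) i l : (forall j, in_root_space (al j) (e j)) ->
  in_root_space (al i + \sum_(j <- l) al j) (word e i l).
Proof.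
move=> re; elim: l => [|j l IH] /=; first by rewrite big_nil addr0.
by rewrite big_cons addrCA; apply: rsp_lie.
Qed.

(** Weights of words are sums of simple roots, which are independent. *)
Lemma word_weight_neq0 i (l : seq I) : al i + \sum_(j <- l) al j != 0.
Proof.
apply/eqP => e0; have E : al i + \sum_(j <- l) al j
    = \sum_k ((k == i) + count_mem k l)%:R *: al k.
  rewrite {1}(sf_delta al i); under [RHS]eq_bigr => k _ do rewrite natrD scalerDl.
  rewrite big_split /=; congr (_ + _); elim: l {e0} => [|j l IH].
    by rewrite big_nil big1 // => k _; rewrite scale0r.
  rewrite big_cons IH {1}(sf_delta al j) -big_split; apply: eq_bigr => k _ /=.
  by rewrite -scalerDl -natrD eq_sym.
have := sf_free alP (etrans (esym E) e0) i; rewrite eqxx => /eqP.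
by rewrite pnatr_eq0.
Qed.

(** Words have nonzero weight, and root spaces are orthogonal to h. *)
Lemma word_span_killing (e : I -> g) z t :
    (forall j, in_root_space (al j) (e j)) -> word_span e z -> t \in h ->
  killing z t = 0.
Proof.
move=> re sz /(rsp0P simple_g hP) rt; elim: sz => [|c i l u _ IH]; first exact: killing0l.
rewrite killingDl killingZl IH addr0.
rewrite (killing_rsp_orthogonal (word_weight i l re) rt) ?mulr0 //.
by rewrite addr0 word_weight_neq0.
Qed.
End OneSide.

Lemma word_prod (F : fieldType) (g1 g2 : lieAlgType F) (I : finType)
    (e1 : I -> g1) (e2 : I -> g2) i l :
  word (fun i => (e1 i, e2 i) : (g1 * g2)%type) i l = (word e1 i l, word e2 i l).
Proof. by elim: l => //= j l ->. Qed.

Lemma word_span_prod (F : fieldType) (g1 g2 : lieAlgType F) (I : finType)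
    (e1 : I -> g1) (e2 : I -> g2) z :
  word_span (fun i => (e1 i, e2 i) : (g1 * g2)%type) z ->
  word_span e1 z.1 /\ word_span e2 z.2.
Proof.
elim=> [|c i l u _ [IH1 IH2]]; first by split; exact: word_span0.
by rewrite word_prod; split; apply: word_spanD.
Qed.

Section SameCartanMatrix.
Variables (R : realType) (g1 g2 : lieAlgType R[i]) (h1 : {vspace g1}) (h2 : {vspace g2}).
Local Notation C := R[i].
Hypotheses (simple_g1 : lie_simple g1) (hP1 : cartan_subalgebra h1).
Hypotheses (simple_g2 : lie_simple g2) (hP2 : cartan_subalgebra h2).
Local Notation crt1 := (coroot simple_g1 hP1).
Local Notation crt2 := (coroot simple_g2 hP2).
Variables (I : finType) (al1 : I -> dual h1) (al2 : I -> dual h2).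
Hypotheses (alP1 : simple_family al1) (alP2 : simple_family al2).
Hypothesis cartanE : forall i j,
  al1 j (crt1 (al1 i)) = al2 j (crt2 (al2 i)) :> C.
Variables (e1 f1 : I -> g1) (e2 f2 : I -> g2).
Hypotheses (ef1 : chevalley simple_g1 hP1 al1 e1 f1).
Hypotheses (ef2 : chevalley simple_g2 hP2 al2 e2 f2).

Let e i : (g1 * g2)%type := (e1 i, e2 i).
Let f i : (g1 * g2)%type := (f1 i, f2 i).
Let t i : (g1 * g2)%type := (vsval (crt1 (al1 i)), vsval (crt2 (al2 i))).

Lemma chevalley_relations_prod :
  chevalley_relations (fun i j => al1 j (crt1 (al1 i)) : C) e f t.
Proof.
have pairE (x1 y1 : g1) (x2 y2 : g2) :
    lie ((x1, x2) : (g1 * g2)%type) (y1, y2) = (lie x1 y1, lie x2 y2) by [].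
split=> i j; rewrite /t /e /f pairE.
- have [->|ij] := eqVneq i j; first by rewrite (ch_ef ef1) (ch_ef ef2).
  by rewrite (chevalley_e_f alP1 ef1) // (chevalley_e_f alP2 ef2).
- by rewrite (ch_e ef1) (ch_e ef2) -cartanE.
- by rewrite (ch_f ef1) (ch_f ef2) !opp_lfunE -cartanE.
- by rewrite (cartan_abelian hP1) ?subvsP // (cartan_abelian hP2) ?subvsP.
Qed.

Local Notation D := (generated e f).

Lemma generated_onto1 x : exists y, D (x, y).
Proof.
move: x; apply: (chevalley_generates alP1 ef1) => [u v [u' Du] [v' Dv]|c u [u' Du]
  |u v [u' Du] [v' Dv]|i|i|].
- by exists (1 *: u' + v'); have := gen_lin 1 Du Dv; congr D; congr pair; rewrite /= scale1r.
- by exists (c *: u' + 0); have := gen_lin c Du (gen_0 e f); congr D; congr pair; rewrite /= addr0.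
- by exists (lie u' v'); exact: (gen_lie Du Dv).
- by exists (e2 i); exact: gen_e.
- by exists (f2 i); exact: gen_f.
- by exists 0; exact: gen_0.
Qed.

Lemma generated_onto2 y : exists x, D (x, y).
Proof.
move: y; apply: (chevalley_generates alP2 ef2) => [u v [u' Du] [v' Dv]|c u [u' Du]
  |u v [u' Du] [v' Dv]|i|i|].
- by exists (1 *: u' + v'); have := gen_lin 1 Du Dv; congr D; congr pair; rewrite /= scale1r.
- by exists (c *: u' + 0); have := gen_lin c Du (gen_0 e f); congr D; congr pair; rewrite /= addr0.
- by exists (lie u' v'); exact: (gen_lie Du Dv).
- by exists (e1 i); exact: gen_e.
- by exists (f1 i); exact: gen_f.
- by exists 0; exact: gen_0.
Qed.

(** In the triangular decomposition, the words have nonzero weight in each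
    factor, so that only the torus part contributes to h1 and h2. *)
Lemma generated_torus x y : D (x, y) -> x \in h1 -> y \in h2 ->
  exists c : I -> C, x = \sum_i c i *: vsval (crt1 (al1 i))
                  /\ y = \sum_i c i *: vsval (crt2 (al2 i)).
Proof.
move=> /(generated_triangular chevalley_relations_prod)[a [b [d [sa [c bE] sd E]]]] xh yh.
have [sa1 sa2] := word_span_prod sa; have [sd1 sd2] := word_span_prod sd.
have b1E : b.1 = \sum_i c i *: vsval (crt1 (al1 i)).
  by rewrite bE (big_morph (fst : (g1 * g2)%type -> g1) (id1 := 0) (op1 := +%R)).
have b2E : b.2 = \sum_i c i *: vsval (crt2 (al2 i)).
  by rewrite bE (big_morph (snd : (g1 * g2)%type -> g2) (id1 := 0) (op1 := +%R)).
exists c; rewrite -b1E -b2E.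
have nal1 := simple_familyN simple_g1 hP1 alP1.
have nal2 := simple_familyN simple_g2 hP2 alP2.
have b1h : b.1 \in h1 by rewrite b1E; apply: memv_suml => i _; rewrite memvZ ?subvsP.
have b2h : b.2 \in h2 by rewrite b2E; apply: memv_suml => i _; rewrite memvZ ?subvsP.
split; apply/eqP; rewrite -subr_eq0; apply/eqP.
- apply: (killing_h_nondegenerate simple_g1 hP1) => [|u uh]; first exact: memvB.
  have := congr1 fst E; rewrite /= => ->; rewrite addrAC addrK killingDl.
  rewrite (word_span_killing simple_g1 hP1 alP1 (ch_e ef1) sd1 uh) addr0.
  exact: (word_span_killing simple_g1 hP1 nal1 (ch_f ef1) sa1 uh).
- apply: (killing_h_nondegenerate simple_g2 hP2) => [|u uh]; first exact: memvB.
  have := congr1 snd E; rewrite /= => ->; rewrite addrAC addrK killingDl.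
  rewrite (word_span_killing simple_g2 hP2 alP2 (ch_e ef2) sd2 uh) addr0.
  exact: (word_span_killing simple_g2 hP2 nal2 (ch_f ef2) sa2 uh).
Qed.

(** The x with (x, 0) in the diagonal subalgebra form an ideal.  It is not
    everything: a coroot of g1 would be paired with 0 by [generated_torus], and
    as the Cartan matrices agree all simple roots would vanish at it. *)
Lemma generated_left x : D (x, 0) -> x = 0.
Proof.
have [||u v Dv|H|H] := simple_prop_ideal simple_g1 (P := fun x => D (x, 0)).
- exact: gen_0.
- by move=> c u v Du Dv; have := gen_lin c Du Dv; congr D; congr pair; rewrite /= scaler0 addr0.
- have [u' Du] := generated_onto1 u; have := gen_lie Du Dv.
  by congr D; congr pair; rewrite /= lie0r.
- exact: H.
have [ i ] := sf_nonempty simple_g1 hP1 alP1.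
have [c [xE yE]] := generated_torus (H (vsval (crt1 (al1 i)))) (subvsP _) (mem0v _).
have E j : al1 j (crt1 (al1 i)) = 0.
  have -> : crt1 (al1 i) = \sum_k c k *: crt1 (al1 k).
    by apply/subvs_inj; rewrite xE linear_sum.
  have e0 : \sum_k c k *: crt2 (al2 k) = 0.
    by apply/subvs_inj; rewrite linear_sum; exact: esym yE.
  rewrite linear_sum -[RHS](linear0 (al2 j)) -e0 linear_sum; apply: eq_bigr => k _.
  rewrite [LHS]linearZ [RHS]linearZ; exact: (congr1 (fun z : C => c k * z) (cartanE k j)).
have := E i; rewrite coroot2; last exact: (sf_root alP1 i).
by move/eqP; rewrite -[_ == _]/((2 : C) == 0) pnatr_eq0.
Qed.

Lemma generated_right y : D (0, y) -> y = 0.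
Proof.
have [||u v Dv|H|H] := simple_prop_ideal simple_g2 (P := fun y => D (0, y)).
- exact: gen_0.
- by move=> c u v Du Dv; have := gen_lin c Du Dv; congr D; congr pair; rewrite /= scaler0 addr0.
- have [u' Du] := generated_onto2 u; have := gen_lie Du Dv.
  by congr D; congr pair; rewrite /= lie0r.
- exact: H.
have [ i ] := sf_nonempty simple_g2 hP2 alP2.
have [c [xE yE]] := generated_torus (H (vsval (crt2 (al2 i)))) (mem0v _) (subvsP _).
have E j : al2 j (crt2 (al2 i)) = 0.
  have -> : crt2 (al2 i) = \sum_k c k *: crt2 (al2 k).
    by apply/subvs_inj; rewrite yE linear_sum.
  have e0 : \sum_k c k *: crt1 (al1 k) = 0.
    by apply/subvs_inj; rewrite linear_sum; exact: esym xE.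
  rewrite linear_sum -[RHS](linear0 (al1 j)) -e0 linear_sum; apply: eq_bigr => k _.
  rewrite [LHS]linearZ [RHS]linearZ; exact: (congr1 (fun z : C => c k * z) (esym (cartanE k j))).
have := E i; rewrite coroot2; last exact: (sf_root alP2 i).
by move/eqP; rewrite -[_ == _]/((2 : C) == 0) pnatr_eq0.
Qed.

(** The subalgebra generated by the pairs (e1 i, e2 i) and (f1 i, f2 i) is the
    graph of an isomorphism. *)
Theorem same_cartan_matrix_isomorphic : lie_isomorphic g1 g2.
Proof.
have /choice[phi phiP] := generated_onto1.
have /choice[psi psiP] := generated_onto2.
have uniq2 x y y' : D (x, y) -> D (x, y') -> y = y'.
  move=> Dy Dy'; apply/esym/eqP; rewrite -subr_eq0; apply/eqP/generated_right.
  have := gen_lin (-1) Dy Dy'; congr D; congr pair; rewrite /= scaleN1r.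
    by rewrite addNr.
  by rewrite addrC.
have uniq1 x x' y : D (x, y) -> D (x', y) -> x = x'.
  move=> Dx Dx'; apply/esym/eqP; rewrite -subr_eq0; apply/eqP/generated_left.
  have := gen_lin (-1) Dx Dx'; congr D; congr pair; rewrite /= scaleN1r.
    by rewrite addrC.
  by rewrite addNr.
have philin : linear phi.
  move=> c u v; apply: uniq2 (phiP _) _; exact: (gen_lin c (phiP u) (phiP v)).
exists (HB.pack_for {linear g1 -> g2} phi (GRing.isLinear.Build C g1 g2 *:%R phi philin)).
  exists psi => [x|y] /=.
    exact: uniq1 (psiP _) (phiP x).
  exact: uniq2 (phiP _) (psiP y).
by move=> x y /=; apply: uniq2 (phiP _) _; exact: (gen_lie (phiP x) (phiP y)).
Qed.
End SameCartanMatrix.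

(** * Polynomial functions and exponential automorphisms *)

Section PolynomialFunctions.
Variables (F : fieldType) (V : vectType F).

(** Polynomial functions in the values of linear forms: closed under all the
    operations below, without reference to coordinates. *)
Inductive polyfun : (V -> F) -> Prop :=
| polyfun_const c : polyfun (fun _ => c)
| polyfun_lin (L : 'Hom(V, F^o)) : polyfun (fun v => L v)
| polyfun_add Q1 Q2 : polyfun Q1 -> polyfun Q2 -> polyfun (fun v => Q1 v + Q2 v)
| polyfun_mul Q1 Q2 : polyfun Q1 -> polyfun Q2 -> polyfun (fun v => Q1 v * Q2 v).

Lemma polyfun_sum (I : Type) (r : seq I) (P : pred I) (Q : I -> V -> F) :
  (forall i, polyfun (Q i)) -> polyfun (fun v => \sum_(i <- r | P i) Q i v).
Proof.
move=> QP; elim: r => [|i r IH].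
  rewrite (_ : (fun _ => _) = fun _ => 0); first exact: polyfun_const.
  by apply/funext => v; rewrite big_nil.
rewrite (_ : (fun _ => _) =
  if P i then fun v => Q i v + \sum_(i <- r | P i) Q i v else fun v => \sum_(i <- r | P i) Q i v).
  by case: ifP => _ //; apply: polyfun_add.
by apply/funext => v; rewrite big_cons; case: ifP.
Qed.

Lemma polyfun_prod (I : Type) (r : seq I) (Q : I -> V -> F) :
  (forall i, polyfun (Q i)) -> polyfun (fun v => \prod_(i <- r) Q i v).
Proof.
move=> QP; elim: r => [|i r IH].
  rewrite (_ : (fun _ => _) = fun _ => 1); first exact: polyfun_const.
  by apply/funext => v; rewrite big_nil.
rewrite (_ : (fun _ => _) = fun v => Q i v * \prod_(i <- r) Q i v).
  exact: polyfun_mul.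
by apply/funext => v; rewrite big_cons.
Qed.

(** dQ is the differential of Q, computed along straight lines. *)
Definition differential (Q : V -> F) (dQ : V -> V -> F) :=
  [/\ forall v, polyfun (dQ^~ v),
      forall z c u v, dQ z (c *: u + v) = c * dQ z u + dQ z v
    & forall z v, exists p : {poly F}, (forall s, p.[s] = Q (z + s *: v)) /\ p`_1 = dQ z v].

Lemma polyfun_differential Q : polyfun Q -> exists dQ, differential Q dQ.
Proof.
elim=> [c|L|Q1 Q2 P1 [d1 [p1 l1 c1]] P2 [d2 [p2 l2 c2]]|Q1 Q2 P1 [d1 [p1 l1 c1]] P2 [d2 [p2 l2 c2]]].
- exists (fun _ _ => 0); split=> [v|z d u v|z v]; first exact: polyfun_const.
    by rewrite mulr0 addr0.
  by exists c%:P; rewrite coefC; split=> // s; rewrite hornerC.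
- exists (fun _ v => L v); split=> [v|z d u v|z v]; first exact: polyfun_const.
    by rewrite linearD linearZ.
  exists ((L z)%:P + L v *: 'X); split=> [s|].
    by rewrite !hornerE mulrC linearD linearZ.
  by rewrite coefD coefC coefZ coefX mulr1 add0r.
- exists (fun z v => d1 z v + d2 z v); split=> [v|z d u v|z v]; first exact: polyfun_add.
    by rewrite l1 l2 mulrDr addrACA.
  have [q1 [h1 e1]] := c1 z v; have [q2 [h2 e2]] := c2 z v.
  exists (q1 + q2); split=> [s|]; first by rewrite hornerD h1 h2.
  by rewrite coefD e1 e2.
- exists (fun z v => Q1 z * d2 z v + d1 z v * Q2 z); split=> [v|z d u v|z v].
  + by apply: polyfun_add; apply: polyfun_mul.
  + by rewrite l1 l2; ring.
  have [q1 [h1 e1]] := c1 z v; have [q2 [h2 e2]] := c2 z v.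
  exists (q1 * q2); split=> [s|]; first by rewrite hornerM h1 h2.
  rewrite coefM big_ord_recl big_ord1 /= e1 e2 -!horner_coef0 h1 h2.
  by rewrite !scale0r !addr0.
Qed.
End PolynomialFunctions.

Lemma poly_zero_on_nat (F : numFieldType) (p : {poly F}) : (forall s, p.[s] = 0) -> p = 0.
Proof.
move=> p0; apply/eqP; apply: contraT => pn0.
have /(max_poly_roots pn0) : all (root p) [seq i%:R | i <- iota 0 (size p)].
  by apply/allP => s _; rewrite /root p0.
rewrite map_inj_uniq ?iota_uniq; last by move=> i j /eqP; rewrite eqr_nat => /eqP.
by rewrite size_map size_iota ltnn => /(_ isT).
Qed.

Section LieAutomorphisms.
Variables (F : numFieldType) (g : lieAlgType F).

Definition lie_automorphism (sg : 'End(g)) :=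
  {morph sg : x y / lie x y} /\ (forall y, exists x, sg x = y).

Lemma lie_automorphism_id : lie_automorphism \1%VF.
Proof. by split=> [x y|y]; [rewrite !id_lfunE|exists y; rewrite id_lfunE]. Qed.

Lemma lie_automorphism_comp sg ta :
  lie_automorphism sg -> lie_automorphism ta -> lie_automorphism (sg \o ta)%VF.
Proof.
move=> [sM sS] [tM tS]; split=> [x y|y]; first by rewrite !comp_lfunE tM sM.
by have [x <-] := sS y; have [z <-] := tS x; exists z; rewrite comp_lfunE.
Qed.

Section Exp.
Variables (u : g) (N : nat).
Hypothesis uN : forall x, iter N (lie u) x = 0.

Let dp k x : g := (k`!%:R)^-1 *: iter k (lie u) x.

Let dp_lin k : linear (dp k).
Proof.
move=> c x y; rewrite /dp; have it z : iter k (lie u) z = iter k (ad u) z.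
  by elim: k => //= k ->; rewrite adE.
by rewrite !it iter_lin scalerDr !scalerA [c * _]mulrC.
Qed.

Let dp_ge k x : (N <= k)%N -> dp k x = 0.
Proof.
move=> Nk; rewrite /dp -(subnK Nk) iterD uN.
by rewrite (_ : iter _ _ 0 = 0) ?scaler0 //; elim: (k - N)%N => //= m ->; rewrite lie0r.
Qed.

Let dpS k x : k.+1%:R *: dp k.+1 x = lie u (dp k x).
Proof.
rewrite /dp lieZr -iterS scalerA factS natrM invfM mulrA divff ?mul1r //.
by rewrite pnatr_eq0.
Qed.

Let leibniz k x y : dp k (lie x y) = \sum_(i < k.+1) lie (dp i x) (dp (k - i) y).
Proof.
elim: k => [|k IH].
  by rewrite big_ord1 /dp /= invr1 !scale1r.
have k0 : (k.+1%:R : F) != 0 by rewrite pnatr_eq0.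
apply: (scalerI k0); rewrite dpS IH lie_sumr scaler_sumr.
under eq_bigr => i _ do rewrite lieJ -!dpS lieZl lieZr.
rewrite big_split /= [in RHS](eq_bigr (fun i : 'I_k.+2 =>
  i%:R *: lie (dp i x) (dp (k.+1 - i) y) + (k.+1 - i)%:R *: lie (dp i x) (dp (k.+1 - i) y))).
  rewrite big_split /=; congr (_ + _).
    rewrite [RHS]big_ord_recl scale0r add0r; apply: eq_bigr => i _.
    by rewrite /bump /= ?add1n subSS; congr (_ *: _).
  rewrite [RHS]big_ord_recr /= subnn scale0r addr0; apply: eq_bigr => i _.
  by rewrite subSn // -ltnS ltn_ord.
by move=> i _; rewrite -scalerDl -natrD subnKC // -ltnS ltn_ord.
Qed.

(** The exponential series of ad u, truncated at an order N where it
    vanishes. *)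
Definition exp_ad_fun x : g := \sum_(k < N) dp k x.

Lemma exp_ad_fun_linear : linear exp_ad_fun.
Proof.
move=> c x y; rewrite /exp_ad_fun scaler_sumr -big_split.
by apply: eq_bigr => k _; rewrite /= dp_lin.
Qed.

Definition exp_ad : 'End(g) := linfun (HB.pack_for {linear g -> g} exp_ad_fun
  (GRing.isLinear.Build F g g *:%R exp_ad_fun exp_ad_fun_linear)).

Lemma exp_adE x : exp_ad x = \sum_(k < N) (k`!%:R)^-1 *: iter k (lie u) x.
Proof. by rewrite lfunE. Qed.

(** The binomial form of the Leibniz rule, for divided powers of ad u; the sum
    over pairs of exponents below N is compared with the triangle of those of
    sum below 2 N. *)
Lemma exp_ad_lie : {morph exp_ad : x y / lie x y}.
Proof.
move=> x y; rewrite !lfunE /= /exp_ad_fun.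
pose T i j := lie (dp i x) (dp j y).
have widen (M : nat) : (N <= M)%N ->
    \sum_(k < N) dp k (lie x y) = \sum_(0 <= k < M) dp k (lie x y).
  move=> NM; rewrite -(big_mkord xpredT (fun k => dp k (lie x y))).
  rewrite [RHS](big_cat_nat (n := N)) //= [X in _ + X]big_nat_cond [X in _ + X]big1 ?addr0 // => k.
  by rewrite andbT => /andP[Nk _]; exact: dp_ge.
rewrite (widen (N + N)%N) ?leq_addr //.
transitivity (\sum_(0 <= k < N + N) \sum_(0 <= i < N + N | (i <= k)%N) T i (k - i)%N).
  apply: eq_big_nat => k /andP[_ kN]; rewrite leibniz.
  rewrite -(big_mkord xpredT (fun i => T i (k - i)%N)).
  by rewrite (big_nat_widen _ _ (N + N)) //.
rewrite (exchange_big_dep_nat xpredT) //=.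
rewrite lie_suml -(big_mkord xpredT (fun i => lie (dp i x) (\sum_(k < N) dp k y))).
rewrite (big_cat_nat (n := N)) ?leq_addr //= [X in _ + X]big_nat_cond [X in _ + X]big1 ?addr0; last first.
  by move=> i /andP[/andP[Ni _] _]; apply: big1 => k _; rewrite /T dp_ge // lie0l.
apply: eq_big_nat => i /andP[_ iN]; rewrite lie_sumr.
rewrite -(big_mkord xpredT (fun k => lie (dp i x) (dp k y))) -/(T i).
transitivity (\sum_(i <= k < N + N) T i (k - i)%N).
  by rewrite [RHS](big_nat_widenl i 0) //=; apply: eq_bigl => k.
rewrite -[X in \sum_(X <= _ < _) _]add0n big_addn (big_cat_nat (n := N)) //=; last by lia.
rewrite [X in _ + X]big_nat_cond [X in _ + X]big1 ?addr0; last first.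
  by move=> k /andP[/andP[Nk _] _]; rewrite addnK /T [dp k y]dp_ge // lie0r.
by apply: eq_big_nat => k _; rewrite addnK.
Qed.
End Exp.
End LieAutomorphisms.

(** * Density of the conjugates of regular elements *)

Section Density.
Variables (R : realType) (g : lieAlgType R[i]) (h : {vspace g}).
Hypotheses (simple_g : lie_simple g) (hP : cartan_subalgebra h).
Local Notation C := R[i].
Local Notation n := (\dim {:g}).

Lemma root_vector_nilpotent (mu : dual h) (x : g) : mu != 0 -> in_root_space mu x ->
  exists N, forall v, iter N (lie x) v = 0.
Proof.
move=> mu0 rx; have [b [w [bb wP]]] := exists_weight_basis hP.
have /choice[k kP] (i : 'I_n) : exists k, iter k (lie x) b`_i = 0.
  exact: (rsp_nilpotent hP mu0 rx (wP i)).
have itE N v : iter N (lie x) v = iter N (ad x) v.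
  by elim: N => //= N ->; rewrite adE.
pose N := (\max_i k i)%N; exists N => v; rewrite [v](coord_basis bb (memvf v)) itE.
elim/big_ind: _ => [|u1 u2 e1 e2|i _]; first exact: iter_lin0.
  by rewrite iter_linD e1 e2 addr0.
rewrite iter_linZ.
by rewrite (iter_lin_le (leq_bigmax i : (k i <= N)%N)) ?scaler0 // -itE.
Qed.

(** With u = - x / mu y, [u, y] = x and [u, x] = 0, so that the exponential of
    ad u stops after two terms.  Its kernel is an ideal that is not everything. *)
Lemma lie_automorphism_shift (mu : dual h) (y : subvs_of h) (x : g) :
  mu y != 0 :> C -> in_root_space mu x ->
  exists2 sg, lie_automorphism sg & sg (vsval y) = vsval y + x.
Proof.
move=> muy rx; pose u := - (mu y : C)^-1 *: x.
have mu0 : mu != 0 by apply: contraNneq muy => ->; rewrite zero_lfunE.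
have ru : in_root_space mu u by exact: rspZ.
have [N uN] := root_vector_nilpotent mu0 ru.
have uy : lie u (vsval y) = x.
  by rewrite lieC ru scalerA mulrN mulfV // scaleN1r opprK.
have uuy : lie u x = 0 by rewrite lieZl liexx scaler0.
have uN2 v : iter N.+2 (lie u) v = 0 by rewrite 2!iterS uN !lie0r.
have it m : iter m.+2 (lie u) (vsval y) = 0.
  by rewrite 2!iterSr uy uuy; elim: m => //= m ->; rewrite lie0r.
have sgy : exp_ad u N.+2 (vsval y) = vsval y + x.
  rewrite exp_adE 2!big_ord_recl /= uy invr1 !scale1r big1 ?addr0 // => k _.
  by rewrite -[X in _ *: X]/(iter k.+2 (lie u) (vsval y)) it scaler0.
exists (exp_ad u N.+2) => //; split; first exact: exp_ad_lie uN2.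
have kerI : lie_ideal (lker (exp_ad u N.+2)).
  by move=> z v; rewrite !memv_ker (exp_ad_lie uN2) => /eqP->; rewrite lie0r.
have [k0|kT] := simple_g.2 _ kerI; last first.
  have yx : vsval y + x = 0 by apply/eqP; rewrite -sgy -memv_ker kT memvf.
  have : lie (vsval y) (vsval y + x) = 0 by rewrite yx lie0r.
  rewrite lieDr liexx add0r rx => /eqP; rewrite scaler_eq0 (negbTE muy) /= => /eqP x0.
  move: yx; rewrite x0 addr0 => y0.
  by case/negP: muy; rewrite (_ : y = 0) ?linear0 //; apply/val_inj; exact: etrans y0 (esym (linear0 vsval)).
move=> z; have /lker0_lfunVK inv : lker (exp_ad u N.+2) == 0%VS by rewrite k0.
by exists ((exp_ad u N.+2)^-1%VF z).
Qed.

Definition regular (y : subvs_of h) := forall mu : dual h, is_root mu -> mu y != 0 :> C.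

(** The class of polynomial functions that vanish on all translates of regular
    elements of h; [vanishes_everywhere] shows that it is zero, which is the
    density of these translates. *)
Definition vanishes_on_conjugates (Q : g -> C) :=
  polyfun Q /\ forall sg y, lie_automorphism sg -> regular y -> Q (sg (vsval y)) = 0.

(** On the line from a good point for the last functionals in a good direction
    for the first one, the product of all is a nonzero polynomial. *)
Lemma common_nonzero (V : vectType C) (s : seq 'Hom(V, C^o)) :
  all (fun mu => mu != 0) s -> exists y, all (fun mu : 'Hom(V, C^o) => mu y != 0) s.
Proof.
elim: s => [|mu s IH] /=; first by exists 0.
case/andP=> mu0 /IH[y ys].
have [v muv] : exists v, mu v != 0.
  by apply: contrapT => H; case/negP: mu0; apply/eqP/lfunP => v; rewrite zero_lfunE;
     apply/eqP; apply: contrapT => /negP e; apply: H; exists v.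
pose p : {poly C} := \prod_(la <- mu :: s) ((la y : C)%:P + (la v : C) *: 'X).
have p0 : p != 0.
  rewrite prodf_seq_neq0; apply/allP => la; rewrite inE => /orP[/eqP->|las] /=.
    apply: contraNneq muv => /(congr1 (coefp 1)); rewrite /coefp /=.
    by rewrite coefD coefC coefZ coefX mulr1 add0r coef0 => ->.
  apply: contraTneq (allP ys _ las) => /(congr1 (coefp 0)); rewrite /coefp /=.
  by rewrite coefD coefC coefZ coefX mulr0 addr0 coef0 => ->; rewrite eqxx.
have [s0 ps0] : exists s0, p.[s0] != 0.
  apply: contrapT => H; case/negP: p0; apply/eqP/poly_zero_on_nat => s0.
  by apply/eqP; apply: contrapT => /negP e; apply: H; exists s0.
exists (y + s0 *: v); have : all (fun la : 'Hom(V, C^o) => la (y + s0 *: v) != 0) (mu :: s).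
  apply/allP => la las; move: ps0; rewrite horner_prod prodf_seq_neq0 => /allP/(_ _ las) /=.
  by rewrite !hornerE linearD linearZ /= mulrC.
by [].
Qed.

Lemma exists_regular : exists y, regular y.
Proof.
have [b [w [bb wP]]] := exists_weight_basis hP.
have [y /allP ys] := @common_nonzero _ [seq mu <- codom w | mu != 0] (filter_all _ _).
exists y => mu /is_root_weight[mu0 /(is_weightP bb wP)[i wi]].
by apply: ys; rewrite mem_filter mu0 -wi codom_f.
Qed.

(** The tangent space at a regular y is spanned by h, along which y moves to
    other regular elements, and by the root spaces, along which y moves by
    automorphisms ([lie_automorphism_shift]). *)
Lemma vanishes_differential Q dQ v : vanishes_on_conjugates Q -> differential Q dQ ->
  vanishes_on_conjugates (dQ^~ v).
Proof.
move=> [_ Q0] [dP dl dc]; split=> [|sg y sgA yr]; first exact: dP.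
have [v' <-] := sgA.2 v; have sA := sgA; move: v'; apply: (rsp_prop hP).
- move=> u1 u2 e1 e2; have -> : sg (u1 + u2) = 1 *: sg u1 + sg u2 by rewrite scale1r linearD.
  by rewrite dl e1 e2 mulr0 addr0.
- have d0 z : dQ z 0 = 0.
    by have := dl z 1 0 0; rewrite scale1r addr0 mul1r => /eqP; rewrite -subr_eq subrr eq_sym => /eqP.
  move=> c u e; have -> : sg (c *: u) = c *: sg u + 0 by rewrite addr0 linearZ.
  by rewrite dl e d0 mulr0 addr0.
- rewrite linear0; have := dl (sg (vsval y)) 1 0 0; rewrite scale1r addr0 mul1r => /eqP.
  by rewrite -subr_eq subrr eq_sym => /eqP.
move=> mu x rx; have [p [pE <-]] := dc (sg (vsval y)) (sg x).
suff -> : p = 0 by rewrite coef0.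
(* Off h, the curve stays in one orbit of automorphisms; on h, it consists of
   regular elements except at the zeros of r, which the factor r removes. *)
have [mu0|mu0] := eqVneq mu 0; last first.
  have [xz|x0] := eqVneq x 0.
    apply: poly_zero_on_nat => s; rewrite pE xz linear0 scaler0 addr0; exact: Q0.
  have muy : mu y != 0 :> C by apply: yr; split=> //; exists x.
  apply: poly_zero_on_nat => s; rewrite pE.
  have -> : sg (vsval y) + s *: sg x = sg (vsval y + s *: x) by rewrite linearD linearZ.
  have [ta taA <-] := lie_automorphism_shift muy (rspZ s rx).
  rewrite -comp_lfunE; apply: Q0 => //; exact: lie_automorphism_comp.
have xh : x \in h by apply/(rsp0P simple_g hP); rewrite -mu0.
pose x' := vsproj h x; have x'E : vsval x' = x by rewrite vsprojK.
have [b [w [bb wP]]] := exists_weight_basis hP.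
pose r : {poly C} := \prod_(i | w i != 0) ((w i y : C)%:P + (w i x' : C) *: 'X).
have r0 : r != 0.
  apply/prodf_neq0 => i wi0.
  have : w i y != 0 :> C by apply: yr; apply/is_root_weight; split=> //; apply/(is_weightP bb wP); exists i.
  apply: contraNneq => /(congr1 (coefp 0)); rewrite /coefp /=.
  by rewrite coefD coefC coefZ coefX mulr0 addr0 coef0 => ->.
have : p * r = 0.
  apply: poly_zero_on_nat => s; rewrite hornerM; have [->|rs] := eqVneq r.[s] 0; first by rewrite mulr0.
  have -> : p.[s] = Q (sg (vsval (y + s *: x'))) by rewrite pE -x'E !linearD !linearZ.
  rewrite Q0 ?mul0r //.
  move=> la /is_root_weight[la0 /(is_weightP bb wP)[i wi]].
  move: rs; rewrite horner_prod => /prodf_neq0/(_ i); rewrite wi => /(_ la0).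
  by rewrite !hornerE linearD linearZ /= mulrC.
by move/eqP; rewrite mulf_eq0 (negbTE r0) orbF => /eqP.
Qed.

(** All derivatives vanish at a regular point, by [vanishes_differential]. *)
Lemma vanishes_everywhere Q : vanishes_on_conjugates Q -> forall z, Q z = 0.
Proof.
have [y yr] := exists_regular.
suff key k : forall Q p v, vanishes_on_conjugates Q ->
    (forall s : C, p.[s] = Q (vsval y + s *: v)) -> p`_k = 0.
  move=> QV z; have [dQ [_ _ dc]] := polyfun_differential QV.1.
  have [p [pE _]] := dc (vsval y) (z - vsval y).
  have := pE 1; rewrite scale1r addrC subrK => <-.
  rewrite horner_coef big1 // => i _; rewrite (key _ Q _ (z - vsval y)) ?mul0r //.
elim: k => [|k IH] {}Q p v QV pE.
  by rewrite -horner_coef0 pE scale0r addr0 -[vsval y](id_lfunE (vsval y)); apply: QV.2;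
    first exact: lie_automorphism_id.
have [dQ dP] := polyfun_differential QV.1.
have [_ _ dc] := dP.
have dE s : p^`().[s] = dQ (vsval y + s *: v) v.
  have [q [qE <-]] := dc (vsval y + s *: v) v.
  have -> : q = p \Po ('X + s%:P).
    apply/eqP; rewrite -subr_eq0; apply/eqP/poly_zero_on_nat => t.
    rewrite !hornerE horner_comp !hornerE qE pE scalerDl -addrA [s *: v + _]addrC.
    by rewrite subrr.
  rewrite -[RHS](_ : (p \Po ('X + s%:P))^`()`_0 = _); last by rewrite coef_deriv mulr1n.
  rewrite deriv_comp derivD derivX derivC addr0 mulr1 -horner_coef0 horner_comp !hornerE.
  by rewrite ?add0r.
have /eqP := IH _ _ v (vanishes_differential v QV dP) dE.
by rewrite coef_deriv -[_ *+ _]mulr_natr mulf_eq0 pnatr_eq0 orbF => /eqP.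
Qed.

End Density.

(** * Spectra of diagonalizable elements *)

Section CharacteristicPolynomial.
Variables (F : fieldType) (V : vectType F).
Local Notation n := (\dim {:V}).
Local Notation e := (vbasis {:V}).

Definition lchar (f : 'End(V)) : {poly F} := char_poly (mxof e e f).

Lemma lchar_eigenbasis (b : n.-tuple V) (la : 'I_n -> F) (f : 'End(V)) :
  basis_of fullv b -> (forall i : 'I_n, f b`_i = la i *: b`_i) ->
  lchar f = \prod_i ('X - (la i)%:P).
Proof.
move=> bb fb; have eb := vbasisP {:V}.
set P := mxof e b \1; set Q := mxof b e (\1 : 'End(V))%VF.
have PQ : P *m Q = 1%:M.
  by rewrite -(mxof_comp e e bb) comp_lfun1l mxof1 ?(basis_free eb).
have fE : mxof e e f = P *m mxof b b f *m Q.
  by rewrite -(mxof_comp e b bb) -(mxof_comp e e bb) comp_lfun1l comp_lfun1r.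
have fD i j : mxof b b f i j = (i == j)%:R * la i.
  rewrite !mxE /= vecof_delta fb linearZ /= coord_free ?(basis_free bb) //.
  by rewrite mulrC.
have <- : char_poly (mxof b b f) = \prod_i ('X - (la i)%:P).
  rewrite char_poly_trig; last first.
    apply/is_trig_mxP => i j ij; rewrite fD.
    by rewrite (_ : (i == j) = false) ?mul0r //; apply/negbTE; rewrite neq_ltn ij.
  by apply: eq_bigr => i _; rewrite fD eqxx mul1r.
pose mp := map_mx (@polyC F).
rewrite /lchar /char_poly /char_poly_mx fE !map_mxM /=.
have <- : mp _ _ P *m ('X%:M - mp _ _ (mxof b b f)) *m mp _ _ Q
          = 'X%:M - mp _ _ P *m mp _ _ (mxof b b f) *m mp _ _ Q.
  by rewrite mulmxBr mulmxBl scalar_mxC -(mulmxA _ (mp _ _ P)) -(map_mxM _ P) PQ map_mx1 mulmx1.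
rewrite !det_mulmx mulrAC -det_mulmx -(map_mxM _ P) PQ map_mx1 det1 mul1r //.
Qed.

Definition coefs_polyfun (U : vectType F) (p : U -> {poly F}) :=
  forall k, polyfun (fun v => (p v)`_k).

Lemma coefs_polyfun_mul (U : vectType F) (p q : U -> {poly F}) :
  coefs_polyfun p -> coefs_polyfun q -> coefs_polyfun (fun v => p v * q v).
Proof.
move=> pP qP k; rewrite (_ : (fun _ => _) = fun v => \sum_(j < k.+1) (p v)`_j * (q v)`_(k - j)).
  by apply: polyfun_sum => j; apply: polyfun_mul.
by apply/funext => v; rewrite coefM.
Qed.

Lemma coefs_polyfun_const (U : vectType F) (p : {poly F}) :
  coefs_polyfun (fun _ : U => p).
Proof. by move=> k; apply: polyfun_const. Qed.

Lemma coefs_polyfun_prod (U : vectType F) (I : Type) (r : seq I) (p : I -> U -> {poly F}) :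
  (forall i, coefs_polyfun (p i)) -> coefs_polyfun (fun v => \prod_(i <- r) p i v).
Proof.
move=> pP; elim: r => [|i r IH].
  by rewrite (_ : (fun _ => _) = fun _ => 1);
    [exact: coefs_polyfun_const | apply/funext => v; rewrite big_nil].
rewrite (_ : (fun _ => _) = fun v => p i v * \prod_(i <- r) p i v).
  exact: coefs_polyfun_mul.
by apply/funext => v; rewrite big_cons.
Qed.

Lemma lchar_polyfun (U : vectType F) (f : {linear U -> 'End(V)}) :
  coefs_polyfun (fun u => lchar (f u)).
Proof.
move=> k.
rewrite (_ : (fun _ => _) = fun u => \sum_(s : 'S_n) ((-1) ^+ s *
    \prod_i (('X *+ (i == s i)) - (mxof e e (f u) i (s i))%:P))`_k); last first.
  apply/funext => u; rewrite /lchar /char_poly /determinant coef_sum.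
  by apply: eq_bigr => s _; congr (nth 0 (polyseq (_ * _)) k); apply: eq_bigr => i _; rewrite !mxE.
apply: polyfun_sum => s; move: k; apply: coefs_polyfun_mul; first exact: coefs_polyfun_const.
apply: coefs_polyfun_prod => i k.
have Llin : linear (fun u => mxof e e (f u) i (s i) : F^o).
  by move=> c u v; rewrite !linearP /= !mxE.
pose L := linfun (HB.pack_for {linear U -> F^o} (fun u => mxof e e (f u) i (s i) : F^o)
     (GRing.isLinear.Build F U F^o *:%R _ Llin)).
rewrite (_ : (fun _ => _) = fun u => ('X *+ (i == s i))`_k + (- (k == 0)%:R) * L u).
  apply: polyfun_add; first exact: polyfun_const.
  by apply: polyfun_mul; [exact: polyfun_const | exact: polyfun_lin].
apply/funext => u; rewrite coefB coefC lfunE /=.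
by congr (_ + _); case: (k == 0); rewrite ?mulN1r ?oppr0 ?mul0r.
Qed.
End CharacteristicPolynomial.

Section SymmetricFunctions.
Import mpoly.
Variables (F : fieldType) (V U : vectType F) (f : {linear U -> 'End(V)}).
Local Notation n := (\dim {:V}).

(** The fundamental theorem on symmetric polynomials: elementary symmetric
    functions of the eigenvalues are coefficients of the characteristic
    polynomial. *)
Lemma symmetric_polyfun (p : mpoly n F) : p \is symmetric ->
  exists2 Q : U -> F, polyfun Q & forall u (la : 'I_n -> F),
    lchar (f u) = \prod_i ('X - (la i)%:P) -> Q u = p.@[la].
Proof.
case/sym_fundamental => t [tE _].
pose s (i : 'I_n) (u : U) := (-1) ^+ i.+1 * (lchar (f u))`_(n - i.+1).
exists (fun u => t.@[fun i => s i u]).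
  rewrite (_ : (fun _ => _) = fun u => \sum_(m <- msupp t) t@_m * \prod_i \prod_(j < m i) s i u).
    apply: polyfun_sum => m; apply: polyfun_mul; first exact: polyfun_const.
    apply: polyfun_prod => i; apply: polyfun_prod => _.
    by apply: polyfun_mul; [exact: polyfun_const | exact: lchar_polyfun].
  apply/funext => u; rewrite mevalE; apply: eq_bigr => m _; congr (_ * _).
  by apply: eq_bigr => i _; rewrite prodr_const card_ord.
move=> u la laE; rewrite -tE comp_mpoly_meval; apply: meval_eq => i.
rewrite tnth_mktuple /s laE.
have lt : (i.+1 < n.+1)%N by rewrite ltnS.
have := mroots_coeff [tuple la i | i < n] (Ordinal lt).
rewrite /= big_map big_enum /= => ->; rewrite mulrA -exprD addnn -mul2n exprM sqrrN expr1n.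
by rewrite expr1n mul1r; apply: meval_eq => j; rewrite tnth_mktuple.
Qed.

(** The inner difference vanishes when the family (la i) consists of the
    combinations of the la (s j) with coefficients c; the product over all s
    makes this condition symmetric in la, hence polynomial in u. *)
Lemma spectrum_polyfun (I : finType) (c : 'I_n -> I -> F) (tau : F) :
  exists2 Q : U -> F, polyfun Q & forall u (la : 'I_n -> F),
    lchar (f u) = \prod_i ('X - (la i)%:P) ->
    Q u = \prod_(s : {ffun I -> 'I_n})
       (\prod_i (tau - \sum_j c i j * la (s j)) - \prod_i (tau - la i)).
Proof.
pose p : mpoly n F := \prod_(s : {ffun I -> 'I_n})
  (\prod_i (tau *: 1 - \sum_j c i j *: 'X_(s j)) - \prod_i (tau *: 1 - 'X_i)).
have [|Q QP QE] := @symmetric_polyfun p.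
  apply/issymP => t; rewrite /p rmorph_prod /=.
  pose act (s : {ffun I -> 'I_n}) := [ffun j => t (s j)].
  pose act' (s : {ffun I -> 'I_n}) := [ffun j => (t^-1)%g (s j)].
  have actK : cancel act act' by move=> s; apply/ffunP => j; rewrite !ffunE permK.
  have actK' : cancel act' act by move=> s; apply/ffunP => j; rewrite !ffunE permKV.
  rewrite [RHS](reindex act) /=; last by exists act' => s _; [exact: actK | exact: actK'].
  have symU i : msym t ('X_i : mpoly n F) = 'X_(t i).
    rewrite msymX; congr 'X_[_]; apply/mnmP => k; rewrite mnmE !mnm1E.
    by rewrite -(inj_eq (@perm_inj _ t)) permKV.
  apply: eq_bigr => s _; rewrite rmorphB !rmorph_prod /=; congr (_ - _).
    apply: eq_bigr => i _; rewrite rmorphB /= msymZ rmorph1 ; congr (_ - _); rewrite raddf_sum.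
    by apply: eq_bigr => j _; rewrite /= msymZ symU ffunE.
  rewrite [RHS](reindex t) /=; last by exists (t^-1)%g => k _; rewrite ?permK ?permKV.
  by apply: eq_bigr => i _; rewrite rmorphB /= msymZ rmorph1 symU.
exists Q => // u la /QE ->; rewrite /p rmorph_prod; apply: eq_bigr => s _.
rewrite rmorphB !rmorph_prod /=; congr (_ - _); apply: eq_bigr => i _.
  rewrite rmorphB /= mevalZ meval1 mulr1 ; congr (_ - _); rewrite raddf_sum.
  by apply: eq_bigr => j _; rewrite /= mevalZ mevalXU.
by rewrite rmorphB /= mevalZ meval1 mulr1 mevalXU.
Qed.
End SymmetricFunctions.

Section SimpleValues.
Variables (R : realType) (g : lieAlgType R[i]) (h : {vspace g}).
Hypotheses (simple_g : lie_simple g) (hP : cartan_subalgebra h).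
Local Notation C := R[i].
Variables (I : finType) (al : I -> dual h).
Hypothesis alP : simple_family al.

Lemma sf_card : \dim {:subvs_of h} = #|I|.
Proof.
have XE (c : 'I_#|I| -> C) : \sum_i c i *: [tuple al (enum_val i) | i < #|I|]`_i
            = \sum_i c (enum_rank i) *: al i.
  rewrite (reindex (@enum_rank I)); last by exists enum_val => i _; rewrite ?enum_rankK ?enum_valK.
  by apply: eq_bigr => i _; rewrite -(tnth_nth 0) tnth_mktuple enum_rankK.
have bX : basis_of fullv [tuple al (enum_val i) | i < #|I|].
  apply/andP; split; last first.
    apply/freeP => c; rewrite XE => /(sf_free alP) c0 i.
    by have := c0 (enum_val i); rewrite enum_valK.
  rewrite eqEsubv subvf /=; apply/subvP => mu _; have [c ->] := sf_span alP mu.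
  apply: memv_suml => i _; apply: memvZ; apply: memv_span.
  by apply/mapP; exists (enum_rank i); rewrite ?mem_enum ?enum_rankK.
rewrite -(size_basis bX) [RHS]dimvf dimvf.
by rewrite -[RHS]/(dim (subvs_of h) * 1)%N muln1.
Qed.

(** Simple roots are a basis of the dual of h, so they are coordinates. *)
Lemma sf_values (v : I -> C) : exists y : subvs_of h, forall j, al j y = v j :> C.
Proof.
pose E (y : subvs_of h) : {ffun I -> C^o} := [ffun j => al j y].
have Elin : linear E by move=> c x y; apply/ffunP => j; rewrite !ffunE linearP.
pose L := linfun (HB.pack_for {linear subvs_of h -> {ffun I -> C^o}} E
     (GRing.isLinear.Build C (subvs_of h) {ffun I -> C^o} *:%R E Elin)).
have L0 : lker L = 0%VS.
  apply/eqP; rewrite -subv0; apply/subvP => y; rewrite memv_ker memv0 lfunE /= => /eqP Ey.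
  suff e : vsval y = 0 by apply/eqP/subvs_inj; rewrite e linear0.
  apply: (h_center simple_g hP) => mu _; have [c ->] := sf_span alP mu.
  rewrite sum_lfunE big1 // => i _; move/ffunP/(_ i): Ey; rewrite !ffunE => Ey.
  by rewrite scale_lfunE Ey scaler0.
have /eqP LT : limg L == fullv.
  rewrite eqEdim subvf limg_dim_eq ?L0 ?capv0 // sf_card [X in (X <= _)%N]dimvf.
  exact: eq_leq (muln1 #|I|).
have : ([ffun j => v j] : {ffun I -> C^o}) \in limg L by rewrite LT memvf.
case/memv_imgP => y _ /ffunP e; exists y => j.
by have := e j; rewrite lfunE !ffunE.
Qed.
End SimpleValues.

Section SpectrumTransfer.
Variables (R : realType) (g : lieAlgType R[i]) (h : {vspace g}).
Hypotheses (simple_g : lie_simple g) (hP : cartan_subalgebra h).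
Local Notation C := R[i].
Local Notation n := (\dim {:g}).
Variables (b : n.-tuple g) (w : 'I_n -> dual h).
Hypotheses (bb : basis_of fullv b) (wP : forall i : 'I_n, in_root_space (w i) b`_i).
Variables (I : finType) (al : I -> dual h).
Hypothesis alP : simple_family al.

(** The condition that some family (la (s j)) generates the spectrum in the
    way the simple roots generate the weights holds on conjugates of regular
    elements of h.  So it holds for x, and the element of h at which the simple
    roots take the values la (s j) has the spectrum of x. *)
Lemma spectrum_transfer (x : g) (e : n.-tuple g) (la : 'I_n -> C) :
    basis_of fullv e -> (forall i : 'I_n, lie x e`_i = la i *: e`_i) ->
  exists y : subvs_of h, perm_eq [seq (w i y : C) | i : 'I_n] [seq la i | i : 'I_n].
Proof.
move=> eb ex.
have /choice[c cE] i : exists c : I -> C, w i = \sum_j c j *: al j.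
  exact: sf_span.
have /choice[k kE] j : exists k, w k = al j.
  by apply/(is_weightP bb wP); have /is_root_weight[] := sf_root alP j.
have adlin : linear (fun z => ad z : 'End(g)).
  by move=> d u v; rewrite adD adZ.
pose adl := HB.pack_for {linear g -> 'End(g)} (fun z => ad z : 'End(g))
     (GRing.isLinear.Build C g 'End(g) *:%R _ adlin).
pose D (s : {ffun I -> 'I_n}) : {poly C} :=
  \prod_i ('X - (\sum_j c i j * la (s j))%:P) - \prod_i ('X - (la i)%:P).
have : \prod_s D s = 0.
  apply: poly_zero_on_nat => tau.
  have [Q QP QE] := spectrum_polyfun adl c tau.
  have QV : vanishes_on_conjugates h Q.
    split=> // sg y [sgM sgS] yr.
    rewrite (QE _ (fun i => w i y)).
      rewrite (bigD1 [ffun j => k j]) //=.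
      rewrite [X in X - _](_ : _ = \prod_i (tau - w i y)) ?subrr ?mul0r //.
      apply: eq_bigr => i _; congr (_ - _); rewrite cE sum_lfunE; apply: eq_bigr => j _.
      by rewrite ffunE scale_lfunE kE.
    have sb : basis_of fullv [tuple of map sg b].
      have sgT : limg sg = fullv.
        apply/eqP; rewrite eqEsubv subvf /=; apply/subvP => z _.
        by have [z' <-] := sgS z; apply/memv_imgP; exists z'; rewrite ?memvf.
      have k0 : (fullv :&: lker sg)%VS = 0%VS.
        apply/eqP; rewrite -dimv_eq0.
        by have := limg_ker_dim sg fullv; rewrite sgT -{2}[\dim fullv]add0n => /addIn/eqP.
      by have := limg_basis_of k0 bb; rewrite sgT.
    apply: (lchar_eigenbasis sb) => i.
    rewrite (nth_map 0) ?size_tuple //= adE -sgM wP linearZ //.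
  rewrite horner_prod -(vanishes_everywhere simple_g hP QV x) (QE _ la).
    apply: eq_bigr => s _; rewrite hornerD hornerN !horner_prod; congr (_ - _).
      by apply: eq_bigr => i _; rewrite !hornerE.
    by apply: eq_bigr => i _; rewrite !hornerE.
  by apply: (lchar_eigenbasis eb) => i; rewrite adE.
move/eqP/prodf_eq0 => D0.
have [s] : exists s : {ffun I -> 'I_n}, D s == 0 by case: D0 => s _ Ds; exists s.
rewrite /D subr_eq0 => /eqP sE.
  have [y yE] := sf_values simple_g hP alP (fun j => la (s j)).
exists y; apply: prod_XsubC_eq; rewrite !big_image /= -sE.
apply: eq_bigr => i _; congr ('X - _%:P); rewrite cE sum_lfunE; apply: eq_bigr => j _.
by rewrite scale_lfunE yE.
Qed.
End SpectrumTransfer.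

(** * Transitivity of reflections on bases *)

Section Transport.
Variables (R : realType) (g1 g2 : lieAlgType R[i]) (h1 : {vspace g1}) (h2 : {vspace g2}).
Hypotheses (simple1 : lie_simple g1) (hP1 : cartan_subalgebra h1).
Hypotheses (simple2 : lie_simple g2) (hP2 : cartan_subalgebra h2).
Local Notation C := R[i].

Variable Th : dual h2 -> dual h1.
Hypotheses (Th_linear : linear Th) (Th_inj : injective Th).
Hypothesis Th_surj : forall mu, exists la, Th la = mu.
Hypothesis Th_weight : forall la, is_weight la <-> is_weight (Th la).

Let ThD la mu : Th (la + mu) = Th la + Th mu.
Proof. by have := Th_linear 1 la mu; rewrite !scale1r. Qed.

Let Th0 : Th 0 = 0.
Proof. by apply: (addrI (Th 0)); rewrite -ThD !addr0. Qed.

Let ThZ c la : Th (c *: la) = c *: Th la.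
Proof. by have := Th_linear c la 0; rewrite Th0 !addr0. Qed.

Let ThMn la m : Th (la *+ m) = Th la *+ m.
Proof. by rewrite -[la *+ m]scaler_nat ThZ scaler_nat. Qed.

Let Th_sum (I : finType) (c : I -> C) (la : I -> dual h2) :
  Th (\sum_i c i *: la i) = \sum_i c i *: Th (la i).
Proof.
by rewrite (big_morph Th ThD Th0); apply: eq_bigr => i _; rewrite ThZ.
Qed.

Let Th_root la : is_root la <-> is_root (Th la).
Proof.
have Th_eq0 : (Th la == 0) = (la == 0) by rewrite -{1}Th0 (inj_eq Th_inj).
by split=> -[la0 /Th_weight wla]; split; rewrite ?Th_eq0 // -Th_eq0.
Qed.

(** The Cartan integer of two simple roots is minus the length of a root
    string, and root strings are defined by addition alone. *)
Lemma transport_simple_family (I : finType) (al : I -> dual h2) : simple_family al ->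
  simple_family (fun i => Th (al i)) /\
  forall i j, Th (al j) (coroot simple1 hP1 (Th (al i))) = al j (coroot simple2 hP2 (al i)) :> C.
Proof.
move=> alP.
have ThP : simple_family (fun i => Th (al i)).
  split=> [i|c c0|mu|be].
  - by apply/Th_root; exact: sf_root.
  - by apply: (sf_free alP); apply: Th_inj; rewrite Th_sum c0 Th0.
  - by have [la <-] := Th_surj mu; have [c ->] := sf_span alP la; exists c; rewrite Th_sum.
  have [la <-] := Th_surj be; move=> /Th_root/(sf_sign alP)[c cE]; exists c.
  have sE : Th (\sum_i al i *+ c i) = \sum_i Th (al i) *+ c i.
    by rewrite sf_natE Th_sum; apply: eq_bigr => i _; rewrite scaler_nat.
  have ThN mu : Th (- mu) = - Th mu by rewrite -scaleN1r ThZ scaleN1r.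
  by case: cE => ->; rewrite ?ThN sE; [left|right].
split=> // i j; have [->|ij] := eqVneq i j.
  exact: etrans (coroot2 _ _ (sf_root ThP j)) (esym (coroot2 _ _ (sf_root alP j))).
have [k [-> kP kN]] := cartan_string simple2 hP2 alP ij.
have [l [-> lP lN]] := cartan_string simple1 hP1 ThP ij.
have ThE m : is_weight (Th (al j) + Th (al i) *+ m) <-> is_weight (al j + al i *+ m).
  by rewrite Th_weight ThD ThMn.
have [lk|kl|-> //] := ltngtP k l; exfalso.
  by apply: kN; apply/ThE; exact: lP.
by apply: lN; apply/ThE; exact: kP.
Qed.
End Transport.

Section WeylTransitivity.
Variables (R : realType) (g : lieAlgType R[i]) (h : {vspace g}).
Hypotheses (simple_g : lie_simple g) (hP : cartan_subalgebra h).
Local Notation C := R[i].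
Local Notation n := (\dim {:g}).
Local Notation coroot := (coroot simple_g hP).
Local Notation reflection := (reflection simple_g hP).

Definition positive (I : finType) (al : I -> dual h) (be : dual h) :=
  is_root be /\ exists c : I -> nat, be = \sum_i al i *+ c i.

Section Positive.
Variables (I : finType) (al : I -> dual h).
Hypothesis alP : simple_family al.

Lemma positive_simple i : positive al (al i).
Proof.
split; first exact: (sf_root alP).
exists (fun j => nat_of_bool (j == i)); rewrite sf_natE {1}(sf_delta al i).
by apply: eq_bigr.
Qed.

Lemma positive_or be : is_root be -> positive al be \/ positive al (- be).
Proof.
move=> rbe; have [c [] bE] := sf_sign alP rbe; first by left; split=> //; exists c.
right; split; first exact: (is_rootN simple_g hP).
by exists c; rewrite bE opprK.
Qed.

Lemma positive_not_both be : positive al be -> positive al (- be) -> False.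
Proof.
move=> [[b0 _] [c cE]] [_ [d dE]]; case/negP: b0.
have cd : \sum_i (c i + d i)%:R *: al i = \sum_i 0 *: al i.
  rewrite -sf_natE [RHS]big1 => [|i _]; last by rewrite scale0r.
  rewrite (eq_bigr (fun i => al i *+ c i + al i *+ d i)) => [|i _]; last by rewrite mulrnDr.
  by rewrite big_split /= -cE -dE subrr.
rewrite cE big1 // => i _; have /eqP := sf_coord_inj alP cd i.
by rewrite pnatr_eq0 addn_eq0 => /andP[/eqP -> _]; rewrite mulr0n.
Qed.

Lemma reflection_weightE al0 mu : is_root al0 -> is_weight mu <-> is_weight (reflection al0 mu).
Proof.
move=> r0; have H la : is_weight la -> is_weight (reflection al0 la).
  by move/(reflection_weight simple_g hP r0) => -[].
by split=> [/H //|/H]; rewrite reflectionK.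
Qed.

Lemma reflection_simple_family i :
  simple_family (fun j => reflection (al i) (al j)) /\
  forall j k, reflection (al i) (al k) (coroot (reflection (al i) (al j)))
              = al k (coroot (al j)) :> C.
Proof.
have ri := sf_root alP i.
apply: (@transport_simple_family _ g g h h simple_g hP simple_g hP (reflection (al i))).
- exact: reflection_linear.
- by apply: (can_inj (g := reflection (al i))) => x; exact: reflectionK.
- by move=> mu; exists (reflection (al i) mu); exact: reflectionK.
- by move=> la; exact: reflection_weightE.
exact: alP.
Qed.

(** Apart from al i itself, a positive root has a positive coefficient on some
    other simple root, which the reflection in al i leaves unchanged. *)
Lemma reflection_positive i be : positive al be -> be != al i ->
  positive al (reflection (al i) be).
Proof.
move=> [rbe [c cE]] bi; have ri := sf_root alP i.
have rr : is_root (reflection (al i) be) by exact: reflection_root.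
have [j ji cj] : exists2 j, j != i & c j != 0%N.
  apply: contrapT => H.
  have bE : be = al i *+ c i.
    rewrite cE (bigD1 i) //= big1 ?addr0 // => j ji.
    case: (eqVneq (c j) 0%N) => [->|cj]; first by rewrite mulr0n.
    by case: H; exists j.
  have [c1|c1|c1] := ltngtP (c i) 1.
  - by case: rbe; rewrite bE; move: c1; rewrite ltnS leqn0 => /eqP ->; rewrite mulr0n eqxx.
  - by apply: (root_no_multiple simple_g hP ri c1); rewrite -bE; exact: rbe.2.
  by case/negP: bi; rewrite bE c1 mulr1n.
split=> //; have [d dE] := sf_sign alP rr; exists d.
case: dE => // dE; exfalso.
pose m : C := be (coroot (al i)).
have E : \sum_k ((c k)%:R - (k == i)%:R * m) *: al k = \sum_k - (d k)%:R *: al k.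
  transitivity (reflection (al i) be).
    rewrite /reflection -/m {1}cE sf_natE {1}(sf_delta al i) scaler_sumr -sumrB.
    by apply: eq_bigr => k _; rewrite scalerBl scalerA mulrC.
  by rewrite dE sf_natE -sumrN; apply: eq_bigr => k _; rewrite scaleNr.
have := sf_coord_inj alP E j; rewrite (negbTE ji) mul0r subr0 => /eqP.
by rewrite -addr_eq0 -natrD pnatr_eq0 addn_eq0 (negbTE cj).
Qed.
End Positive.

Section Compare.
Variables (I J : finType) (al : I -> dual h) (ga : J -> dual h).
Hypotheses (alP : simple_family al) (gaP : simple_family ga).
Hypothesis sub : forall be, positive al be -> positive ga be.

(** Positivity decides between a root and its opposite. *)
Lemma positive_subset_eq be : positive ga be -> positive al be.
Proof.
move=> pb; case: (positive_or alP pb.1) => // /sub pNb.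
by case: (positive_not_both gaP pb pNb).
Qed.
End Compare.

(** Simple roots are indecomposable: if al i is a combination of the ga j and
    those are combinations of the al k, with natural coefficients, then some
    ga j that occurs in al i is a multiple of al i. *)
Lemma same_positive_simple (I J : finType) (al : I -> dual h) (ga : J -> dual h) :
    simple_family al -> simple_family ga ->
    (forall be, positive al be <-> positive ga be) ->
  forall i, exists j, al i = ga j.
Proof.
move=> alP gaP pE i.
have [_ [c cE]] : positive ga (al i) by apply/pE; exact: positive_simple.
have /choice[e eE] (j : J) : exists e : I -> nat, ga j = \sum_k al k *+ e k.
  by have [] : positive al (ga j) by apply/pE; exact: positive_simple.
have de k : (\sum_j c j * e j k)%N = (k == i).
  apply/eqP; rewrite -(eqr_nat C); apply/eqP.
  apply: (sf_coord_inj alP (c := fun k => (\sum_j c j * e j k)%N%:R)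
    (d := fun k => (nat_of_bool (k == i))%:R)).
  rewrite -sf_delta cE -sf_natE.
  rewrite (eq_bigr (fun j => \sum_k al k *+ (c j * e j k))) => [|j _].
    by rewrite exchange_big; apply: eq_bigr => l _; rewrite sumrMnr.
  by rewrite eE -sumrMnl; apply: eq_bigr => l _; rewrite -mulrnA mulnC.
have [j cj] : exists j, (c j * e j i != 0)%N.
  apply: contrapT => H; have := de i; rewrite big1 ?eqxx // => j _.
  by apply/eqP; apply: contrapT => /negP b; apply: H; exists j.
exists j; move: cj; rewrite muln_eq0 negb_or => /andP[cj ej].
have e0 k : k != i -> e j k = 0%N.
  move=> ki; apply/eqP; have /eqP := de k; rewrite (negbTE ki) sum_nat_eq0.
  by move/forallP/(_ j); rewrite /= muln_eq0 (negbTE cj).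
have e1 : e j i = 1%N.
  apply/eqP; rewrite eqn_leq [(0 < _)%N]lt0n ej andbT.
  have := de i; rewrite eqxx (bigD1 j) //=; move: cj ej; nia.
rewrite eE (bigD1 i) //= e1 mulr1n big1 ?addr0 // => k /e0 ->.
by rewrite mulr0n.
Qed.

(** Induction on the number of roots that are positive for al and negative for
    ga.  If there are any, some simple ga j is negative for al; reflecting ga in
    ga j changes the sign of the roots +ga j and -ga j only, and lowers the
    number. *)
Lemma weyl_transitive (I J : finType) (al : I -> dual h) (ga : J -> dual h) :
    simple_family al -> simple_family ga ->
  exists2 s : J -> I, bijective s &
    forall i j, ga j (coroot (ga i)) = al (s j) (coroot (al (s i))) :> C.
Proof.
move=> alP.
have [b [w [bb wP]]] := exists_weight_basis hP.
pose bad (ga : J -> dual h) := [set i | `[< positive al (w i) /\ positive ga (- w i) >] ].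
have [m] := ubnP #|bad ga|; elim: m => // m IH in ga *; rewrite ltnS => bm gaP.
(* If every simple ga j is positive for al, the positive roots agree, and so do
   the simple ones. *)
have [allp|] := pselect (forall j, positive al (ga j)).
  have sub be : positive ga be -> positive al be.
    move=> [rb [c cE]]; split=> //.
    have /choice[e eE] (j : J) : exists e : I -> nat, ga j = \sum_k al k *+ e k.
      by have [] := allp j.
    exists (fun k => \sum_j e j k * c j)%N; rewrite cE.
    rewrite (eq_bigr (fun j => \sum_k al k *+ (e j k * c j))) => [|j _].
      by rewrite exchange_big; apply: eq_bigr => l _; rewrite sumrMnr.
    by rewrite {1}eE -sumrMnl; apply: eq_bigr => l _; rewrite mulrnA.
  have pE be : positive ga be <-> positive al be.
    by split; [exact: sub | exact: (positive_subset_eq gaP alP sub)].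
  have /choice[s sE] := same_positive_simple gaP alP pE.
  have /choice[t tE] := same_positive_simple alP gaP (fun be => iff_sym (pE be)).
  exists s => [|i j]; last by rewrite !sE.
  by exists t => i; [apply: (sf_inj gaP) | apply: (sf_inj alP)]; rewrite -?tE -?sE.
move/existsNP => [j nj].
have rj := sf_root gaP j.
have pj : positive al (- ga j) by case: (positive_or alP rj).
have [gaP' gaE] := reflection_simple_family gaP j.
set ga' := fun k => _ in gaP'.
have [|s sb sE] := IH ga' _ gaP'; last first.
  by exists s => // i k; rewrite -sE gaE.
apply: leq_trans bm; apply: proper_card.
have posE be : positive ga' be -> positive ga (reflection (ga j) be).
  move=> [rb [c cE]]; split; first exact: reflection_root.
  have rD la mu : reflection (ga j) (la + mu) = reflection (ga j) la + reflection (ga j) mu.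
    by have := reflection_linear simple_g hP (ga j) 1 la mu; rewrite !scale1r.
  have r0 : reflection (ga j) 0 = 0 by apply: (addrI (reflection (ga j) 0)); rewrite -rD !addr0.
  exists c; rewrite cE (big_morph _ rD r0); apply: eq_bigr => k _.
  have rMn p : reflection (ga j) (ga' k *+ p) = ga k *+ p.
    elim: p => [|p IHm]; first by rewrite !mulr0n r0.
    by rewrite !mulrS rD IHm reflectionK.
  exact: rMn.
have posN : positive ga' (- ga j).
  rewrite -reflection_self //; exact: (positive_simple gaP').
have [i0 wi0] : exists i0, w i0 = - ga j by apply/(is_weightP bb wP); exact: pj.1.2.
apply/properP; split.
  apply/fintype.subsetP => i; rewrite !inE => /asboolP[pi /posE ni]; apply/asboolP; split=> //.
  have [e|ne] := eqVneq (reflection (ga j) (- w i)) (ga j).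
    have : - w i = - ga j by rewrite -(reflectionK _ _ rj (- w i)) e reflection_self.
    by move/oppr_inj => wi; case: nj; rewrite -wi.
  by have := reflection_positive gaP ni ne; rewrite reflectionK.
exists i0; rewrite inE wi0; first by apply/asboolP; rewrite opprK; split=> //; exact: positive_simple.
apply/asboolP => -[_]; rewrite opprK => H; exact: (positive_not_both gaP' H posN).
Qed.
End WeylTransitivity.

(** * The Lie algebra determines the Cartan matrix *)

Lemma bijective_basis (F : fieldType) (V W : vectType F) (f : {linear V -> W}) (b : seq V) :
  bijective f -> basis_of fullv b -> basis_of fullv [seq f v | v <- b].
Proof.
move=> [f' fK f'K] bb.
have L0 : lker (linfun f) = 0%VS.
  apply/eqP; rewrite -subv0; apply/subvP => v; rewrite memv_ker memv0 lfunE /= => /eqP fv.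
  by rewrite -(fK v) fv -(linear0 f) fK.
have LT : limg (linfun f) = fullv.
  apply/eqP; rewrite eqEsubv subvf /=; apply/subvP => w _.
  by apply/memv_imgP; exists (f' w); rewrite ?memvf // lfunE /= f'K.
have := limg_basis_of (f := linfun f) (U := fullv) _ bb; rewrite LT L0 capv0 => /(_ erefl).
by congr (basis_of _ _); apply: eq_map => v; rewrite lfunE.
Qed.

Lemma lie_isomorphic_sym (F : fieldType) (g1 g2 : lieAlgType F) :
  lie_isomorphic g1 g2 -> lie_isomorphic g2 g1.
Proof.
move=> [f [f' fK f'K] fM].
have f'lin : linear f'.
  by move=> c u v; apply: (can_inj fK); rewrite linearP !f'K.
exists (HB.pack_for {linear g2 -> g1} f' (GRing.isLinear.Build F g2 g1 *:%R f' f'lin)).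
  by exists f.
by move=> x y /=; apply: (can_inj fK); rewrite fM !f'K.
Qed.

Section Theta.
Variables (R : realType) (g1 g2 : lieAlgType R[i]) (h1 : {vspace g1}) (h2 : {vspace g2}).
Hypotheses (simple1 : lie_simple g1) (hP1 : cartan_subalgebra h1).
Hypotheses (simple2 : lie_simple g2) (hP2 : cartan_subalgebra h2).
Local Notation C := R[i].
Variables (I : finType) (al : I -> dual h2).
Hypothesis alP : simple_family al.
Hypothesis iso : lie_isomorphic g1 g2.

(** Choose x in h1 outside the kernels of finitely many nonzero functionals, so
    that every relation of the form w1 l = sum of c i j w1 (s j) that holds at x
    holds identically.  An element of h2 with the spectrum of f x then attaches a
    weight of h1 to each weight of h2, compatibly with the expressions of weights
    by simple roots. *)
Lemma weights_transport : exists ga : I -> dual h1,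
  (forall c : I -> C, is_weight (\sum_i c i *: al i) -> is_weight (\sum_i c i *: ga i)) /\
  (forall mu, is_weight mu -> exists2 c : I -> C,
     mu = \sum_i c i *: ga i & is_weight (\sum_i c i *: al i)).
Proof.
have [f fbij fM] := iso.
pose n := \dim {:g2}.
have dimE : \dim {:g1} = n.
  have [e eE] : exists e : (\dim {:g1}).-tuple g1, basis_of fullv e by exists (vbasis _); exact: vbasisP.
  have /size_basis <- : basis_of fullv [tuple of map f e] by exact: bijective_basis.
  by [].
have [b1 [w1 [bb1 wP1 ww1]]] : exists (b : n.-tuple g1) (w : 'I_n -> dual h1),
    [/\ basis_of fullv b, forall i : 'I_n, in_root_space (w i) b`_i
      & forall mu, is_weight mu <-> exists i, w i = mu].
  rewrite -dimE; have [b [w [bb wP]]] := exists_weight_basis hP1.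
  by exists b, w; split=> // mu; exact: (is_weightP bb wP).
have [b2 [w2 [bb2 wP2]]] := exists_weight_basis hP2.
have ww2 := is_weightP bb2 wP2.
have /choice[c cE] i : exists c : I -> C, w2 i = \sum_j c j *: al j by exact: sf_span.
have /choice[k kE] j : exists k, w2 k = al j by apply/ww2; exact: (sf_root alP j).2.
(* The relations between weights that must not hold at x by accident. *)
pose gen (t : 'I_n * 'I_n * {ffun I -> 'I_n}) : dual h1 :=
  w1 t.1.1 - \sum_j c t.1.2 j *: w1 (t.2 j).
have [x /allP xP] := @common_nonzero _ _ [seq mu <- codom gen | mu != 0] (filter_all _ _).
have genP t : gen t x = 0 :> C -> gen t = 0.
  move=> e; apply/eqP; apply: contraT => t0.
  have : gen t x != 0 :> C by apply: xP; rewrite mem_filter t0 codom_f.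
  by rewrite e eqxx.
have fb : basis_of fullv [tuple of map f b1] by exact: bijective_basis.
have [y perm_yx] : exists y : subvs_of h2,
    perm_eq [seq (w2 i y : C) | i : 'I_n] [seq (w1 i x : C) | i : 'I_n].
  apply: (spectrum_transfer simple2 hP2 bb2 wP2 alP (x := f (vsval x)) fb) => i.
  by rewrite (nth_map 0) ?size_tuple // -fM wP1 linearZ.
have [p pE] : exists p : 'S_n, forall i, w2 i y = w1 (p i) x :> C.
  have /tuple_permP[p pE] : perm_eq [tuple (w2 i y : C) | i < n] [tuple (w1 i x : C) | i < n].
    exact: perm_yx.
  exists p => i; have /(congr1 (fun t : n.-tuple C => tnth t i)) := val_inj pE.
  by rewrite !tnth_mktuple.
exists (fun j => w1 (p (k j))).
have pw i : w1 (p i) = \sum_j c i j *: w1 (p (k j)).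
  have := genP (p i, i, [ffun j => p (k j)]).
  rewrite /gen /=; under eq_bigr do rewrite ffunE.
  move=> G; apply/eqP; rewrite -subr_eq0; apply/eqP/G.
  rewrite add_lfunE opp_lfunE -pE cE !sum_lfunE; apply/eqP; rewrite subr_eq0; apply/eqP.
  by apply: eq_bigr => j _; rewrite !scale_lfunE -pE kE.
split=> [d /ww2[i wi]|mu /ww1[i <-]].
  have dc : d = c i by apply/funext; apply: (sf_coord_inj alP); rewrite -wi cE.
  by apply/ww1; exists (p i); rewrite dc pw.
exists (c ((p^-1)%g i)); first by rewrite -pw permKV.
by apply/ww2; exists ((p^-1)%g i); rewrite cE.
Qed.
End Theta.

Section SameCartanMatrix.
Variables (R : realType) (g1 g2 : lieAlgType R[i]) (h1 : {vspace g1}) (h2 : {vspace g2}).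
Hypotheses (simple1 : lie_simple g1) (hP1 : cartan_subalgebra h1).
Hypotheses (simple2 : lie_simple g2) (hP2 : cartan_subalgebra h2).
Local Notation C := R[i].

Section Span.
Variables (I1 I2 : finType) (al1 : I1 -> dual h1) (ga : I2 -> dual h1).
Hypothesis alP1 : simple_family al1.
Hypothesis gaW : forall mu : dual h1, is_weight mu -> exists c : I2 -> C, mu = \sum_i c i *: ga i.
Local Notation X := [tuple ga (enum_val j) | j < #|I2|].

Lemma weights_span mu : exists c : I2 -> C, mu = \sum_i c i *: ga i.
Proof.
have [d ->] := sf_span alP1 mu.
have /choice[c cE] i : exists c : I2 -> C, al1 i = \sum_j c j *: ga j.
  exact: gaW (sf_root alP1 i).2.
exists (fun j => \sum_i d i * c i j).
rewrite (eq_bigr (fun i => \sum_j (d i * c i j) *: ga j)) => [|i _].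
  by rewrite exchange_big; apply: eq_bigr => j _; rewrite scaler_suml.
by rewrite cE scaler_sumr; apply: eq_bigr => j _; rewrite scalerA.
Qed.

Let XT : <<X>>%VS = fullv.
Proof.
apply/eqP; rewrite eqEsubv subvf /=; apply/subvP => mu _; have [c ->] := weights_span mu.
apply: memv_suml => j _; apply/memvZ/memv_span.
by apply/mapP; exists (enum_rank j); rewrite ?mem_enum ?enum_rankK.
Qed.

Let dimX : \dim {:dual h1} = #|I1|.
Proof.
rewrite -(sf_card alP1) [RHS]dimvf dimvf.
by rewrite -[LHS]/(dim (subvs_of h1) * 1)%N muln1.
Qed.

Lemma weights_span_card : (#|I1| <= #|I2|)%N.
Proof. by rewrite -dimX -XT (leq_trans (dim_span _)) // size_tuple. Qed.

Lemma weights_span_free (c : I2 -> C) : (#|I2| <= #|I1|)%N ->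
  \sum_i c i *: ga i = 0 -> forall i, c i = 0.
Proof.
move=> le c0 i.
have bX : basis_of fullv X by rewrite basisEdim XT subvv dimX size_tuple.
have /freeP/(_ (fun j => c (enum_val j))) := basis_free bX.
move=> H; have := H _ (enum_rank i); rewrite enum_rankK; apply.
rewrite -[RHS]c0 (reindex (@enum_rank I2)); last first.
  by exists enum_val => j _; rewrite ?enum_rankK ?enum_valK.
by apply: eq_bigr => j _; rewrite -(tnth_nth 0) tnth_mktuple enum_rankK.
Qed.
End Span.
End SameCartanMatrix.

Section IsomorphicCartan.
Variables (R : realType) (g1 g2 : lieAlgType R[i]) (h1 : {vspace g1}) (h2 : {vspace g2}).
Hypotheses (simple1 : lie_simple g1) (hP1 : cartan_subalgebra h1).
Hypotheses (simple2 : lie_simple g2) (hP2 : cartan_subalgebra h2).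
Local Notation C := R[i].
Variables (I1 I2 : finType) (al1 : I1 -> dual h1) (al2 : I2 -> dual h2).
Hypotheses (alP1 : simple_family al1) (alP2 : simple_family al2).

(** The correspondence al2 i |-> ga i of [weights_transport] extends to a
    linear map between the duals; it is surjective because it reaches all
    weights, and injective because the ranks agree by symmetry. *)
Lemma isomorphic_same_cartan_matrix : lie_isomorphic g1 g2 ->
  exists2 s : I2 -> I1, bijective s & forall i j,
    al2 j (coroot simple2 hP2 (al2 i)) = al1 (s j) (coroot simple1 hP1 (al1 (s i))) :> C.
Proof.
move=> iso.
have card21 : (#|I2| <= #|I1|)%N.
  have [ga' [_ gaW']] := weights_transport hP2 simple1 hP1 alP1 (lie_isomorphic_sym iso).
  apply: (weights_span_card alP2 (ga := ga')) => mu /gaW'[c -> _]; by exists c.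
have [ga [gaW gaV]] := weights_transport hP1 simple2 hP2 alP2 iso.
have gaV' mu : is_weight mu -> exists c : I2 -> C, mu = \sum_i c i *: ga i.
  by move=> /gaV[c -> _]; exists c.
have gfree c : \sum_i c i *: ga i = 0 -> forall i, c i = 0.
  exact: (weights_span_free alP1 gaV' card21).
have /choice[cf cfE] mu : exists c : I2 -> C, mu = \sum_i c i *: al2 i by exact: sf_span.
pose Th mu : dual h1 := \sum_i cf mu i *: ga i.
have cfK (c : I2 -> C) : cf (\sum_i c i *: al2 i) = c.
  by apply/funext; apply: (sf_coord_inj alP2); rewrite -cfE.
have ThE c : Th (\sum_i c i *: al2 i) = \sum_i c i *: ga i by rewrite /Th cfK.
have Th_lin : linear Th.
  move=> d u v; rewrite [u]cfE [v]cfE scaler_sumr -big_split /=.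
  rewrite (eq_bigr (fun i => (d * cf u i + cf v i) *: al2 i)) => [|i _].
    rewrite !ThE scaler_sumr -big_split; apply: eq_bigr => i _ /=.
    by rewrite scalerDl scalerA.
  by rewrite scalerDl scalerA.
have Th_inj : injective Th.
  move=> u v e; have : Th (- 1 *: u + v) = 0 by rewrite Th_lin e scaleN1r addNr.
  rewrite [- 1 *: u + v]cfE ThE => /gfree c0.
  apply/esym/eqP; rewrite -subr_eq0 addrC -scaleN1r [- 1 *: u + v]cfE big1 // => i _.
  by rewrite c0 scale0r.
have Th_surj mu : exists la, Th la = mu.
  by have [c ->] := weights_span alP1 gaV' mu; exists (\sum_i c i *: al2 i).
have Th_weight la : is_weight la <-> is_weight (Th la).
  split=> [|/gaV[c cE wc]]; first by rewrite {1}[la]cfE => /gaW.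
  by rewrite (_ : la = \sum_i c i *: al2 i) //; apply: Th_inj; rewrite ThE.
have [gP gE] := @transport_simple_family _ g1 g2 h1 h2 simple1 hP1 simple2 hP2 Th
  Th_lin Th_inj Th_surj Th_weight _ al2 alP2.
have [s sb sE] := weyl_transitive simple1 hP1 alP1 gP.
by exists s => // i j; rewrite -sE gE.
Qed.
End IsomorphicCartan.

(** * Root data and quantized enveloping algebras *)

Section RootData.
Variables (R : realType) (g : lieAlgType R[i]) (simple_g : lie_simple g) (D : root_data g).
Local Notation C := R[i].
Local Notation h := (cartan D).
Local Notation hP := (cartanP D).
Local Notation Pi := (simple_roots D).
Local Notation form := (@root_form R g D).
Local Notation al := (@simple_root R g D).
Local Notation coroot := (coroot simple_g hP).

Lemma root_data_family : simple_family al.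
Proof. exact: simple_system_family (simple_rootsP D). Qed.
Local Notation alP := root_data_family.

Lemma simple_root_in i : al i \in Pi.
Proof. by rewrite mem_nth. Qed.

Lemma simple_root_span i : real_span Pi (al i).
Proof.
exists (fun j => (j == i)%:R); rewrite {1}(sf_delta al i).
by apply: eq_bigr => j _; case: (j == i); rewrite /= ?rmorph1 ?rmorph0.
Qed.

Lemma real_span_comb (a : R) la mu : real_span Pi la -> real_span Pi mu ->
  real_span Pi ((a%:C)%C *: la + mu).
Proof.
move=> [c ->] [d ->]; exists (fun i => a * c i + d i).
rewrite scaler_sumr -big_split; apply: eq_bigr => i _.
by rewrite rmorphD rmorphM /= scalerDl scalerA.
Qed.

(** Compare the form on (al i, al j) with the form on the images of these under
    the reflection in al i. *)
Lemma root_form_cartan i j k : al j (coroot (al i)) = - (k%:R : C) ->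
  2 * form (al i) (al j) = - k%:R * form (al i) (al i) /\
  2 * form (al j) (al i) = - k%:R * form (al i) (al i).
Proof.
move=> kE; have [bil inv _] := root_formP D.
have ri := sf_root alP i; have Si := simple_root_span i; have Sj := simple_root_span j.
have W : weyl_group (fun la => la - (la (coroot (al i)) : C) *: al i).
  by apply: (weyl_reflection ri (corootP simple_g hP ri)); exact: weyl_id.
(* - al i is written as (-2) al i + al i, which bilinearity on the real span accepts. *)
have sj : al j - (al j (coroot (al i)) : C) *: al i = ((k%:R : R)%:C)%C *: al i + al j.
  by rewrite kE scaleNr opprK addrC rmorph_nat.
have si : al i - (al i (coroot (al i)) : C) *: al i = ((-2 : R)%:C)%C *: al i + al i.
  by rewrite (coroot2 simple_g hP ri) addrC rmorphN rmorph_nat scaleNr.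
have [S1 S2] := (real_span_comb (-2) Si Si, real_span_comb k%:R Si Sj).
split.
  have := inv _ _ _ W Si Sj; rewrite sj si.
  rewrite (bil _ _ _ (-2) Si Si S2).1 (bil _ _ _ k%:R Si Sj Si).2; lra.
have := inv _ _ _ W Sj Si; rewrite sj si.
rewrite (bil _ _ _ (-2) Si Si S2).2 (bil _ _ _ k%:R Si Sj Si).1; lra.
Qed.

Lemma exists_short_root : exists2 m, form (al m) (al m) = 2 &
  forall i, 2 <= form (al i) (al i).
Proof.
have [_ _ norm] := root_formP D; have [i0] := sf_nonempty simple_g hP alP.
have [m _ mP] := @arg_minP _ R _ i0 xpredT (fun i => form (al i) (al i)) isT.
have sh : short Pi form (al m).
  by move=> be /(nthP 0)[i iPi <-]; exact: (mP (Ordinal iPi)).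
have m2 := norm _ (simple_root_in m) sh; exists m => // i.
by rewrite -m2; exact: mP.
Qed.

Lemma serre_orderE i j k : al j (coroot (al i)) = - (k%:R : C) ->
  serre_order i j = k.+1.
Proof.
move=> kE; have [e _] := root_form_cartan kE.
have [_ _ /(_ i) F2] := exists_short_root.
rewrite /serre_order /cartan_integer e mulfK; last by apply: lt0r_neq0; lra.
by rewrite opprK -(natrD _ 1 k) add1n natrK.
Qed.

Lemma half_length_gt0 (i : 'I_(rank D)) : (0 < half_length i)%N.
Proof.
have [_ _ /(_ i) F2] := exists_short_root.
by rewrite truncn_gt0; lra.
Qed.

Lemma root_data_cartan i j : i != j -> exists k : nat, al j (coroot (al i)) = - k%:R :> C.
Proof. by move=> ij; have [k [kE _ _]] := cartan_string simple_g hP alP ij; exists k. Qed.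

Lemma serre_order_gt0 (i j : 'I_(rank D)) : i != j -> (0 < serre_order i j)%N.
Proof. by move=> /root_data_cartan[k /serre_orderE ->]. Qed.

Lemma serre_orderC (i j : 'I_(rank D)) : i != j -> serre_order i j = 1%N -> serre_order j i = 1%N.
Proof.
move=> ij; have ji : j != i by rewrite eq_sym.
have [k kE] := root_data_cartan ij; have [l lE] := root_data_cartan ji.
rewrite (serre_orderE kE) (serre_orderE lE) => -[k0].
have aij0 : al j (coroot (al i)) = 0 by rewrite kE k0 oppr0.
have := cartan_zero_sym alP aij0; rewrite lE => /eqP.
by rewrite oppr_eq0 -[_ == _]/((l%:R : C) == 0) pnatr_eq0 => /eqP ->.
Qed.

(** The product of the two Cartan integers is 1, 2 or 3, so one of them is -1. *)
Lemma serre_order_even (i j : 'I_(rank D)) : i != j -> serre_order i j != 1%N ->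
  ~~ odd (serre_order i j) || ~~ odd (serre_order j i).
Proof.
move=> ij m1; have ji : j != i by rewrite eq_sym.
have mji : serre_order j i != 1%N by apply: contra_neq m1; exact: serre_orderC.
move: m1 mji; have [k kE] := root_data_cartan ij; have [l lE] := root_data_cartan ji.
rewrite (serre_orderE kE) (serre_orderE lE).
(* Both are nonzero and their product is at most 3. *)
have := cartan_product_lt4 alP ij kE lE; move: k l {kE lE}.
by case=> [|[|[|[|k]]]] [|[|[|[|l]]]] //; lia.
Qed.
End RootData.

Section Classification.
Variables (R : realType) (g1 g2 : lieAlgType R[i]).
Hypotheses (simple_g1 : lie_simple g1) (simple_g2 : lie_simple g2).
Variables (D1 : root_data g1) (D2 : root_data g2).
Local Notation C := R[i].
Local Notation al1 := (@simple_root R g1 D1).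
Local Notation al2 := (@simple_root R g2 D2).
Local Notation crt1 := (coroot simple_g1 (cartanP D1)).
Local Notation crt2 := (coroot simple_g2 (cartanP D2)).
Local Notation form1 := (@root_form R g1 D1).
Local Notation form2 := (@root_form R g2 D2).

Definition same_cartan_matrix (s : 'I_(rank D1) -> 'I_(rank D2)) := forall i j,
  al1 j (crt1 (al1 i)) = al2 (s j) (crt2 (al2 (s i))) :> C.

Lemma same_serre_order s i j : same_cartan_matrix s -> i != j ->
  serre_order i j = serre_order (s i) (s j).
Proof.
move=> sE ij; have [k kE] := root_data_cartan simple_g1 ij.
by rewrite (serre_orderE kE) (@serre_orderE _ _ simple_g2 _ _ _ k) // -sE.
Qed.

Lemma serre_order_same s : injective s ->
    (forall i j, i != j -> serre_order i j = serre_order (s i) (s j)) ->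
  same_cartan_matrix s.
Proof.
move=> s_inj sE i j; have [->|ij] := eqVneq i j.
  rewrite (coroot2 simple_g1 (cartanP D1) (sf_root (root_data_family D1) j)).
  by rewrite (coroot2 simple_g2 (cartanP D2) (sf_root (root_data_family D2) (s j))).
have sij : s i != s j by rewrite (inj_eq s_inj).
have [k kE] := root_data_cartan simple_g1 ij; have [l lE] := root_data_cartan simple_g2 sij.
rewrite kE lE; have := sE i j ij; rewrite (serre_orderE kE) (serre_orderE lE).
by case=> ->.
Qed.

(** Along an edge of the Dynkin diagram, the ratio of square lengths is the
    ratio of Cartan integers.  As the diagram is connected, the two forms are
    proportional, and both have minimum 2 on simple roots. *)
Lemma same_half_length s : bijective s -> same_cartan_matrix s ->
  forall i, half_length i = half_length (s i).
Proof.
move=> [t sK tK] sE.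
have [m m2 mP] := exists_short_root simple_g1 D1.
have [p p2 pP] := exists_short_root simple_g2 D2.
pose J i := form1 (al1 i) (al1 i) * form2 (al2 (s m)) (al2 (s m))
            == form1 (al1 m) (al1 m) * form2 (al2 (s i)) (al2 (s i)).
have [e [f ef]] := exists_chevalley simple_g1 (cartanP D1) (root_data_family D1).
have Jall : forall i, J i.
  apply: (sf_connected (root_data_family D1) ef (i0 := m)); first by rewrite /J.
  move=> i j Ji nJj; have ij : i != j by apply: contraNneq nJj => <-.
  have ji : j != i by rewrite eq_sym.
  have [k kE] := root_data_cartan simple_g1 ij; have [l lE] := root_data_cartan simple_g1 ji.
  apply: contrapT => a0; case/negP: nJj; apply/eqP.
  have [_ e1] := root_form_cartan kE; have [e2 _] := root_form_cartan lE.
  have kE' : al2 (s j) (crt2 (al2 (s i))) = - k%:R :> C by rewrite -sE.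
  have lE' : al2 (s i) (crt2 (al2 (s j))) = - l%:R :> C by rewrite -sE.
  have [_ e3] := root_form_cartan kE'; have [e4 _] := root_form_cartan lE'.
  have k0 : (l%:R : R) != 0.
    rewrite pnatr_eq0; apply/negP => /eqP l0; apply: a0.
    by apply: (cartan_zero_sym (root_data_family D1)); rewrite lE l0 oppr0.
  move/eqP: Ji => Ji; apply: (mulfI k0).
  have E1 : l%:R * form1 (al1 j) (al1 j) = k%:R * form1 (al1 i) (al1 i) by lra.
  have E2 : l%:R * form2 (al2 (s j)) (al2 (s j)) = k%:R * form2 (al2 (s i)) (al2 (s i)) by lra.
  by rewrite mulrA E1 -mulrA Ji [RHS]mulrCA E2; ring.
move=> i; rewrite /half_length; congr (Num.truncn (_ / 2)).
have /eqP := Jall (t p); rewrite tK p2 m2 => Ep.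
have := mP (t p); have := pP (s m) => h1 h2.
(* Both factors are at least 2 and their product is 4. *)
have {}Ep : form2 (al2 (s m)) (al2 (s m)) = 2 by nra.
by have /eqP := Jall i; rewrite Ep m2; lra.
Qed.

Lemma same_cartan_matrix_lie_isomorphic s : bijective s -> same_cartan_matrix s ->
  lie_isomorphic g1 g2.
Proof.
move=> [t sK tK] sE; have P2 := root_data_family D2.
have P2s : simple_family (fun i => al2 (s i)).
  have sum_s (V : nmodType) (F : 'I_(rank D2) -> V) : \sum_i F (s i) = \sum_i F i.
    by rewrite [RHS](reindex s) //; exists t => i _; rewrite ?sK ?tK.
  split=> [i|c c0 i|mu|be].
  - exact: sf_root P2 (s i).
  - rewrite -(sK i); apply: (sf_free P2 (c := fun i => c (t i))).
    by rewrite -sum_s -[RHS]c0; apply: eq_bigr => j _; rewrite sK.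
  - by have [c ->] := sf_span P2 mu; exists (fun i => c (s i)); rewrite -sum_s.
  move=> /(sf_sign P2)[c cE]; exists (fun i => c (s i)).
  by rewrite (sum_s _ (fun i => al2 i *+ c i)).
have [e1 [f1 ef1]] := exists_chevalley simple_g1 (cartanP D1) (root_data_family D1).
have [e2 [f2 ef2]] := exists_chevalley simple_g2 (cartanP D2) P2s.
exact: (same_cartan_matrix_isomorphic (root_data_family D1) P2s sE ef1 ef2).
Qed.

Variables (K : fieldType) (q : K).
Hypotheses (q_neq0 : q != 0) (qX_neq1 : forall n : nat, (0 < n)%N -> q ^+ n != 1).

Definition serre_data_of (g : lieAlgType C) (simple_g : lie_simple g) (D : root_data g) :=
  SerreData (half_length_gt0 simple_g (D := D)) (serre_order_gt0 simple_g (D := D))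
    (serre_orderC simple_g (D := D)) (serre_order_even simple_g (D := D)).

Lemma serre_relatorsE (g : lieAlgType C) (simple_g : lie_simple g) (D : root_data g) r :
  serre_relators D q r <-> exists i j : 'I_(rank D), i != j /\
    r = qserre (q ^+ sd_len (serre_data_of simple_g D) i)
          (sd_order (serre_data_of simple_g D) i j) (free_gen K i) (free_gen K j).
Proof. by []. Qed.

Lemma Uq_isomorphic :
  alg_isomorphic (presented_algebra (serre_relators D1 q))
                 (presented_algebra (serre_relators D2 q)) <-> lie_isomorphic g1 g2.
Proof.
split=> [iso|iso].
  have [s sb sE] := serre_rigidity q_neq0 qX_neq1 (D1 := serre_data_of simple_g1 D1)
    (D2 := serre_data_of simple_g2 D2) (@serre_relatorsE g1 simple_g1 D1) (@serre_relatorsE g2 simple_g2 D2) iso.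
  apply: (same_cartan_matrix_lie_isomorphic sb).
  exact: serre_order_same (bij_inj sb) sE.
have [s sb sE] := isomorphic_same_cartan_matrix simple_g2 (cartanP D2) simple_g1 (cartanP D1)
  (root_data_family D2) (root_data_family D1) (lie_isomorphic_sym iso).
have sC : same_cartan_matrix s by move=> i j; exact: sE.
apply: (relabel_isomorphic (@serre_relatorsE g1 simple_g1 D1) (@serre_relatorsE g2 simple_g2 D2) sb).
  exact: same_half_length.
by move=> i j; exact: same_serre_order.
Qed.
End Classification.

Theorem corollary6p10 (R : realType) (g1 g2 : lieAlgType R[i])
    (simple_g1 : lie_simple g1) (simple_g2 : lie_simple g2)
    (D1 : root_data g1) (D2 : root_data g2)
    (K : fieldType) (q : K) (q_neq0 : q != 0)
    (q_not_root_of_1 : forall n : nat, (0 < n)%N -> q ^+ n != 1) :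
  (alg_isomorphic (Uq_plus D1 q) (Uq_plus D2 q) <-> lie_isomorphic g1 g2) /\
  (alg_isomorphic (Uq_minus D1 q) (Uq_minus D2 q) <-> lie_isomorphic g1 g2).
Proof. by split; exact: Uq_isomorphic. Qed.
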